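(* Let $n\ge 2$ be an integer and $k$ a field whose characteristic is zero or greater than $(n+1)/2$. Let $S=k[p_1,\dots,p_n,q_1,\dots,q_n]$ be the polynomial ring, $\mathbb{N}^2$-graded with $\deg p_i=[1,0]$ and $\deg q_i=[0,1]$, and let $$B=S/\bigl(\{p_iq_j,\ p_iq_i-p_jq_j \mid 1\le i,j\le n,\ i\neq j\}\bigr).$$ The trigraded Poincaré series of $B$ over $S$ is $$P^S_B(s,t,u)=1+u^{-1}\Bigl(1-(1+su)^n-(1+tu)^n+\bigl[(1-stu^2)(1+su)^n(1+tu)^n\bigr]_+\Bigr)+u^{-2}\bigl[(stu^2-1)(1+su)^n(1+tu)^n\bigr]_+ .$$ The Poincaré series is thus $$P^S_B(u)=1-2u^{-1}\bigl[(1+u)^n-1\bigr]+u^{-1}\bigl[(1-u^2)(1+u)^{2n}-1\bigr]_+ + u^{-2}\bigl[(u^2-1)(1+u)^{2n}\bigr]_+ ,$$ so the Betti numbers of $B$ over $S$ are $$\beta^S_i(B)=\begin{cases}1 & \text{for } i=0,\\ \binom{2n}{i+1}-\binom{2n}{i-1}-2\binom{n}{i+1} & \text{for } 1\le i\le n-1,\\ \binom{2n}{i}-\binom{2n}{i+2} & \text{for } n\le i\le 2n.\end{cases}$$ Moreover, $\dim B=n$ and $\operatorname{depth} B=0$.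
   Context: For a finitely generated $\mathbb{N}^2$-graded $S$-module $M$, the graded Betti numbers are $\beta^S_{i,v}(M)=\operatorname{rank}_k\operatorname{Tor}^S_i(k,M)_v$ for $i\in\mathbb{N}$, $v=[v_1,v_2]\in\mathbb{N}^2$, where $k$ is $S$ modulo its homogeneous maximal ideal; $\beta^S_i(M)=\sum_v\beta^S_{i,v}(M)$. The trigraded Poincaré series is $P^S_M(s,t,u)=\sum_{i,v}\beta^S_{i,v}(M)s^{v_1}t^{v_2}u^i$, and $P^S_M(u)=\sum_i\beta^S_i(M)u^i$. For a polynomial $h$ with integer coefficients, $[h]_+$ denotes its positive part, obtained by omitting all the terms (monomials) whose coefficients are negative integers. In the second display, $\bigl[(1+u)^n-1\bigr]$ without subscript $+$ are ordinary brackets. $\dim$ is Krull dimension and $\operatorname{depth}$ is taken with respect to the homogeneous maximal ideal. *)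

(* Defs.v *)
From HB Require Import structures.
From mathcomp Require Import all_boot all_order all_algebra.
From mathcomp Require Import ring_quotient generic_quotient fraction.
From mathcomp Require Import boolp.
From mathcomp Require Export mpoly.

Set Implicit Arguments.
Unset Strict Implicit.
Unset Printing Implicit Defensive.

Import Order.TTheory GRing.Theory Num.Theory.
Local Open Scope ring_scope.
Local Open Scope quotient_scope.

Section QuotientModule.
Variables (R : comNzRingType) (I : idealr R).
Implicit Types (a b : R) (x y : {ideal_quot I}).

Definition quot_scale a x : {ideal_quot I} := \pi_({ideal_quot I}) a * x.

Lemma quot_scaleA a b x : quot_scale a (quot_scale b x) = quot_scale (a * b) x.
Proof. by rewrite /quot_scale rmorphM mulrA. Qed.

Lemma quot_scale1 x : quot_scale 1 x = x.
Proof. by rewrite /quot_scale rmorph1 mul1r. Qed.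

Lemma quot_scaleDr a : {morph quot_scale a : x y / x + y}.
Proof. by move=> x y; rewrite /quot_scale mulrDr. Qed.

Lemma quot_scaleDl x : {morph quot_scale^~ x : a b / a + b}.
Proof. by move=> a b; rewrite /quot_scale rmorphD mulrDl. Qed.

HB.instance Definition _ := GRing.Zmodule_isLmodule.Build R {ideal_quot I}
  quot_scaleA quot_scale1 quot_scaleDr quot_scaleDl.

End QuotientModule.

Section KrullDimension.
Variable R : comNzRingType.

Definition prime_chain (d : nat) (P : 'I_d.+1 -> prime_idealr R) : Prop :=
  forall i j : 'I_d.+1, (i < j)%N ->
    {subset (P i : pred R) <= (P j : pred R)} /\
    (exists2 x, x \in (P j : pred R) & x \notin (P i : pred R)).

Definition krull_dim (d : nat) : Prop :=
  (exists P : 'I_d.+1 -> prime_idealr R, prime_chain P) /\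
  (forall e (P : 'I_e.+1 -> prime_idealr R), prime_chain P -> (e <= d)%N).

End KrullDimension.

Section Depth.
Variables (R : comNzRingType) (I : idealr R) (M : lmodType R).

(* x lies in (s_0, s_1, ...) M *)
Definition in_seq_mul (s : seq R) (x : M) : Prop :=
  exists y : 'I_(size s) -> M, x = \sum_(i < size s) s`_i *: y i.

Definition regular_seq (s : seq R) : Prop :=
  (forall i, (i < size s)%N -> forall x : M,
     in_seq_mul (take i s) (s`_i *: x) -> in_seq_mul (take i s) x) /\
  (exists x : M, ~ in_seq_mul s x).

Definition depth_is (d : nat) : Prop :=
  (exists s : seq R,
     [/\ {subset s <= (I : pred R)}, regular_seq s & size s = d]) /\
  (forall s : seq R,
     {subset s <= (I : pred R)} -> regular_seq s -> (size s <= d)%N).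

End Depth.

Section BigradedRing.
Variables (n : nat) (k : fieldType).

Notation S := {mpoly k[n + n]}.

Definition pvar (i : 'I_n) : S := 'X_(lshift n i).
Definition qvar (i : 'I_n) : S := 'X_(rshift n i).

Definition bideg (m : 'X_{1..n + n}) : nat * nat :=
  (\sum_(i < n) m (lshift n i), \sum_(i < n) m (rshift n i))%N.

Definition add_bideg (v w : nat * nat) : nat * nat :=
  (v.1 + w.1, v.2 + w.2)%N.

Definition bihomog (v : nat * nat) (f : S) : Prop :=
  forall m, m \in msupp f -> bideg m = v.

(* Membership is made boolean, as the library quotients require. *)
Definition ideal_gen (G : seq S) : pred S := fun f =>
  `[< exists c : 'I_(size G) -> S, f = \sum_(i < size G) c i * G`_i >].

Lemma ideal_gen_closed (G : seq S) :
  (forall g, g \in G -> g@_0%MM = 0) -> idealr_closed (ideal_gen G).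
Proof.
move=> G0; split; rewrite ?unfold_in.
- by apply/asboolP; exists (fun=> 0); rewrite big1 // => i _; rewrite mul0r.
- apply/asboolP => -[c /(congr1 (mcoeff 0%MM))] /eqP.
  rewrite mcoeff1 eqxx raddf_sum big1 ?oner_eq0 // => i _.
  by rewrite /= rmorphM /= (G0 _ (mem_nth 0 (ltn_ord i))) mulr0.
- move=> a u v; rewrite !unfold_in => /asboolP[c ->] /asboolP[d ->].
  apply/asboolP; exists (fun i => a * c i + d i).
  rewrite mulr_sumr -big_split /=; apply: eq_bigr => i _.
  by rewrite mulrDl mulrA.
Qed.

Definition max_gens : seq S := [seq 'X_i | i <- enum 'I_(n + n)].

Definition B_gens : seq S :=
  [seq pvar ij.1 * qvar ij.2 | ij <- enum [pred ij : 'I_n * 'I_n | ij.1 != ij.2]]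
  ++ [seq pvar ij.1 * qvar ij.1 - pvar ij.2 * qvar ij.2
        | ij <- enum [pred ij : 'I_n * 'I_n | ij.1 != ij.2]].

Definition max_ideal : pred S := ideal_gen max_gens.
Definition B_ideal : pred S := ideal_gen B_gens.

Lemma mcoeff0X (i : 'I_(n + n)) : ('X_i : S)@_0%MM = 0.
Proof. by rewrite mcoeffX mnm1_eq0. Qed.

Lemma max_ideal_closed : idealr_closed max_ideal.
Proof.
by apply: ideal_gen_closed => g /mapP[i _ ->]; exact: mcoeff0X.
Qed.

Lemma B_ideal_closed : idealr_closed B_ideal.
Proof.
apply: ideal_gen_closed => g; rewrite mem_cat => /orP[] /mapP[ij _ ->];
  by rewrite ?raddfB /= !rmorphM /= !mcoeff0X !mulr0 ?subrr.
Qed.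

HB.instance Definition _ := isIdealr.Build S max_ideal max_ideal_closed.
HB.instance Definition _ := isIdealr.Build S B_ideal B_ideal_closed.

Definition residue_field := {ideal_quot (max_ideal : idealr S)}.
Definition B := {ideal_quot (B_ideal : idealr S)}.

HB.instance Definition _ := GRing.ComNzRing.on residue_field.
HB.instance Definition _ := GRing.Lmodule.on residue_field.
HB.instance Definition _ := GRing.ComNzRing.on B.
HB.instance Definition _ := GRing.Lmodule.on B.

Definition quot_part (I : idealr S) (v : nat * nat) (x : {ideal_quot I}) : Prop :=
  exists2 f : S, bihomog v f & x = \pi_({ideal_quot I}) f.

Definition residue_part : nat * nat -> residue_field -> Prop :=
  @quot_part max_ideal.
Definition B_part : nat * nat -> B -> Prop := @quot_part B_ideal.

(* Finite free bigraded modules F_0, F_1, ..., where F_i has a basis indexed  *)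
(* by 'I_(crk i) whose a-th element has degree cdeg i a, and maps             *)
(* F_(i+1) -> F_i acting on row vectors by right multiplication by cdiff i.   *)
Record free_seq := FreeSeq {
  crk : nat -> nat;
  cdeg : forall i, 'I_(crk i) -> nat * nat;
  cdiff : forall i, 'M[S]_(crk i.+1, crk i)
}.

Section Tor.
Variables (N : lmodType S) (Npart : nat * nat -> N -> Prop).
Variables (M : lmodType S) (Mpart : nat * nat -> M -> Prop).

Definition augmentation (F : free_seq) (eps : 'I_(crk F 0) -> N)
  (v : 'rV[S]_(crk F 0)) : N := \sum_a v 0 a *: eps a.

(* ... -> F_1 -> F_0 -> N -> 0 is exact with all maps of degree [0,0]. *)
Definition graded_free_resolution (F : free_seq) (eps : 'I_(crk F 0) -> N) : Prop :=
  [/\ (forall i a b m, m \in msupp (cdiff F i a b) ->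
         cdeg a = add_bideg (bideg m) (cdeg b)) /\
      (forall a, Npart (cdeg a) (eps a)),
      forall y : N, exists v, y = augmentation eps v,
      forall v, augmentation eps v = 0 <-> exists w, v = w *m cdiff F 0
    & forall i (v : 'rV[S]_(crk F i.+1)),
        v *m cdiff F i = 0 <-> exists w, v = w *m cdiff F i.+1].

(* F_i (x) M is identified with M^(crk i). *)
Definition tensor_diff (F : free_seq) i (x : {ffun 'I_(crk F i.+1) -> M}) :
    {ffun 'I_(crk F i) -> M} :=
  [ffun b => \sum_a cdiff F i a b *: x a].

Definition tensor_part (F : free_seq) i (v : nat * nat)
    (x : {ffun 'I_(crk F i) -> M}) : Prop :=
  forall a, x a = 0 \/ exists2 w, Mpart w (x a) & v = add_bideg w (cdeg a).

Definition tensor_cycle (F : free_seq) i : {ffun 'I_(crk F i) -> M} -> Prop :=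
  match i with
  | 0 => fun=> True
  | j.+1 => fun x => tensor_diff x = 0
  end.

Definition tensor_boundary (F : free_seq) i (v : nat * nat)
    (x : {ffun 'I_(crk F i) -> M}) : Prop :=
  exists2 y : {ffun 'I_(crk F i.+1) -> M}, tensor_part v y & x = tensor_diff y.

(* For k-subspaces D of Z, Z / D has a k-basis with d elements. *)
Definition quot_rank (W : lmodType S) (Z D : W -> Prop) (d : nat) : Prop :=
  exists2 e : 'I_d -> W, forall j, Z (e j) &
    forall z, Z z ->
      exists! c : {ffun 'I_d -> k}, D (z - \sum_j (c j)%:MP *: e j).

Definition tor_rank (i : nat) (v : nat * nat) (d : nat) : Prop :=
  (exists F eps, @graded_free_resolution F eps) /\
  (forall F eps, @graded_free_resolution F eps ->
     quot_rank (fun x : {ffun 'I_(crk F i) -> M} =>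
                  tensor_part v x /\ tensor_cycle x)
               (@tensor_boundary F i v) d).

End Tor.

Section Betti.
Variables (M : lmodType S) (Mpart : nat * nat -> M -> Prop).

Definition graded_betti (i : nat) (v : nat * nat) (b : nat) : Prop :=
  tor_rank residue_part Mpart i v b.

Definition total_betti (i b : nat) : Prop :=
  exists beta : nat * nat -> nat,
    (forall v, graded_betti i v (beta v)) /\
    exists2 d : nat,
      forall v, (d <= v.1)%N || (d <= v.2)%N -> beta v = 0%N &
      b = (\sum_(v1 < d) \sum_(v2 < d) beta (v1 : nat, v2 : nat))%N.

(* The series is a polynomial; the variables of {mpoly int[3]} are s, t, u. *)
Definition trigraded_poincare (P : {mpoly int[3]}) : Prop :=
  forall i v1 v2, exists2 b : nat,
    graded_betti i (v1, v2) b & P@_[multinom [tuple v1; v2; i]] = b%:Z.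

Definition poincare (P : {poly int}) : Prop :=
  forall i, exists2 b : nat, total_betti i b & P`_i = b%:Z.

End Betti.

End BigradedRing.

Definition svar : {mpoly int[3]} := 'X_(inord 0).
Definition tvar : {mpoly int[3]} := 'X_(inord 1).
Definition uvar : {mpoly int[3]} := 'X_(inord 2).

Definition mpos_part (r : nat) (h : {mpoly int[r]}) : {mpoly int[r]} :=
  \sum_(m <- msupp h | 0 < h@_m) h@_m *: 'X_[m].

Definition pos_part (h : {poly int}) : {poly int} :=
  \poly_(i < size h) (if 0 < h`_i then h`_i else 0).

(* Main.v *)
From HB Require Import structures.
Require Import Defs.
From mathcomp Require Import all_boot all_order all_algebra fraction.
From mathcomp Require Import ring_quotient generic_quotient.
From mathcomp Require Import boolp ring zify.
Set Implicit Arguments.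
Unset Strict Implicit.
Unset Printing Implicit Defensive.
Import GRing.Theory Num.Theory Order.TTheory.
Local Open Scope ring_scope.
Local Open Scope quotient_scope.

(** The Betti numbers of [B] are the dimensions of [Tor (k, B)], and [Tor]
    does not depend on the resolution ([quot_rank_resolution]), so they can be
    read off the Koszul complex [K], which resolves the residue field
    ([koszul_resolution]).  The task is to compute the homology of [K (x) B].

    As a vector space [B] is simple: all products [p_i q_i] equal one element
    [w], which the maximal ideal kills, and the monomials in the [p_i],
    those in the [q_i], and [w] form a basis ([B_idealP]).  In homological
    degree [i] and bidegree [v], chains have coefficients of degree
    [e = v.1 + v.2 - i].  Apart from [w], the complex is two Koszul complexes,
    over [k[p]] and over [k[q]], which have an explicit contracting homotopy
    ([khom_homotopy]) and share only their constants.  Hence nothing survives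
    for [e >= 3], and only the unit for [e <= 0].  The element [w] links the
    two remaining cases: taking the [p]-part of the boundary of a constant
    chain [y], and then the boundary of that, gives [w] times [lef y], where
    [lef] is the contraction with [p_1 q_1 + ... + p_n q_n] on the exterior
    algebra, from bidegree [(a+1, b+1)] to bidegree [(a, b)]
    ([socle_component]).  The homology is the cokernel of [lef] for [e = 2]
    ([rank_coker]) and its kernel for [e = 1] ([rank_ker]).

    The operator [lef] has maximal rank ([lef_surj], [lef_inj]).  After a
    change of signs ([twist]) and with the unpaired indices fixed, it is the
    incidence matrix between two consecutive levels of a Boolean lattice, whose
    inverse at the middle levels [s], [s+1] is explicit
    ([subset_lattice_delta]).  This requires [(s+1)!] to be invertible, and
    [2 (s+1) <= n+1]: here the characteristic enters.  So the graded Betti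
    numbers are the positive parts of the differences of
    ['C(n, a.+1) * 'C(n, b.+1)] and ['C(n, a) * 'C(n, b)] ([betti]).  These are
    the coefficients of the two bracketed polynomials.  The sign of the
    difference depends only on [a + b] ([binprod_le], [binprod_ge]), so taking
    positive parts commutes with summing over an antidiagonal, and
    Vandermonde's identity gives the total Betti numbers ([total_low],
    [total_high]).

    For the dimension, every prime of [B] contains all [p_i] or all [q_i]
    ([prime_contains]), so its quotient is generated by [n] elements.  Any
    [n+1] polynomials in [n] variables are algebraically dependent
    ([algebraic_dependence]), while elements taken from the successive steps
    of a chain of primes are independent in the sense needed ([no_relation]);
    thus chains have length at most [n].  The depth is zero because [w] is a
    nonzero element killed by the maximal ideal ([depth_B]). *)

(** * Ranks of subquotients *)

Section Extend.
Variables (U : finType) (V : zmodType) (T : {set U}).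
Implicit Types x y : 'I_#|T| -> V.

(** Free modules have bases indexed by ordinals, while the basis vectors of a
    Koszul complex are sets; this passes from the former to the latter, with
    the value zero outside [T]. *)
Definition extend x (A : U) : V := \sum_(a | enum_val a == A) x a.

Lemma extend_val x a : extend x (enum_val a) = x a.
Proof.
rewrite /extend (bigD1 a) //= big1 ?addr0 // => b /andP[/eqP E].
by rewrite (enum_val_inj E) eqxx.
Qed.

Lemma extend_out x A : A \notin T -> extend x A = 0.
Proof. by move=> TA; rewrite /extend big1 // => a /eqP E; rewrite -E enum_valP in TA. Qed.

Lemma extend_in x A (TA : A \in T) : extend x A = x (enum_rank_in TA A).
Proof. by rewrite -{1}(enum_rankK_in TA TA) extend_val. Qed.

Lemma extendB x y A : extend (fun a => x a - y a) A = extend x A - extend y A.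
Proof. by rewrite /extend sumrB. Qed.

End Extend.

Section Rank.
Variable k : fieldType.

(** The scalar action is an argument because the [k]-structures that occur are
    of different kinds: on matrices, on functions, and on [S]-modules through
    the constant polynomials. *)
Definition krank (W : zmodType) (sc : k -> W -> W) (Z D : W -> Prop) (d : nat) :=
  exists2 e : 'I_d -> W, forall j, Z (e j) &
    forall z, Z z -> exists! c : {ffun 'I_d -> k}, D (z - \sum_j sc (c j) (e j)).

Lemma krank0 (W : zmodType) (sc : k -> W -> W) (Z D : W -> Prop) :
  (forall z, Z z -> D z) -> krank sc Z D 0.
Proof.
move=> H; exists (fun=> 0) => [[]//|z Zz].
exists [ffun=> 0]; split=> [|c _]; first by rewrite big_ord0 subr0; exact: H.
by apply/ffunP => -[].
Qed.

(** A [k]-linear map that identifies [Z' / D'] with [Z / D] carries a basis of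
    the former to a basis of the latter. *)
Lemma krank_transfer (W W' : zmodType) (sc : k -> W -> W) (sc' : k -> W' -> W')
    (Z D : W -> Prop) (Z' D' : W' -> Prop) (g : W' -> W) d :
    (forall x y, g (x - y) = g x - g y) ->
    (forall c x, g (sc' c x) = sc c (g x)) ->
    (forall x y, Z' x -> Z' y -> Z' (x - y)) ->
    (forall c x, Z' x -> Z' (sc' c x)) ->
    (forall x y, D x -> D y -> D (x - y)) ->
    (forall z, Z' z -> Z (g z)) ->
    (forall z, Z z -> exists2 z', Z' z' & D (z - g z')) ->
    (forall z, Z' z -> D (g z) <-> D' z) ->
  krank sc' Z' D' d -> krank sc Z D d.
Proof.
move=> gB gZ ZB ZZ DB gZZ cov gD [e eZ eU].
have g0 : g 0 = 0 by rewrite -(subrr 0) gB subrr.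
have gN x : g (- x) = - g x by rewrite -sub0r gB g0 sub0r.
have gA x y : g (x + y) = g x + g y by rewrite -{1}(opprK y) gB gN opprK.
have gS (c : {ffun 'I_d -> k}) :
    g (\sum_j sc' (c j) (e j)) = \sum_j sc (c j) (g (e j)).
  rewrite (big_morph g gA g0); apply: eq_bigr => j _; exact: gZ.
have ZA x y : Z' x -> Z' y -> Z' (x + y).
  move=> Zx Zy; have ZN : Z' (- y) by rewrite -sub0r -(subrr y); do 2!apply: (ZB) => //.
  by rewrite -[y]opprK; apply: ZB.
have ZS z (c : {ffun 'I_d -> k}) : Z' z -> Z' (z - \sum_j sc' (c j) (e j)).
  move=> Zz; rewrite -sumrN; elim/big_rec: _ => [|j x _ Zx]; first by rewrite addr0.
  by rewrite addrCA addrC; apply: ZB => //; apply: ZZ.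
have D0 x : D x -> D 0 by move=> Dx; rewrite -(subrr x); apply: DB.
have DN x : D x -> D (- x) by move=> Dx; rewrite -sub0r; apply: DB => //; exact: D0 Dx.
exists (g \o e) => [j|z Zz] /=; first exact: gZZ.
have [z' Zz' Dz'] := cov z Zz.
have [c [Dc cU]] := eU z' Zz'.
exists c; split=> [|c2 Dc2].
  rewrite -gS -(subrK (g z') z) -addrA -gB -[g (z' - _)]opprK.
  by apply: DB => //; apply/DN/gD => //; apply: ZS.
apply: cU; apply/gD; first exact: ZS.
rewrite gB gS -(subrK z (g z')) -addrA -[_ + (z - _)]opprK opprD opprB.
by apply: DN; apply: DB.
Qed.

Lemma krank_ker m r (A : 'M[k]_(m, r)) :
  krank *:%R (fun z : 'rV_m => z *m A = 0) (fun z => z = 0) (m - \rank A).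
Proof.
rewrite -mxrank_ker; set K := kermx A.
exists (fun j => row j (row_base K)) => [j|z zA].
  by apply/sub_kermxP; rewrite (submx_trans (row_sub _ _)) ?eq_row_base.
have sumE (c : {ffun 'I_(\rank K) -> k}) :
    \sum_j c j *: row j (row_base K) = (\row_j c j) *m row_base K.
  by rewrite mulmx_sum_row; apply: eq_bigr => j _; rewrite mxE.
have /submxP[w wE] : (z <= row_base K)%MS by rewrite eq_row_base; apply/sub_kermxP.
exists [ffun j => w 0 j]; split=> [|c].
  apply/eqP; rewrite subr_eq0 sumE {1}wE; apply/eqP; congr (_ *m _).
  by apply/rowP => j; rewrite mxE ffunE.
move/eqP; rewrite subr_eq0 sumE wE => /eqP/(row_free_inj (row_base_free K)) E.
by apply/ffunP => j; rewrite ffunE E mxE.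
Qed.

Lemma krank_coker m r (A : 'M[k]_(m, r)) :
  krank *:%R (fun z : 'rV_r => True) (fun z => exists y, z = y *m A) (r - \rank A).
Proof.
rewrite -mxrank_compl; set K := (A^C)%MS.
exists (fun j => row j (row_base K)) => // z _.
have sumE (c : {ffun 'I_(\rank K) -> k}) :
    \sum_j c j *: row j (row_base K) = (\row_j c j) *m row_base K.
  by rewrite mulmx_sum_row; apply: eq_bigr => j _; rewrite mxE.
have /sub_addsmxP[[u w] /= zE] : (z <= A + row_base K)%MS.
  rewrite (@submx_trans _ _ _ _ _ _ (A + K)%MS) //; last by rewrite addsmxS ?eq_row_base.
  by rewrite submx_full // addsmx_compl_full.
exists [ffun j => w 0 j]; split=> [|c [y yE]].
  exists u; rewrite sumE zE [X in _ - X](_ : _ = w *m row_base K) ?addrK //.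
  by congr (_ *m _); apply/rowP => j; rewrite mxE ffunE.
have : ((\row_j c j - w) *m row_base K <= A :&: K)%MS.
  rewrite sub_capmx; apply/andP; split.
    apply/submxP; exists (u - y); rewrite !mulmxBl -sumE.
    by rewrite -(subKr z (\sum_j _)) yE {1}zE addrAC addrK.
  by rewrite (submx_trans (submxMl _ _)) ?eq_row_base.
rewrite capmx_compl submx0 => /eqP E.
have /eqP : \row_j c j - w = 0.
  by apply: (row_free_inj (row_base_free K)); rewrite E mul0mx.
rewrite subr_eq0 => /eqP <-.
by apply/ffunP => j; rewrite ffunE mxE.
Qed.

Variable U : finType.
Implicit Types (T : {set U}) (z : {ffun U -> k}).

Definition fscale (c : k) z : {ffun U -> k} := [ffun A => c * z A].
Definition supp_on T z := forall A, A \notin T -> z A = 0.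

Lemma supp_onB T x y : supp_on T x -> supp_on T y -> supp_on T (x - y).
Proof. by move=> Tx Ty A TA; rewrite !ffunE Tx // Ty // subrr. Qed.

Lemma supp_onZ T c x : supp_on T x -> supp_on T (fscale c x).
Proof. by move=> Tx A TA; rewrite !ffunE Tx // mulr0. Qed.

(** Functions supported on [T] form a space that depends on a set; row vectors
    give it a basis, so that matrix ranks apply. *)
Definition fun_of_row T (v : 'rV[k]_#|T|) : {ffun U -> k} :=
  [ffun A => extend (v 0) A].

Lemma fun_of_row_val T (v : 'rV_#|T|) a : fun_of_row v (enum_val a) = v 0 a.
Proof. by rewrite ffunE extend_val. Qed.

Lemma fun_of_row_supp T (v : 'rV_#|T|) : supp_on T (fun_of_row v).
Proof. by move=> A TA; rewrite ffunE extend_out. Qed.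

Lemma supp_on_ext T x y :
  supp_on T x -> supp_on T y -> (forall a : 'I_#|T|, x (enum_val a) = y (enum_val a)) ->
  x = y.
Proof.
move=> Tx Ty E; apply/ffunP => A; have [TA|TA] := boolP (A \in T); last by rewrite Tx ?Ty.
by rewrite -(enum_rankK_in TA TA) E.
Qed.

Definition row_of_fun T z : 'rV[k]_#|T| := \row_a z (enum_val a).

Lemma row_of_funK T z : supp_on T z -> fun_of_row (row_of_fun T z) = z.
Proof.
by move=> Tz; apply: supp_on_ext Tz _ => [|a]; [exact: fun_of_row_supp | rewrite fun_of_row_val mxE].
Qed.

Section LinearMap.
Variables (T T' : {set U}) (L : {ffun U -> k} -> {ffun U -> k}).
Hypothesis LB : forall x y, L (x - y) = L x - L y.
Hypothesis LZ : forall c x, L (fscale c x) = fscale c (L x).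
Hypothesis LT : forall z, supp_on T z -> supp_on T' (L z).

Let M : 'M[k]_(#|T|, #|T'|) :=
  \matrix_(a, b) L [ffun A => (A == enum_val a)%:R] (enum_val b).

Let ME (v : 'rV_#|T|) : L (fun_of_row v) = fun_of_row (v *m M).
Proof.
have L0 : L 0 = 0 by rewrite -[X in L X](subrr 0) LB subrr.
have LN x : L (- x) = - L x by rewrite -sub0r LB L0 sub0r.
have LA x y : L (x + y) = L x + L y by rewrite -{1}(opprK y) LB LN opprK.
apply: (@supp_on_ext T'); first by apply: LT; exact: fun_of_row_supp.
  exact: fun_of_row_supp.
move=> b; rewrite fun_of_row_val mxE.
have -> : fun_of_row v = \sum_a fscale (v 0 a) [ffun A => (A == enum_val a)%:R].
  apply/ffunP => A; rewrite ffunE sum_ffunE /extend big_mkcond; apply: eq_bigr => a _.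
  by rewrite !ffunE eq_sym; case: eqP; rewrite ?mulr1 ?mulr0.
rewrite (big_morph L LA L0) sum_ffunE; apply: eq_bigr => a _.
by rewrite LZ !ffunE mxE.
Qed.

Let fun_of_rowB (S : {set U}) (x y : 'rV_#|S|) :
  fun_of_row (x - y) = fun_of_row x - fun_of_row y.
Proof. by apply/ffunP => A; rewrite !ffunE -extendB; apply: eq_bigr => a _; rewrite !mxE. Qed.

Let fun_of_rowZ (S : {set U}) c (x : 'rV_#|S|) :
  fun_of_row (c *: x) = fscale c (fun_of_row x).
Proof. by apply/ffunP => A; rewrite !ffunE /extend mulr_sumr; apply: eq_bigr => a _; rewrite mxE. Qed.

Let fun_of_row_eq0 (S : {set U}) (x : 'rV_#|S|) : fun_of_row x = 0 <-> x = 0.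
Proof.
split=> [/ffunP E|->]; last by apply/ffunP => A; rewrite !ffunE /extend big1 // => a; rewrite mxE.
by apply/rowP => a; rewrite -fun_of_row_val E ffunE mxE.
Qed.

Lemma krank_fun_ker :
    (forall w, supp_on T' w -> exists2 z, supp_on T z & L z = w) ->
  krank fscale (fun z => supp_on T z /\ L z = 0) (fun z => z = 0) (#|T| - #|T'|).
Proof.
move=> Lsurj; have rM : \rank M = #|T'|.
  apply/eqP/row_fullP; have lift (b : 'I_#|T'|) : exists v : 'rV_#|T|, v *m M == delta_mx 0 b.
    have [z Tz Lz] := Lsurj (fun_of_row (delta_mx 0 b)) (@fun_of_row_supp _ _).
    exists (row_of_fun T z); rewrite -subr_eq0; apply/eqP/fun_of_row_eq0.
    by rewrite fun_of_rowB -ME row_of_funK // Lz subrr.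
  exists (\matrix_b xchoose (lift b)); apply/row_matrixP => b.
  by rewrite row_mul rowK (eqP (xchooseP (lift b))) row1.
rewrite -{1}rM; apply: krank_transfer (krank_ker M) => //=.
- exact: fun_of_rowB.
- exact: fun_of_rowZ.
- by move=> x y xM yM; rewrite mulmxBl xM yM subrr.
- by move=> c x xM; rewrite -scalemxAl xM scaler0.
- by move=> x y -> ->; rewrite subrr.
- move=> z zM; split; first exact: fun_of_row_supp.
  by rewrite ME zM; apply/fun_of_row_eq0.
move=> z [Tz Lz]; exists (row_of_fun T z); last by rewrite row_of_funK // subrr.
by apply/fun_of_row_eq0; rewrite -ME row_of_funK.
Qed.

Lemma krank_fun_coker :
    (forall z, supp_on T z -> L z = 0 -> z = 0) ->
  krank fscale (supp_on T') (fun w => exists2 z, supp_on T z & w = L z) (#|T'| - #|T|).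
Proof.
move=> Linj; have rM : \rank M = #|T|.
  apply/eqP; rewrite -[_ == _]/(row_free M) -kermx_eq0.
  apply/eqP/row_matrixP => a; rewrite row0.
  apply/fun_of_row_eq0/Linj; first exact: fun_of_row_supp.
  by rewrite ME; apply/fun_of_row_eq0; rewrite -row_mul mulmx_ker row0.
rewrite -{1}rM; apply: krank_transfer (krank_coker M) => //=.
- exact: fun_of_rowB.
- exact: fun_of_rowZ.
- by move=> x y [a Ta ->] [b Tb ->]; exists (a - b); rewrite ?LB //; apply: supp_onB.
- by move=> z _; exact: fun_of_row_supp.
- move=> z Tz; exists (row_of_fun T' z) => //; rewrite row_of_funK // subrr.
  by exists 0 => [A|]; rewrite ?ffunE // -[X in L X](subrr 0) LB subrr.
move=> w _; split=> [[z Tz E]|[y ->]]; last first.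
  by exists (fun_of_row y); [exact: fun_of_row_supp | rewrite ME].
exists (row_of_fun T z); apply/eqP; rewrite -subr_eq0; apply/eqP/fun_of_row_eq0.
by rewrite fun_of_rowB -ME row_of_funK // E subrr.
Qed.

End LinearMap.
End Rank.

(** * The Koszul complex in coordinates *)

Section KoszulCoordinates.
Variables (N : nat) (k : comNzRingType).
Implicit Types (A C T : {set 'I_N}) (m : 'X_{1..N}) (j l : 'I_N).
Implicit Types (x y : {set 'I_N} -> 'X_{1..N} -> k).

Definition below j A : nat := #|[set l in A | (l < j)%N]|.
Definition ksign j A : k := (-1) ^+ below j A.

(** The Koszul boundary acts on families of scalars, [x A m] being the
    coefficient of the monomial [m] at the basis vector [e_A].  In this form it
    serves over the polynomial ring and over the pure monomials of [B] alike. *)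
Definition kdiff x A m : k :=
  \sum_(l | (l \notin A) && (0 < m l)%N) ksign l A * x (l |: A) (m - U_(l))%MM.

Lemma below_setU1 j l A : l \notin A ->
  below j (l |: A) = ((l < j) + below j A)%N.
Proof.
move=> lA; rewrite /below; case: (ltnP l j) => lj /=.
  have -> : [set i in l |: A | (i < j)%N] = l |: [set i in A | (i < j)%N].
    by apply/setP => i; rewrite !inE; case: eqP => [->|].
  by rewrite cardsU1 inE (negbTE lA).
rewrite add0n; apply: eq_card => i; rewrite !inE; case: eqP => [->|] //.
by rewrite ltnNge lj !andbF.
Qed.

Lemma ksign_sqr j A : ksign j A * ksign j A = 1.
Proof. by rewrite -expr2 sqrr_sign. Qed.

(** One of [j] and [l] lies below the other, and exactly one of the two orders
    of adjoining them counts this. *)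
Lemma ksign_swap j l A : j != l -> j \notin A -> l \notin A ->
  ksign j A * ksign l (j |: A) = - (ksign l A * ksign j (l |: A)).
Proof.
move=> jl jA lA; rewrite /ksign -!exprD !below_setU1 //.
case: (ltngtP j l) => [lt|lt|/val_inj E]; last by rewrite E eqxx in jl.
  by rewrite add0n add1n addnS exprS mulN1r [(_ + below l _)%N]addnC.
by rewrite add0n add1n addnS exprS mulN1r opprK [(_ + below l _)%N]addnC.
Qed.

Lemma ksign_swap' j l A : j != l -> j \notin A -> l \notin A ->
  ksign l A * ksign j A = - (ksign l (j |: A) * ksign j (l |: A)).
Proof.
move=> jl jA lA; have E := ksign_swap jl jA lA.
rewrite -[LHS]mulr1 -(ksign_sqr l (j |: A)) mulrA -[ksign l A * ksign j A * _]mulrA E.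
by rewrite mulrN mulNr mulrA ksign_sqr mul1r [in RHS]mulrC.
Qed.

Lemma mnmBU m l i : (m - U_(l))%MM i = (m i - (l == i))%N.
Proof. by rewrite mnmBE mnm1E. Qed.

Lemma mnmDU m l i : (m + U_(l))%MM i = (m i + (l == i))%N.
Proof. by rewrite mnmDE mnm1E. Qed.

(** The terms of the double sum cancel in pairs: [ksign_swap]. *)
Lemma kdiff_kdiff x A m : kdiff (kdiff x) A m = 0.
Proof.
pose P j l := [&& j \notin A, l \notin A, j != l, 0 < m j & 0 < m l]%N.
pose F j l := ksign j A * ksign l (j |: A) * x (l |: (j |: A)) (m - U_(j) - U_(l))%MM.
have FN j l : P j l -> F l j = - F j l.
  case/and5P=> jA lA jl _ _; rewrite /F [ksign l A * _](@ksign_swap l j) 1?eq_sym // mulNr.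
  by congr (- (_ * x _ _)); [rewrite setUCA|apply/mnmP => i; rewrite !mnmBU subnAC].
have -> : kdiff (kdiff x) A m = \sum_j \sum_(l | P j l) F j l.
  rewrite /kdiff big_mkcond; apply: eq_bigr => j _; rewrite /P.
  have [/andP[jA mj]|H] := boolP (_ && _); last first.
    by rewrite big_pred0 // => l; apply: contraNF H => /and5P[-> _ _ ->].
  rewrite mulr_sumr; apply: eq_big => [l|l _]; last by rewrite mulrA.
  rewrite mnmBU jA mj !inE negb_or /= [l == j]eq_sym.
  by case: eqVneq => //=; rewrite ?andbF // subn0.
have PC j l : P j l = P l j.
  by rewrite /P eq_sym; case: (_ \in _); case: (_ \in _); case: eqP => //= _; rewrite andbC.
rewrite (eq_bigr (fun j => \sum_(l | P j l && (j < l)%N) F j l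
                         + \sum_(l | P j l && (l < j)%N) F j l)); last first.
  move=> j _; rewrite (bigID (fun l => (j < l)%N)) /=; congr (_ + _).
  apply: eq_bigl => l; rewrite -leqNgt leq_eqVlt.
  by case: eqP => //= /val_inj ->; rewrite /P eqxx ltnn !andbF.
rewrite big_split /= [X in _ + X](exchange_big_dep xpredT) //=.
rewrite -big_split /= big1 // => j _; rewrite -[RHS](subrr (\sum_(l | P j l && (j < l)%N) F j l)).
congr (_ + _); rewrite -sumrN; apply: eq_big => [l|l /andP[Plj _]]; first by rewrite PC.
by rewrite FN // PC.
Qed.

Lemma eq_kdiff x y A m :
    (forall l, l \notin A -> (0 < m l)%N ->
       x (l |: A) (m - U_(l))%MM = y (l |: A) (m - U_(l))%MM) ->
  kdiff x A m = kdiff y A m.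
Proof. by move=> E; apply: eq_bigr => l /andP[lA ml]; rewrite E. Qed.

Definition tsupp T A m := [set l in T | (l \in A) || (0 < m l)%N].

(** The contracting homotopy multiplies by one basis vector [e_j] and divides
    by the variable [j]; the choice of [j] may depend only on the multidegree,
    hence on the set [tsupp], which the differential preserves. *)
Definition khom T x A m : k :=
  if [pick j in tsupp T A m] is Some j then
    if j \in A then ksign j (A :\ j) * x (A :\ j) (m + U_(j))%MM else 0
  else 0.

(** In the boundary of the homotopy, the chosen variable [j] contributes the
    identity, as in the Koszul complex of one variable; the contributions of
    all other variables cancel between the two terms by [ksign_swap']. *)
Lemma khom_homotopy T x A m : (forall l, (0 < m l)%N -> l \in T) ->
  tsupp T A m != set0 -> kdiff (khom T x) A m + khom T (kdiff x) A m = x A m.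
Proof.
move=> mT /set0Pn[i0 Ti0].
have [j pickj] : exists j, [pick j in tsupp T A m] = Some j.
  by case: pickP => [j|/(_ i0)]; [exists j | rewrite Ti0].
have jS : j \in tsupp T A m by move: pickj; case: pickP => // ? ? [<-].
(* The differential preserves the multidegree, hence the choice of [j]. *)
have pickE l : l \notin A -> (0 < m l)%N ->
    [pick j in tsupp T (l |: A) (m - U_(l))%MM] = Some j.
  move=> lA ml; rewrite -pickj; apply: eq_pick => i; rewrite !inE mnmBU.
  case: eqVneq => [->|il]; first by rewrite mT // ml orbT.
  by rewrite subn0.
have -> : kdiff (khom T x) A m =
    \sum_(l | (l \notin A) && (0 < m l)%N) ksign l A *
      (if j \in l |: A then ksign j ((l |: A) :\ j) *
         x ((l |: A) :\ j) (m - U_(l) + U_(j))%MM else 0).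
  by apply: eq_bigr => l /andP[lA ml]; rewrite /khom pickE.
rewrite /khom pickj; move: jS; rewrite inE => /andP[jT].
case: ifPn => jA /= => [_|mj]; last first.
  rewrite addr0 (bigD1 j) ?jA //= big1 => [|l /andP[_ lj]].
    rewrite setU11 setU1K // mulrA ksign_sqr mul1r addr0.
    by congr (x A _); apply/mnmP => i; rewrite mnmDU mnmBU; case: eqVneq => [<-|_]; lia.
  by rewrite inE (negbTE jA) inE eq_sym (negbTE lj) mulr0.
rewrite /kdiff mulr_sumr [in X in _ + X](bigD1 j) /=; last first.
  by rewrite !inE eqxx mnmDU eqxx addn1.
rewrite setD1K // mulrA ksign_sqr mul1r.
have -> : (m + U_(j) - U_(j))%MM = m by apply/mnmP => i; rewrite mnmBU mnmDU addnK.
rewrite addrCA addrA -[RHS]addr0 -addrA; congr (_ + _).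
rewrite -[RHS](subrr (\sum_(l | (l \notin A) && (0 < m l)%N)
   ksign l A * (ksign j ((l |: A) :\ j) * x ((l |: A) :\ j) (m - U_(l) + U_(j))%MM))).
congr (_ + _).
  by apply: eq_bigr => l _; rewrite inE jA orbT.
rewrite -sumrN; apply: eq_big => [l|l].
  rewrite !inE mnmDU; case: (eqVneq l j) => [->|lj]; first by rewrite jA andbF.
  by rewrite addn0 andbT.
case/andP; rewrite !inE mnmDU => /andP[lA ml] lj.
have {}lA : l \notin A by move: lA; rewrite (negbTE lj).
have EA : (l |: A) :\ j = l |: (A :\ j).
  by apply/setP => i; rewrite !inE; case: eqVneq => // ->; rewrite eq_sym (negbTE lj).
have Em : (m - U_(l) + U_(j))%MM = (m + U_(j) - U_(l))%MM.
  apply/mnmP => i; rewrite mnmDU !mnmBU mnmDU.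
  case: (eqVneq l i) => [<-|_]; last by rewrite !subn0.
  by rewrite (eq_sym j) (negbTE lj) !addn0.
rewrite EA Em !mulrA -mulNr; congr (_ * _).
rewrite [LHS]mulrC ksign_swap' 1?eq_sym //; last by rewrite inE (negbTE lA) andbF.
  by rewrite setD1K // opprK mulrC.
by rewrite !inE eqxx.
Qed.

End KoszulCoordinates.

(** * Coefficients of polynomials and membership in the two ideals *)

Section Coefficients.
Variables (N : nat) (k : comNzRingType).
Implicit Types (f g : {mpoly k[N]}) (m : 'X_{1..N}).

Lemma mcoeff_sumE (I : Type) (r : seq I) (P : pred I) (F : I -> {mpoly k[N]}) m :
  (\sum_(i <- r | P i) F i)@_m = \sum_(i <- r | P i) (F i)@_m.
Proof. exact: raddf_sum. Qed.

Lemma mcoeff_Xmul f j m :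
  ('X_j * f)@_m = if (0 < m j)%N then f@_(m - U_(j)) else 0.
Proof.
case: ifPn => mj.
  have E : m = (U_(j) + (m - U_(j)))%MM.
    apply/mnmP => i; rewrite mnmDE mnmBE mnm1E.
    by case: eqP => [<-|]; rewrite ?subnKC ?subn0 ?add0n.
  by rewrite mulrC [in LHS]E mcoeffMX.
apply/eqP; rewrite mulrC mcoeff_eq0 (perm_mem (msuppMX f U_(j)%MM)).
by apply/mapP => -[m' _ E]; rewrite E mnmDE mnm1E eqxx in mj.
Qed.

Lemma mpoly_of_coef (c : 'X_{1..N} -> k) d :
  (forall m, (d <= mdeg m)%N -> c m = 0) -> exists f, forall m, f@_m = c m.
Proof.
move=> cd; exists (\sum_(m : 'X_{1..N < d}) c m *: 'X_[m]) => m.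
have [lt|le] := ltnP (mdeg m) d; first exact: mcoeff_mpoly.
rewrite cd // mcoeff_sumE big1 // => p _; rewrite mcoeffZ mcoeffX.
by case: eqP => [E|]; rewrite ?mulr0 //; have := bmdeg p; rewrite E; lia.
Qed.

Lemma mcoeff_msize f m : (msize f <= mdeg m)%N -> f@_m = 0.
Proof. by move=> le; apply/eqP; rewrite mcoeff_eq0; exact: msize_mdeg_ge. Qed.

End Coefficients.

Section Ideals.
Variables (n : nat) (k : fieldType).
Notation S := {mpoly k[n + n]}.

Lemma ideal_gen_mem (G : seq S) g : g \in G -> ideal_gen G g.
Proof.
move=> gG; apply/asboolP.
exists (fun i : 'I_(size G) => if i == index g G :> nat then 1 else 0).
have lt : (index g G < size G)%N by rewrite index_mem.
rewrite (bigD1 (Ordinal lt)) //= eqxx mul1r nth_index // big1 ?addr0 // => i.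
by rewrite -val_eqE /= => /negbTE ->; rewrite mul0r.
Qed.

Section Quotient.
Variable I : idealr S.

Lemma quot_eq0 (f : S) : \pi_({ideal_quot I}) f = 0 <-> f \in (I : pred S).
Proof.
have <- : (f == 0 %[mod {ideal_quot I}]) = (f \in (I : pred S)).
  by rewrite -Quotient.idealrBE subr0.
by rewrite rmorph0; split=> [->|/eqP].
Qed.

Lemma quot_repr_sub (x : {ideal_quot I}) f :
  x = \pi_({ideal_quot I}) f -> f - repr x \in (I : pred S).
Proof. by move=> E; apply/quot_eq0; rewrite rmorphB /= reprK -E subrr. Qed.

End Quotient.

Lemma max_idealP (f : S) : f \in @max_ideal n k <-> f@_0%MM = 0.
Proof.
split=> [/asboolP[c ->]|f0].
  rewrite mcoeff_sumE big1 // => i _; rewrite rmorphM /=.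
  by have /mapP[j _ ->] := mem_nth 0 (ltn_ord i); rewrite mcoeff0X mulr0.
rewrite [f]mpolyE big_seq; apply: rpred_sum => m mf.
have /existsP[j mj] : [exists j, (0 < m j)%N].
  apply: contraT; rewrite negb_exists => /forallP m0; move: mf.
  suff -> : m = 0%MM by rewrite mcoeff_msupp f0 eqxx.
  by apply/mnmP => i; rewrite mnm0E; apply/eqP; rewrite -leqn0 leqNgt.
rewrite -mul_mpolyC; apply: idealMr.
have -> : 'X_[m] = 'X_[m - U_(j)] * 'X_j :> S.
  rewrite -mpolyXD; congr 'X_[_]; apply/mnmP => i.
  by rewrite mnmDU mnmBU; case: eqP => [<-|]; rewrite ?subnK ?subn0 ?addn0.
by apply: idealMr; apply: ideal_gen_mem; apply/map_f; rewrite mem_enum.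
Qed.

End Ideals.

(** * The Koszul complex resolves the residue field *)

Section Koszul.
Variables (n : nat) (k : fieldType).
Notation S := {mpoly k[n + n]}.
Implicit Types (A C : {set 'I_(n + n)}) (j : 'I_(n + n)) (m : 'X_{1..n + n}).

Definition sdeg A : nat * nat :=
  (\sum_(i < n) (lshift n i \in A), \sum_(i < n) (rshift n i \in A))%N.

Lemma add_bidegA : associative add_bideg.
Proof. by move=> [a b] [c d] [e f]; rewrite /add_bideg /= !addnA. Qed.

Lemma add_bidegC : commutative add_bideg.
Proof. by move=> [a b] [c d]; rewrite /add_bideg /= addnC [(b + d)%N]addnC. Qed.

Lemma add_bidegI u : injective (add_bideg u).
Proof. by case: u => [a b] [c d] [e f] [/addnI -> /addnI ->]. Qed.

Lemma bidegD (m p : 'X_{1..n + n}) : bideg (m + p) = add_bideg (bideg m) (bideg p).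
Proof.
by rewrite /bideg /add_bideg /=; congr (_, _); rewrite -big_split; apply: eq_bigr => i _;
  rewrite mnmDE.
Qed.

Lemma bideg0 : bideg (0%MM : 'X_{1..n + n}) = (0, 0)%N.
Proof. by rewrite /bideg !big1 // => i _; rewrite mnm0E. Qed.

Lemma bideg_mdeg m : ((bideg m).1 + (bideg m).2)%N = mdeg m.
Proof. by rewrite mdegE big_split_ord. Qed.

Lemma sdeg_setU1 j A : j \notin A -> sdeg (j |: A) = add_bideg (bideg U_(j)) (sdeg A).
Proof.
move=> jA; rewrite /sdeg /add_bideg /=; congr (_, _); rewrite -big_split;
  apply: eq_bigr => i _; rewrite mnm1E !inE eq_sym;
  by case: eqP => [<-|]; rewrite ?(negbTE jA).
Qed.

Lemma sdeg_card A : ((sdeg A).1 + (sdeg A).2)%N = #|A|.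
Proof.
by rewrite -sum1_card big_mkcond big_split_ord /=; congr addn; apply: eq_bigr => i _; case: ifP => ->.
Qed.

Lemma sdeg0 : sdeg set0 = (0, 0)%N.
Proof. by rewrite /sdeg !big1 // => i _; rewrite inE. Qed.

Definition kset (i : nat) := [set A : {set 'I_(n + n)} | #|A| == i].

Definition koszul : free_seq n k := @FreeSeq n k (fun i => #|kset i|)
  (fun i a => sdeg (enum_val a))
  (fun i => \matrix_(a < #|kset i.+1|, b < #|kset i|)
     \sum_(j | (j \notin enum_val b) && (enum_val a == j |: enum_val b))
        ksign k j (enum_val b) *: 'X_j).

Lemma koszul_action i (M : lmodType S) (x : 'I_#|kset i.+1| -> M) C :
  extend (fun b : 'I_#|kset i| => \sum_a (cdiff koszul i a b : S) *: x a) C =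
  \sum_(j | j \notin C) (ksign k j C *: 'X_j : S) *: extend x (j |: C).
Proof.
have [iC|iC] := boolP (C \in kset i); last first.
  rewrite extend_out // big1 // => j jC; rewrite extend_out ?scaler0 //.
  by move: iC; rewrite !inE cardsU1 jC eqSS.
rewrite extend_in /=; under eq_bigr do rewrite mxE enum_rankK_in // scaler_suml.
rewrite [RHS]big_mkcond (exchange_big_dep xpredT) //=; apply: eq_bigr => j _.
have [jC|jC] := ifP; last by rewrite big_pred0.
by rewrite /extend scaler_sumr; apply: eq_bigl => a.
Qed.

Definition coordS i (v : 'rV[S]_#|kset i|) A m : k := (extend (v 0) A)@_m.

Lemma coordS_diff i (v : 'rV[S]_(crk koszul i.+1)) C m :
  coordS (v *m cdiff koszul i) C m = kdiff (coordS v) C m.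
Proof.
have -> : coordS (v *m cdiff koszul i) C m =
    (extend (fun b => \sum_a (cdiff koszul i a b : S) *: (v 0 a : S^o)) C)@_m.
  congr (_ @_ m); apply: eq_bigr => b _; rewrite mxE; apply: eq_bigr => a _.
  by rewrite mulrC.
rewrite koszul_action mcoeff_sumE /kdiff big_mkcondr; apply: eq_bigr => j _.
have -> : (ksign k j C *: 'X_j : S) *: (extend (v 0) (j |: C) : S^o) =
  ksign k j C *: ('X_j * extend (v 0) (j |: C)) by rewrite scalerAl.
by rewrite mcoeffZ mcoeff_Xmul; case: ifP; rewrite ?mulr0.
Qed.

Lemma coordS_inj i (v w : 'rV[S]_#|kset i|) :
  (forall A m, coordS v A m = coordS w A m) -> v = w.
Proof.
move=> E; apply/rowP => a; apply/mpolyP => m.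
by rewrite -(extend_val (v 0)) -(extend_val (w 0)); exact: E.
Qed.

Lemma coordS_out i (v : 'rV[S]_#|kset i|) A m : #|A| != i -> coordS v A m = 0.
Proof. by move=> Ai; rewrite /coordS extend_out ?mcoeff0 // inE. Qed.

Lemma coordS_realize i (c : {set 'I_(n + n)} -> 'X_{1..n + n} -> k) d :
    (forall A m, #|A| != i -> c A m = 0) ->
    (forall A m, (d <= mdeg m)%N -> c A m = 0) ->
  exists v : 'rV[S]_#|kset i|, forall A m, coordS v A m = c A m.
Proof.
move=> ci cd; have cE A : exists f : S, forall m, f@_m = c A m.
  by apply: (@mpoly_of_coef _ _ _ d) => m; exact: cd.
have /choice[f fE] := cE.
exists (\row_a f (enum_val a)) => A m.
have [Ai|Ai] := boolP (A \in kset i).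
  by rewrite /coordS extend_in mxE enum_rankK_in // fE.
by rewrite ci ?coordS_out //; rewrite inE in Ai.
Qed.

Lemma khom_out T (x : {set 'I_(n + n)} -> 'X_{1..n + n} -> k) i A m :
  (forall A m, #|A| != i -> x A m = 0) -> #|A| != i.+1 -> khom T x A m = 0.
Proof.
move=> xi Ai; rewrite /khom; case: pickP => // j _; case: ifP => // jA.
by rewrite xi ?mulr0 //; rewrite (cardsD1 j) jA add1n eqSS in Ai.
Qed.

Lemma coordS_bound i (v : 'rV[S]_#|kset i|) :
  exists d, forall A m, (d <= mdeg m)%N -> coordS v A m = 0.
Proof.
exists (\max_(A : {set 'I_(n + n)}) msize (extend (v 0%R) A)) => A m le.
by apply: mcoeff_msize; apply: leq_trans le; apply: leq_bigmax.
Qed.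

(** The homotopy lowers polynomial degree, so it produces polynomials. *)
Lemma coordS_khom i (v : 'rV[S]_#|kset i|) :
  exists w : 'rV[S]_#|kset i.+1|, forall A m, coordS w A m = khom setT (coordS v) A m.
Proof.
have [d vd] := coordS_bound v.
apply: (@coordS_realize _ _ d) => [A m Ai|A m dm].
  by apply: khom_out Ai => C p; exact: coordS_out.
rewrite /khom; case: pickP => // j _; case: ifP => // _.
by rewrite vd ?mulr0 // mdegD; lia.
Qed.

Lemma kset0 (a : 'I_#|kset 0|) : enum_val a = set0.
Proof. by have := enum_valP a; rewrite inE cards_eq0 => /eqP. Qed.

Definition koszul_eps (a : 'I_(crk koszul 0)) : residue_field n k := 1.

Lemma koszul_aug (v : 'rV[S]_(crk koszul 0)) :
  augmentation koszul_eps v = \pi_(residue_field n k) (extend (v 0) set0).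
Proof.
rewrite /augmentation /extend rmorph_sum /=.
apply: eq_big => [a|a _]; first by rewrite kset0 eqxx.
by rewrite /koszul_eps; exact: mulr1.
Qed.

(** Exactness comes from [khom_homotopy] over all variables.  It fails only at
    [A = set0] and [m = 0], where the residue field sits. *)
Lemma koszul_resolution :
  graded_free_resolution (@residue_part n k) koszul_eps.
Proof.
have diff0 i (v : 'rV[S]_(crk koszul i.+1)) : v *m cdiff koszul i = 0 ->
    forall A m, kdiff (coordS v) A m = 0.
  move=> v0 A m; rewrite -coordS_diff v0 /coordS /extend big1 ?mcoeff0 // => a _.
  by rewrite mxE.
have exact (i : nat) (v : 'rV[S]_#|kset i|) :
    (forall A m, kdiff (coordS v) A m = 0) -> coordS v set0 0%MM = 0 ->
    exists w : 'rV_(crk koszul i.+1), v = w *m cdiff koszul i.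
  move=> dv v00; have [w wE] := coordS_khom v; exists w.
  apply: coordS_inj => A m; rewrite coordS_diff.
  rewrite (@eq_kdiff _ _ _ (khom setT (coordS v))); last by move=> *; exact: wE.
  have [S0|S0] := eqVneq (tsupp setT A m) set0; last first.
    rewrite -[LHS](@khom_homotopy _ _ setT) //; last by move=> l _; rewrite inE.
    rewrite -[RHS]addr0; congr (_ + _); rewrite /khom.
    by case: pickP => // j _; case: ifP => // _; rewrite dv mulr0.
  have S0' j : (j \notin A) && (m j == 0)%N.
    have : j \notin tsupp setT A m by rewrite S0 inE.
    by rewrite !inE /= negb_or -leqNgt leqn0.
  have m0 : m = 0%MM by apply/mnmP => j; have /andP[_ /eqP ->] := S0' j; rewrite mnm0E.
  have A0 : A = set0 by apply/setP => j; have /andP[/negbTE -> _] := S0' j; rewrite inE.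
  by rewrite A0 m0 v00 /kdiff big_pred0 // => l; rewrite mnm0E andbF.
split; first split.
- move=> i a b m; rewrite mcoeff_msupp mxE mcoeff_sumE => nz.
  have [j /andP[/andP[jb /eqP Ea] /eqP <-]|H] :=
      pickP (fun j => (j \notin enum_val b) && (enum_val a == j |: enum_val b) && (U_(j)%MM == m)).
    by rewrite /= Ea; exact: sdeg_setU1.
  case/eqP: nz; apply: big1 => j Pj; rewrite mcoeffZ mcoeffX.
  by have := H j; rewrite Pj /= => ->; rewrite mulr0.
- move=> a; exists 1; last by rewrite rmorph1.
  have degE : cdeg a = (0, 0)%N by rewrite -sdeg0 -(kset0 a).
  by move=> m; rewrite msupp1 inE degE => /eqP ->; rewrite bideg0.
- move=> y; exists (\row_a repr y); rewrite koszul_aug extend_in ?inE ?cards0 // => H.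
  by rewrite mxE reprK.
- move=> v; rewrite koszul_aug quot_eq0; split=> [/max_idealP v0|[w ->]].
    apply: exact => // A m; rewrite /kdiff big1 // => l /andP[lA _].
    by rewrite coordS_out ?mulr0 // cardsU1 lA.
  apply/max_idealP; rewrite -[LHS]/(coordS _ _ _) coordS_diff /kdiff big_pred0 // => l.
  by rewrite mnm0E andbF.
move=> i v; split=> [v0|[w ->]].
  by apply: exact (diff0 _ _ v0) _; rewrite coordS_out ?cards0.
apply: coordS_inj => A m; rewrite coordS_diff (@eq_kdiff _ _ _ (kdiff (coordS w))).
  by rewrite kdiff_kdiff /coordS /extend big1 ?mcoeff0 // => a _; rewrite mxE.
by move=> *; rewrite coordS_diff.
Qed.

End Koszul.

(** * Comparison of graded free resolutions *)

Lemma dependent_choice_from (T : nat -> Type) (C : forall i, T i -> Prop)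
    (R : forall i, T i -> T i.+1 -> Prop) (x0 : T 0) :
  C 0 x0 -> (forall i x, C i x -> exists2 y, C i.+1 y & R i x y) ->
  exists2 f : forall i, T i, f 0 = x0 & forall i, C i (f i) /\ R i (f i) (f i.+1).
Proof.
move=> C0 step.
pose next i (x : {x | C i x}) := cid2 (step i (sval x) (svalP x)).
pose f := fix f i : {x | C i x} :=
  if i is j.+1 then exist _ (s2val (next j (f j))) (s2valP (next j (f j)))
  else exist _ x0 C0.
exists (fun i => sval (f i)) => // i; split; first exact: svalP (f i).
exact: s2valP' (next i (f i)).
Qed.

Section Comparison.
Variables (n : nat) (k : fieldType).
Notation S := {mpoly k[n + n]}.
Notation degree := (nat * nat)%type.
Implicit Types (f g : S) (u d : degree).

Section GradedMatrices.

Lemma bihomogC (c : k) : bihomog (0, 0)%N (c%:MP : S).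
Proof. by move=> m; rewrite msuppC; case: ifP => // _; rewrite inE => /eqP ->; exact: bideg0. Qed.

(** A degree-preserving matrix has entries of degree [u - d] where the row has
    degree [u] and the column has degree [d]; this projects to that part. *)
Definition gproj u d f : S :=
  \sum_(m <- msupp f | u == add_bideg (bideg m) d) f@_m *: 'X_[m].

Lemma mcoeff_gproj u d f m :
  (gproj u d f)@_m = if u == add_bideg (bideg m) d then f@_m else 0.
Proof.
rewrite mcoeff_sumE big_mkcond; have [mf|mf] := boolP (m \in msupp f).
  rewrite (bigD1_seq m) ?msupp_uniq //= big1 => [|p /negbTE pm].
    by rewrite addr0 mcoeffZ mcoeffX eqxx mulr1.
  by rewrite mcoeffZ mcoeffX pm mulr0 if_same.
have fm : f@_m = 0 by apply/eqP; rewrite mcoeff_eq0.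
rewrite fm if_same big1_seq // => p /andP[_ pf]; rewrite mcoeffZ mcoeffX.
by case: (eqVneq p m) => [E|_]; rewrite ?mulr0 ?if_same //; rewrite E (negbTE mf) in pf.
Qed.

Lemma gproj_sum u d (I : Type) (r : seq I) (P : pred I) (F : I -> S) :
  gproj u d (\sum_(i <- r | P i) F i) = \sum_(i <- r | P i) gproj u d (F i).
Proof.
apply/mpolyP => m; rewrite mcoeff_gproj !mcoeff_sumE; case: ifP => E.
  by apply: eq_bigr => i _; rewrite mcoeff_gproj E.
by rewrite big1 // => i _; rewrite mcoeff_gproj E.
Qed.

Lemma gproj_id u d f :
  (forall m, m \in msupp f -> u = add_bideg (bideg m) d) -> gproj u d f = f.
Proof.
move=> fd; apply/mpolyP => m; rewrite mcoeff_gproj; case: eqP => // ud.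
by apply/esym/eqP; rewrite mcoeff_eq0; apply/negP => /fd.
Qed.

Lemma gproj_mono u d (c : k) m :
  gproj u d (c *: 'X_[m]) = if u == add_bideg (bideg m) d then c *: 'X_[m] else 0.
Proof.
apply/mpolyP => p; rewrite mcoeff_gproj (fun_if (fun h : S => h@_p)) mcoeffZ mcoeffX mcoeff0.
by case: (eqVneq m p) => [->|]; rewrite // mulr0 !if_same.
Qed.

Lemma gproj_mul u d e f g :
    (forall m, m \in msupp g -> e = add_bideg (bideg m) d) ->
  gproj u d (f * g) = gproj u e f * g.
Proof.
move=> ge; rewrite [in LHS](mpolyE f) [in RHS](mpolyE f) mulr_suml !gproj_sum mulr_suml.
apply: eq_bigr => m _; rewrite gproj_mono.
rewrite [in LHS](mpolyE g) mulr_sumr gproj_sum (eq_big_seq (fun p =>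
  if u == add_bideg (bideg m) e then f@_m *: 'X_[m] * (g@_p *: 'X_[p]) else 0)).
  by case: eqP => _; [rewrite -mulr_sumr -mpolyE | rewrite big1 ?mul0r].
move=> p pg; rewrite -scalerAl -scalerAr scalerA -mpolyXD gproj_mono bidegD.
by rewrite -add_bidegA -(ge p pg).
Qed.

Definition gmx p q (dr : 'I_p -> degree) (dc : 'I_q -> degree) (A : 'M[S]_(p, q)) :=
  forall a b m, m \in msupp (A a b) -> dr a = add_bideg (bideg m) (dc b).

Variables (p q r : nat) (dp : 'I_p -> degree) (dq : 'I_q -> degree) (dr : 'I_r -> degree).

Lemma gmxB (A C : 'M_(p, q)) : gmx dp dq A -> gmx dp dq C -> gmx dp dq (A - C).
Proof.
move=> gA gC a b m; rewrite !mxE => /msuppB_le; rewrite mem_cat.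
by case/orP => [/gA|/gC].
Qed.

Lemma gmx1 : gmx dp dp 1%:M.
Proof.
move=> a b m; rewrite !mxE; case: eqP => [->|_]; last by rewrite msupp0.
rewrite msupp1 inE => /eqP ->; rewrite bideg0.
by case: (dp b) => x y; rewrite /add_bideg !add0n.
Qed.

Lemma gmxM (A : 'M_(p, q)) (C : 'M_(q, r)) :
  gmx dp dq A -> gmx dq dr C -> gmx dp dr (A *m C).
Proof.
move=> gA gC a b m; rewrite mxE mcoeff_msupp mcoeff_sumE => nz.
have [c cP] : exists c, (A a c * C c b)@_m != 0.
  apply/existsP; apply: contraNT nz; rewrite negb_exists => /forallP H.
  by rewrite big1 // => c _; apply/eqP; have := H c; rewrite negbK.
move: cP; rewrite -mcoeff_msupp => /msuppM_le/allpairsP[[m1 m2] /= [m1A m2C ->]].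
by rewrite bidegD -add_bidegA -(gC _ _ _ m2C) -(gA _ _ _ m1A).
Qed.

(** Homogeneous components of a solution of a homogeneous equation solve it. *)
Lemma gmx_lift (X : 'M_(p, q)) (D : 'M_(r, q)) :
    gmx dp dq X -> gmx dr dq D ->
    (forall a, exists w, row a X = w *m D) ->
  exists2 Y : 'M_(p, r), gmx dp dr Y & X = Y *m D.
Proof.
move=> gX gD /choice[w wE].
exists (\matrix_(a, c) gproj (dp a) (dr c) (w a 0 c)).
  move=> a c m; rewrite mxE mcoeff_msupp mcoeff_gproj.
  by case: ifP => [/eqP //|_]; rewrite eqxx.
apply/matrixP => a b; rewrite -(gproj_id (gX a b)).
have -> : X a b = \sum_c w a 0 c * D c b.
  by have /rowP/(_ b) := wE a; rewrite !mxE.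
rewrite gproj_sum mxE; apply: eq_bigr => c _; rewrite mxE.
by apply: gproj_mul => m; exact: gD.
Qed.

End GradedMatrices.

Notation cdg F i := (@cdeg n k F i).
Notation res F eps := (@graded_free_resolution n k _ (@residue_part n k) F eps).

Section Resolution.
Variables (F : free_seq n k) (eps : 'I_(crk F 0) -> residue_field n k).
Hypothesis rF : res F eps.

Lemma cdiff_gmx i : gmx (cdg F i.+1) (cdg F i) (cdiff F i).
Proof. by case: rF => -[gF _] _ _ _ a b m; exact: gF. Qed.

Lemma cdiff_cdiff i : cdiff F i.+1 *m cdiff F i = 0.
Proof.
case: rF => _ _ _ ex; apply/row_matrixP => a; rewrite row_mul row0.
by apply/ex; exists (row a 1%:M); rewrite -row_mul mul1mx.
Qed.

Lemma exact_rows p i (X : 'M_(p, crk F i.+1)) : X *m cdiff F i = 0 ->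
  forall a, exists w, row a X = w *m cdiff F i.+1.
Proof.
by move=> X0 a; case: rF => _ _ _ ex; apply/ex; rewrite -row_mul X0 row0.
Qed.

Lemma augmentationB (v w : 'rV_(crk F 0)) :
  augmentation eps (v - w) = augmentation eps v - augmentation eps w.
Proof.
by rewrite /augmentation -sumrB; apply: eq_bigr => a _; rewrite !mxE scalerBl.
Qed.

Lemma aug_rows p (X : 'M_(p, crk F 0)) : (forall a, augmentation eps (row a X) = 0) ->
  forall a, exists w, row a X = w *m cdiff F 0.
Proof. by case: rF => _ _ ex _ X0 a; apply/ex. Qed.

(** The homogeneous parts of any lift form a lift: the error is a homogeneous
    part of an element of the maximal ideal. *)
Lemma aug_lift p (dp : 'I_p -> degree) (y : 'I_p -> residue_field n k) :
    (forall a, residue_part (dp a) (y a)) ->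
  exists2 Y : 'M_(p, crk F 0), gmx dp (cdg F 0) Y &
    forall a, augmentation eps (row a Y) = y a.
Proof.
move=> yd; case: rF => -[_ epsd] surj _ _.
have /choice[w wE] : forall a, exists v, y a = augmentation eps v by move=> a; exact: surj.
have /choice[f fE] : forall a, exists f, bihomog (dp a) f /\ y a = \pi_(residue_field n k) f.
  by move=> a; have [f] := yd a; exists f.
have /choice[g gE] : forall b, exists g,
    bihomog (cdg F 0 b) g /\ eps b = \pi_(residue_field n k) g.
  by move=> b; have [g] := epsd b; exists g.
exists (\matrix_(a, b) gproj (dp a) (cdg F 0 b) (w a 0 b)).
  move=> a c m; rewrite mxE mcoeff_msupp mcoeff_gproj.
  by case: ifP => [/eqP //|_]; rewrite eqxx.
have augE (v : 'rV_(crk F 0)) :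
    augmentation eps v = \pi_(residue_field n k) (\sum_b v 0 b * g b).
  rewrite rmorph_sum; apply: eq_bigr => b _.
  by rewrite (gE b).2 rmorphM.
move=> a; have /eqP := wE a; rewrite (fE a).2 augE -subr_eq0 -rmorphB /=.
move=> /eqP/quot_eq0/max_idealP H; rewrite augE; apply/eqP; rewrite -subr_eq0 -rmorphB.
apply/eqP/quot_eq0/max_idealP.
pose z : S := f a - \sum_b w a 0 b * g b.
have -> : \sum_b (row a (\matrix_(a, b) gproj (dp a) (cdg F 0 b) (w a 0 b))) 0 b * g b - f a
    = - gproj (dp a) (0, 0)%N z.
  rewrite /z -opprB; congr (- _).
  have gB h1 h2 : gproj (dp a) (0, 0)%N (h1 - h2) =
      gproj (dp a) (0, 0)%N h1 - gproj (dp a) (0, 0)%N h2.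
    by apply/mpolyP => m; rewrite mcoeffB !mcoeff_gproj mcoeffB; case: ifP; rewrite ?subrr.
  have add0 u : add_bideg u (0, 0)%N = u by case: u => x y0; rewrite /add_bideg !addn0.
  rewrite gB gproj_sum gproj_id => [|m /(fE a).1 ->]; last by rewrite add0.
  congr (_ - _); apply: eq_bigr => b _; rewrite !mxE; apply/esym/gproj_mul => m.
  by rewrite add0 => /(gE b).1.
by rewrite mcoeffN mcoeff_gproj H if_same oppr0.
Qed.

End Resolution.

Lemma augmentation_mulmx F G epsF epsG (v : 'rV_(crk F 0)) (Y : 'M[S]_(crk F 0, crk G 0)) :
    (forall a, augmentation (F := G) epsG (row a Y) = epsF a) ->
  augmentation (F := G) epsG (v *m Y) = augmentation (N := residue_field n k) epsF v.
Proof.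
move=> YE; rewrite /augmentation; under eq_bigr do rewrite mxE scaler_suml.
rewrite exchange_big; apply: eq_bigr => b _ /=; rewrite -YE /augmentation scaler_sumr.
by apply: eq_bigr => c _; rewrite [row b Y 0 c]mxE scalerA.
Qed.

(** Graded chain maps, and homotopies between them, are built one degree at a
    time: exactness of the target provides each next matrix and [gmx_lift]
    makes it homogeneous. *)
Lemma chain_map_exists F epsF G epsG : res F epsF -> res G epsG ->
  exists phi : forall i, 'M[S]_(crk F i, crk G i),
    [/\ forall i, gmx (cdg F i) (cdg G i) (phi i),
        forall a, augmentation epsG (row a (phi 0%N)) = epsF a
      & forall i, phi i.+1 *m cdiff G i = cdiff F i *m phi i].
Proof.
move=> rF rG; have [phi0 g0 e0] := aug_lift rG (fun a => (let: And4 (conj _ h) _ _ _ := rF in h) a).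
pose C i (phi : 'M[S]_(crk F i, crk G i)) := gmx (cdg F i) (cdg G i) phi /\
  forall a, exists w, row a (cdiff F i *m phi) = w *m cdiff G i.
have C0 : C 0%N phi0.
  split=> //; apply: (aug_rows rG) => a.
  rewrite row_mul (augmentation_mulmx _ e0).
  by case: rF => _ _ ex _; apply/ex; exists (row a 1%:M); rewrite -row_mul mul1mx.
have [i phi [gphi lift]|phi phi0E H] :=
  @dependent_choice_from _ C (fun i x y => y *m cdiff G i = cdiff F i *m x) _ C0.
  have [psi gpsi E] := gmx_lift (gmxM (@cdiff_gmx _ _ rF i) gphi) (@cdiff_gmx _ _ rG i) lift.
  exists psi => //; split=> //; apply: (exact_rows rG).
  by rewrite -mulmxA -E mulmxA (cdiff_cdiff rF) mul0mx.
by exists phi; split=> [i|a|i]; [case: (H i) => [[]]|rewrite phi0E|case: (H i)].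
Qed.

Lemma homotopy_exists F eps (f : forall i, 'M[S]_(crk F i)) : res F eps ->
    (forall i, gmx (cdg F i) (cdg F i) (f i)) ->
    (forall a, augmentation eps (row a (f 0%N)) = 0) ->
    (forall i, f i.+1 *m cdiff F i = cdiff F i *m f i) ->
  exists h : forall i, 'M[S]_(crk F i, crk F i.+1),
    [/\ forall i, gmx (cdg F i) (cdg F i.+1) (h i),
        f 0%N = h 0%N *m cdiff F 0
      & forall i, f i.+1 = cdiff F i *m h i + h i.+1 *m cdiff F i.+1].
Proof.
move=> rF gf f0 fd.
have [h0 gh0 E0] := gmx_lift (gf 0%N) (@cdiff_gmx _ _ rF 0) (aug_rows rF f0).
pose C i (h : 'M[S]_(crk F i, crk F i.+1)) := gmx (cdg F i) (cdg F i.+1) h /\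
  forall a, exists w, row a (f i.+1 - cdiff F i *m h) = w *m cdiff F i.+1.
have C0 : C 0%N h0.
  by split=> //; apply: (exact_rows rF); rewrite mulmxBl fd -mulmxA -E0 subrr.
have [i h [gh lift]|h h0E H] := @dependent_choice_from _ C
    (fun i x y => f i.+1 = cdiff F i *m x + y *m cdiff F i.+1) _ C0.
  have [h' gh' E] := gmx_lift (gmxB (gf i.+1) (gmxM (@cdiff_gmx _ _ rF i) gh))
    (@cdiff_gmx _ _ rF i.+1) lift.
  exists h'; last by rewrite -E addrCA subrr addr0.
  split=> //; apply: (exact_rows rF).
  by rewrite mulmxBl fd -mulmxA -E mulmxBr mulmxA (cdiff_cdiff rF) mul0mx subr0 subrr.
by exists h; split=> [i||i]; [case: (H i) => [[]]|rewrite h0E|case: (H i)].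
Qed.

Section Tensor.
Variables (M : lmodType S) (Mpart : degree -> M -> Prop).
Hypothesis MpartD : forall v x y, Mpart v x -> Mpart v y -> Mpart v (x + y).
Hypothesis MpartZ : forall v w f x, bihomog v f -> Mpart w x -> Mpart (add_bideg v w) (f *: x).

Definition mxact p q (A : 'M[S]_(p, q)) (x : {ffun 'I_p -> M}) : {ffun 'I_q -> M} :=
  [ffun b => \sum_a A a b *: x a].

Lemma mxactM p q r (A : 'M_(p, q)) (C : 'M_(q, r)) x : mxact (A *m C) x = mxact C (mxact A x).
Proof.
apply/ffunP => c; rewrite !ffunE; under eq_bigr do rewrite mxE scaler_suml.
rewrite exchange_big; apply: eq_bigr => b _; rewrite ffunE scaler_sumr.
by apply: eq_bigr => a _; rewrite scalerA mulrC.
Qed.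

Lemma mxactD p q (A C : 'M_(p, q)) x : mxact (A + C) x = mxact A x + mxact C x.
Proof. by apply/ffunP => b; rewrite !ffunE -big_split; apply: eq_bigr => a _; rewrite mxE scalerDl. Qed.

Lemma mxact_subid p (A : 'M_p) x : mxact (A - 1%:M) x = mxact A x - x.
Proof.
apply/ffunP => b; rewrite !ffunE; under eq_bigr do rewrite !mxE scalerBl.
rewrite sumrB; congr (_ - _); rewrite (bigD1 b) //= eqxx scale1r big1 ?addr0 // => a /negbTE ->.
by rewrite scale0r.
Qed.

Lemma mxactB p q (A : 'M_(p, q)) x y : mxact A (x - y) = mxact A x - mxact A y.
Proof. by apply/ffunP => b; rewrite !ffunE -sumrB; apply: eq_bigr => a _; rewrite !ffunE scalerBr. Qed.

Lemma mxactZ p q (A : 'M_(p, q)) f x : mxact A (f *: x) = f *: mxact A x.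
Proof.
apply/ffunP => b; rewrite !ffunE scaler_sumr; apply: eq_bigr => a _.
by rewrite ffunE !scalerA mulrC.
Qed.

Lemma mxact0 p q (A : 'M_(p, q)) : mxact A 0 = 0.
Proof. by apply/ffunP => b; rewrite !ffunE big1 // => a _; rewrite ffunE scaler0. Qed.

Definition gpart p (d : 'I_p -> degree) v (x : {ffun 'I_p -> M}) :=
  forall a, x a = 0 \/ exists2 w, Mpart w (x a) & v = add_bideg w (d a).

Lemma gpart_sum p (d : 'I_p -> degree) v a (I : Type) (s : seq I) (y : I -> M) :
    (forall i, y i = 0 \/ exists2 w, Mpart w (y i) & v = add_bideg w (d a)) ->
  \sum_(i <- s) y i = 0 \/ exists2 w, Mpart w (\sum_(i <- s) y i) & v = add_bideg w (d a).
Proof.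
move=> yd; elim: s => [|i s]; first by left; rewrite big_nil.
rewrite big_cons; case: (yd i) => [->|[w Mw vw]]; first by rewrite add0r.
case=> [->|[w' Mw' vw']]; first by right; exists w; rewrite ?addr0.
right; exists w => //; apply: MpartD => //.
suff -> : w = w' by [].
by apply: (@add_bidegI (d a)); rewrite ![add_bideg (d a) _]add_bidegC -vw -vw'.
Qed.

Lemma mxact_gpart p q (dp : 'I_p -> degree) (dq : 'I_q -> degree) (A : 'M_(p, q)) v x :
  gmx dp dq A -> gpart dp v x -> gpart dq v (mxact A x).
Proof.
move=> gA gx b; rewrite ffunE; apply: gpart_sum => a.
case: (gx a) => [->|[w Mw ->]]; first by left; rewrite scaler0.
have [->|nz] := eqVneq (A a b) 0; first by left; rewrite scale0r.
have [m mA] : exists m, m \in msupp (A a b).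
  case E : (msupp (A a b)) => [|m s]; last by exists m; rewrite inE eqxx.
  by rewrite (msuppnil0 E) eqxx in nz.
right; exists (add_bideg (bideg m) w).
  apply: MpartZ => // p0 p0A.
  by apply: (@add_bidegI (dq b)); rewrite ![add_bideg (dq b) _]add_bidegC -(gA _ _ _ mA) -(gA _ _ _ p0A).
by rewrite (gA _ _ _ mA) add_bidegA [add_bideg w _]add_bidegC.
Qed.

Lemma gpartB p (d : 'I_p -> degree) v x y : gpart d v x -> gpart d v y -> gpart d v (x - y).
Proof.
move=> gx gy a; rewrite !ffunE.
have -> : x a - y a = \sum_(b <- [:: true; false]) (if b then x a else - y a).
  by rewrite big_cons big_seq1.
apply: gpart_sum => -[]; first exact: gx.
case: (gy a) => [->|[w Mw ->]]; first by left; rewrite oppr0.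
right; exists w => //; rewrite -[w](_ : add_bideg (0, 0)%N w = w); last by case: (w).
by rewrite -scaleN1r -mpolyC1 -mpolyCN; apply: MpartZ => //; exact: bihomogC.
Qed.

Lemma tensor_diffE F i (x : {ffun 'I_(crk F i.+1) -> M}) : tensor_diff x = mxact (cdiff F i) x.
Proof. by []. Qed.

Lemma tensor_boundaryB F i v (x y : {ffun 'I_(crk F i) -> M}) :
  tensor_boundary Mpart v x -> tensor_boundary Mpart v y -> tensor_boundary Mpart v (x - y).
Proof.
move=> [x' gx ->] [y' gy ->]; exists (x' - y'); first exact: gpartB.
by rewrite !tensor_diffE mxactB.
Qed.

(** Chain maps in the two directions between the resolutions are inverse to each
    other up to homotopy, hence so are the maps induced on homology with
    coefficients in [M]. *)
Lemma quot_rank_resolution F epsF G epsG i v (r : nat) : res F epsF -> res G epsG ->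
    quot_rank (fun x : {ffun 'I_(crk G i) -> M} => tensor_part Mpart v x /\ tensor_cycle x)
      (@tensor_boundary n k M Mpart G i v) r ->
    quot_rank (fun x : {ffun 'I_(crk F i) -> M} => tensor_part Mpart v x /\ tensor_cycle x)
      (@tensor_boundary n k M Mpart F i v) r.
Proof.
move=> rF rG.
have [phi [gphi ephi dphi]] := chain_map_exists rF rG.
have [psi [gpsi epsi dpsi]] := chain_map_exists rG rF.
have homotopic F' eps' G' eps'' (a : forall i, 'M[S]_(crk F' i, crk G' i))
    (b : forall i, 'M[S]_(crk G' i, crk F' i)) : res F' eps' -> res G' eps'' ->
    (forall i, gmx (cdg F' i) (cdg G' i) (a i)) ->
    (forall c, augmentation eps'' (row c (a 0%N)) = eps' c) ->
    (forall i, a i.+1 *m cdiff G' i = cdiff F' i *m a i) ->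
    (forall i, gmx (cdg G' i) (cdg F' i) (b i)) ->
    (forall c, augmentation eps' (row c (b 0%N)) = eps'' c) ->
    (forall i, b i.+1 *m cdiff F' i = cdiff G' i *m b i) ->
    forall i (x : {ffun 'I_(crk F' i) -> M}), tensor_part Mpart v x -> tensor_cycle x ->
      tensor_boundary Mpart v (mxact (b i) (mxact (a i) x) - x).
  move=> rF' rG' ga ea da gb eb db.
  have [j|c|j|h [gh h0 hS]] := @homotopy_exists F' eps' (fun i => a i *m b i - 1%:M) rF'.
  - by apply: gmxB; [apply: gmxM (ga j) (gb j) | exact: gmx1].
  - rewrite linearB /= (@augmentationB F' eps') row_mul row1.
    have -> : augmentation eps' (delta_mx 0 c) = eps' c.
      rewrite /augmentation (bigD1 c) //= mxE !eqxx scale1r big1 ?addr0 // => j /negbTE jc.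
      by rewrite mxE jc andbF scale0r.
    by rewrite (augmentation_mulmx _ eb) ea subrr.
  - by rewrite mulmxBl mulmxBr mul1mx mulmx1 -mulmxA db !mulmxA da.
  move=> j x gx cx; rewrite -mxactM -mxact_subid; case: j x gx cx => [|j] x gx cx.
    rewrite h0 mxactM; exists (mxact (h 0%N) x) => //.
    by apply: mxact_gpart gx; exact: gh.
  rewrite hS mxactD !mxactM -tensor_diffE (cx : tensor_diff x = 0) mxact0 add0r.
  by exists (mxact (h j.+1) x) => //; apply: mxact_gpart gx; exact: gh.
have cycle_map F' G' (a : forall i, 'M[S]_(crk F' i, crk G' i)) :
    (forall i, a i.+1 *m cdiff G' i = cdiff F' i *m a i) ->
    forall i (x : {ffun 'I_(crk F' i) -> M}), tensor_cycle x -> tensor_cycle (mxact (a i) x).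
  move=> da [|j] x //= cx.
  by rewrite tensor_diffE -mxactM da mxactM -tensor_diffE cx mxact0.
have boundary_map F' G' (a : forall i, 'M[S]_(crk F' i, crk G' i)) :
    (forall i, gmx (cdg F' i) (cdg G' i) (a i)) ->
    (forall i, a i.+1 *m cdiff G' i = cdiff F' i *m a i) ->
    forall i (x : {ffun 'I_(crk F' i) -> M}), tensor_boundary Mpart v x ->
      tensor_boundary Mpart v (mxact (a i) x).
  move=> ga da j x [y gy ->]; exists (mxact (a j.+1) y).
    by apply: mxact_gpart gy; exact: ga.
  by rewrite !tensor_diffE -!mxactM da.
have boundaryN F' j (x : {ffun 'I_(crk F' j) -> M}) :
    tensor_boundary Mpart v x -> tensor_boundary Mpart v (- x).
  by move=> bx; rewrite -sub0r -(subrr x); do 2!apply: (tensor_boundaryB) => //.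
apply: (@krank_transfer k _ _ (fun c x => c%:MP *: x) (fun c x => c%:MP *: x) _ _ _ _
  (mxact (psi i))).
- exact: mxactB.
- by move=> c x; rewrite mxactZ.
- move=> x y [gx cx] [gy cy]; split; first exact: gpartB.
  by case: (i) x y cx cy {gx gy} => //= j x y cx cy; rewrite tensor_diffE mxactB -!tensor_diffE cx cy subrr.
- move=> c x [gx cx]; split; last first.
    by case: (i) x cx {gx} => //= j x cx; rewrite tensor_diffE mxactZ -!tensor_diffE cx scaler0.
  move=> a; rewrite ffunE; case: (gx a) => [->|[w Mw ->]]; first by left; rewrite scaler0.
  right; exists w => //; rewrite -[w](_ : add_bideg (0, 0)%N w = w); last by case: (w).
  by apply: MpartZ => //; exact: bihomogC.
- exact: tensor_boundaryB.
- move=> z [gz cz]; split; last exact: cycle_map.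
  by apply: mxact_gpart gz; exact: gpsi.
- move=> z [gz cz]; exists (mxact (phi i) z).
    split; last exact: cycle_map.
    by apply: mxact_gpart gz; exact: gphi.
  rewrite -opprB; apply: boundaryN.
  exact: (@homotopic F epsF G epsG).
move=> z [gz cz]; split=> [bz|]; last exact: boundary_map.
rewrite -[z](subKr (mxact (phi i) (mxact (psi i) z))).
apply: tensor_boundaryB; first exact: boundary_map.
exact: (@homotopic G epsG F epsF).
Qed.

End Tensor.
End Comparison.

(** * A k-basis of the ring [B] *)

Section RingB.
Variables (n : nat) (k : fieldType).
Hypothesis hn : (2 <= n)%N.
Notation S := {mpoly k[n + n]}.
Notation B := (B n k).
Notation p := (@lshift n n).
Notation q := (@rshift n n).
Implicit Types (f g : S) (m : 'X_{1..n + n}) (x y : B) (v : nat * nat).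

Definition ponly m := [forall i : 'I_n, m (q i) == 0%N].
Definition qonly m := [forall i : 'I_n, m (p i) == 0%N].
Definition pure m := ponly m || qonly m.

Definition pq (i : 'I_n) : 'X_{1..n + n} := (U_(p i) + U_(q i))%MM.
(** All [p_i q_i] become equal in [B], so only the sum of their coefficients
    matters there. *)
Definition wcoef f : k := \sum_i f@_(pq i).

Lemma ponlyP m : ponly m -> forall i, m (q i) = 0%N.
Proof. by move=> /forallP H i; exact/eqP. Qed.

Lemma qonlyP m : qonly m -> forall i, m (p i) = 0%N.
Proof. by move=> /forallP H i; exact/eqP. Qed.

Lemma pureP m : pure m -> forall i j, (m (p i) == 0) || (m (q j) == 0)%N.
Proof. by case/orP => H i j; rewrite ?(ponlyP H) ?(qonlyP H) eqxx ?orbT. Qed.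

Lemma eq_pp i j : (p i == p j) = (i == j).
Proof. by rewrite (inj_eq (@lshift_inj _ _)). Qed.

Lemma eq_qq i j : (q i == q j) = (i == j).
Proof. by rewrite (inj_eq (@rshift_inj _ _)). Qed.

Lemma eq_pq i j : (p i == q j) = false.
Proof. by apply/negbTE; rewrite -val_eqE /= neq_ltn (leq_trans (ltn_ord i)) // leq_addr. Qed.

Lemma eq_qp i j : (q i == p j) = false.
Proof. by rewrite eq_sym eq_pq. Qed.

Lemma pqE_p i j : pq i (p j) = (i == j) :> nat.
Proof. by rewrite mnmDE !mnm1E eq_pp eq_qp addn0. Qed.

Lemma pqE_q i j : pq i (q j) = (i == j) :> nat.
Proof. by rewrite mnmDE !mnm1E eq_qq eq_pq add0n. Qed.

Lemma pq_inj : injective pq.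
Proof.
move=> i j /(congr1 (fun m : 'X_{1..n + n} => m (p j))); rewrite !pqE_p eqxx.
by case: eqP.
Qed.

Lemma pq_not_pure i : ~~ pure (pq i).
Proof.
by apply/negP => /pureP/(_ i i); rewrite pqE_p pqE_q eqxx.
Qed.

Lemma bideg_U (j : 'I_(n + n)) : bideg U_(j) = if (j < n)%N then (1, 0)%N else (0, 1)%N.
Proof.
rewrite -[j]splitK; case: (split j) => i; rewrite /bideg /=; under eq_bigr do rewrite mnm1E;
  under [X in (_, X)]eq_bigr do rewrite mnm1E.
- rewrite ltn_ord (bigD1 i) //= eqxx !big1 // => l; rewrite ?eq_pq ?eq_pp //.
  by rewrite eq_sym => /negbTE ->.
- rewrite ltnNge leq_addr /= [X in (_, X)](bigD1 i) //= eqxx !big1 // => l; rewrite ?eq_qp ?eq_qq //.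
  by rewrite eq_sym => /negbTE ->.
Qed.

Lemma bideg_p i : bideg U_(p i) = (1, 0)%N.
Proof. by rewrite bideg_U /= ltn_ord. Qed.

Lemma bideg_q i : bideg U_(q i) = (0, 1)%N.
Proof. by rewrite bideg_U /= ltnNge leq_addr. Qed.

Lemma bideg_pq i : bideg (pq i) = (1, 1)%N.
Proof. by rewrite bidegD bideg_p bideg_q. Qed.

Lemma mcoeff_pqmul i j t f :
  ('X_(p i) * ('X_(q j) * f))@_(pq t) = if (i == t) && (j == t) then f@_0%MM else 0.
Proof.
rewrite mcoeff_Xmul pqE_p lt0b [t == i]eq_sym; case: eqP => //= ->.
rewrite mcoeff_Xmul mnmBU pqE_q eq_pq subn0 lt0b [t == j]eq_sym; case: eqP => //= ->.
by congr (_ @_ _); apply/mnmP => l; rewrite !mnmBU mnmDE mnm0E !mnm1E; lia.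
Qed.

Lemma mcoeff_pqmul_pure i j f m : pure m -> ('X_(p i) * ('X_(q j) * f))@_m = 0.
Proof.
move=> /pureP/(_ i j)/orP[] /eqP m0; rewrite !mcoeff_Xmul ?m0 //=.
by rewrite mnmBU eq_pq subn0 m0 /= if_same.
Qed.

Lemma wcoef_pqmul i j f : wcoef ('X_(p i) * ('X_(q j) * f)) = if i == j then f@_0%MM else 0.
Proof.
rewrite /wcoef (bigD1 i) //= mcoeff_pqmul eqxx /= eq_sym big1 ?addr0 // => t ti.
by rewrite mcoeff_pqmul eq_sym (negbTE ti).
Qed.

Lemma wcoefB f g : wcoef (f - g) = wcoef f - wcoef g.
Proof. by rewrite -sumrB; apply: eq_bigr => i _; rewrite mcoeffB. Qed.

Lemma mem_pq i j : i != j -> 'X_(p i) * 'X_(q j) \in @B_ideal n k.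
Proof.
move=> ij; apply: ideal_gen_mem; rewrite mem_cat; apply/orP; left.
by apply/mapP; exists (i, j); rewrite // mem_enum.
Qed.

Lemma mem_pqB i j : 'X_(p i) * 'X_(q i) - 'X_(p j) * 'X_(q j) \in @B_ideal n k.
Proof.
have [->|ij] := eqVneq i j; first by rewrite subrr rpred0.
apply: ideal_gen_mem; rewrite mem_cat; apply/orP; right.
by apply/mapP; exists (i, j); rewrite // mem_enum.
Qed.

Lemma XU2 (i j : 'I_(n + n)) : 'X_i * 'X_j = 'X_[U_(i) + U_(j)] :> S.
Proof. by rewrite -mpolyXD. Qed.

Lemma B_ideal_dvd (d m : 'X_{1..n + n}) : 'X_[d] \in @B_ideal n k ->
  (forall i, d i <= m i)%N -> 'X_[m] \in @B_ideal n k.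
Proof.
move=> dI dm; have -> : 'X_[m] = 'X_[m - d] * 'X_[d] :> S.
  by rewrite -mpolyXD; congr 'X_[_]; apply/mnmP => i; rewrite mnmDE mnmBE subnK.
exact: idealMr.
Qed.

Lemma other (i : 'I_n) : exists j : 'I_n, i != j.
Proof.
have lt0 : (0 < n)%N by apply: leq_trans hn.
have [i0|i0] := eqVneq i (Ordinal lt0); last by exists (Ordinal lt0).
by exists (Ordinal hn); rewrite i0.
Qed.

(** A mixed monomial other than the [p_i q_i] is divisible by some [p_i q_j]
    with [i != j], or by [p_i^2 q_i] or [p_i q_i^2]; the latter lie in the ideal
    because [p_i q_i] may be replaced by [p_j q_j]. *)
Lemma mono_mem m : ~~ pure m -> (forall t, m != pq t) -> 'X_[m] \in @B_ideal n k.
Proof.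
rewrite negb_or !negb_forall => /andP[/existsP[j mj] /existsP[i mi]] mt.
have dvd a b : a != b -> (0 < m (p a))%N -> (0 < m (q b))%N -> 'X_[m] \in @B_ideal n k.
  move=> ab ma mb; apply: B_ideal_dvd (_ : 'X_[U_(p a) + U_(q b)] \in _) _.
    by rewrite -XU2; exact: mem_pq.
  move=> l; rewrite mnmDE !mnm1E.
  by case: eqP => [<-|_]; [rewrite eq_qp addn0 | case: eqP => [<-|]].
have [ij|ij] := eqVneq i j; last by apply: (dvd _ _ ij); rewrite lt0n.
subst j.
have [l lE] : exists l, m l != pq i l.
  apply/existsP; apply: contraT; rewrite negb_exists => /forallP H.
  by case/eqP: (mt i); apply/mnmP => l; have := H l; rewrite negbK => /eqP.
have dvd3 c j : i != j -> 'X_c * ('X_(p j) * 'X_(q j)) \in @B_ideal n k ->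
    (1 < m c)%N -> (c == p i) || (c == q i) -> 'X_[m] \in @B_ideal n k.
  move=> ij cI mc ci; apply: B_ideal_dvd (_ : 'X_[U_(c) + pq i] \in _) _.
    rewrite mpolyXD -[X in _ * X]XU2.
    rewrite -[X in 'X_c * X](subrK ('X_(p j) * 'X_(q j))) mulrDr rpredD //.
    by apply: idealMr; exact: mem_pqB.
  move=> s; rewrite !mnmDE !mnm1E.
  have [sc|sc] := eqVneq c s.
    by rewrite -sc; case/orP: ci mc => /eqP ->; rewrite eqxx ?eq_pq ?eq_qp.
  rewrite add0n; case: eqP => [<-|_]; last by case: eqP => [<-|] //; rewrite lt0n.
  by rewrite eq_qp lt0n.
have [j ij] := other i.
rewrite -[l]splitK in lE *; move: lE; case: (split l) => s /= lE.
- have [si|si] := eqVneq i s.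
    rewrite -{s}si pqE_p eqxx in lE.
    apply: (dvd3 (p i) j ij); rewrite ?eqxx //; last by move: mi lE; case: (m (p i)) => [|[]].
    by rewrite mulrCA; apply: idealMr; exact: mem_pq.
  apply: (dvd s i); rewrite 1?eq_sym ?lt0n //.
  by move: lE; rewrite pqE_p (negbTE si).
- have [si|si] := eqVneq i s.
    rewrite -{s}si pqE_q eqxx in lE.
    apply: (dvd3 (q i) j ij); rewrite ?eqxx ?orbT //; last by move: mj lE; case: (m (q i)) => [|[]].
    rewrite mulrA mulrC; apply: idealMr; rewrite mulrC; apply: mem_pq.
    by rewrite eq_sym.
  apply: (dvd i s); rewrite ?lt0n //.
  by move: lE; rewrite pqE_q (negbTE si).
Qed.

(** The generators satisfy the two linear conditions, which are stable under
    multiplication by polynomials.  Conversely, subtracting a combination of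
    the [p_i q_i - p_j q_j] leaves only the monomials of [mono_mem]. *)
Lemma B_idealP f : f \in @B_ideal n k <->
  (forall m, pure m -> f@_m = 0) /\ wcoef f = 0.
Proof.
split=> [/asboolP[c fE]|[f0 fw]].
  have H (i : 'I_(size (@B_gens n k))) :
      (forall m, pure m -> (c i * (B_gens n k)`_i)@_m = 0) /\ wcoef (c i * (B_gens n k)`_i) = 0.
    have := mem_nth 0 (ltn_ord i); rewrite {1}mem_cat.
    case/orP => /mapP[[a b]]; rewrite mem_enum inE /= => ab ->.
      rewrite mulrC -mulrA; split=> [m pm|]; first exact: mcoeff_pqmul_pure.
      by rewrite wcoef_pqmul (negbTE ab).
    rewrite mulrC mulrBl -!mulrA; split=> [m pm|].
      by rewrite mcoeffB !mcoeff_pqmul_pure ?subrr.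
    by rewrite wcoefB !wcoef_pqmul !eqxx subrr.
  split=> [m pm|]; rewrite fE.
    by rewrite mcoeff_sumE big1 // => i _; apply: (H i).1.
  rewrite /wcoef; under eq_bigr do rewrite mcoeff_sumE.
  by rewrite exchange_big big1 // => i _; exact: (H i).2.
have lt0 : (0 < n)%N by apply: leq_trans hn.
pose i0 := Ordinal lt0.
pose g := \sum_t f@_(pq t) *: 'X_[pq t] : S.
have gI : g \in @B_ideal n k.
  have -> : g = \sum_t (f@_(pq t))%:MP * ('X_(p t) * 'X_(q t) - 'X_(p i0) * 'X_(q i0)).
    under [RHS]eq_bigr do rewrite mulrBr !XU2.
    rewrite sumrB -mulr_suml -rmorph_sum -/(wcoef f) fw rmorph0 mul0r subr0.
    by apply: eq_bigr => t _; rewrite mul_mpolyC.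
  by apply: rpred_sum => t _; apply: idealMr; exact: mem_pqB.
rewrite -[f](subrK g) rpredD // [_ - g]mpolyE big_seq rpred_sum // => m.
rewrite mcoeff_msupp mcoeffB mcoeff_sumE => nz.
rewrite -mul_mpolyC; apply/idealMr/mono_mem => [|t].
  apply: contraNN nz => pm; rewrite f0 // big1 ?subrr // => t _.
  rewrite mcoeffZ mcoeffX; case: eqP => [E|]; last by rewrite mulr0.
  by have := pq_not_pure t; rewrite E pm.
apply: contraNN nz => /eqP ->; rewrite (bigD1 t) //= mcoeffZ mcoeffX eqxx mulr1.
rewrite big1 ?addr0 ?subrr // => s st; rewrite mcoeffZ mcoeffX.
by case: eqP => [/pq_inj E|_]; [rewrite E eqxx in st | rewrite mulr0].
Qed.

(** Coordinates on [B]: the coefficients of pure monomials, and the coefficient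
    of the socle element [p_i q_i]. *)
Definition bc x m : k := (repr x)@_m.
Definition bw x : k := wcoef (repr x).

Lemma bc_pi f m : pure m -> bc (\pi_B f) m = f@_m.
Proof.
move=> pm; have /B_idealP[/(_ m pm)] := quot_repr_sub (erefl (\pi_B f)).
by rewrite mcoeffB => /eqP; rewrite subr_eq0 => /eqP ->.
Qed.

Lemma bw_pi f : bw (\pi_B f) = wcoef f.
Proof.
have /B_idealP[_] := quot_repr_sub (erefl (\pi_B f)).
by rewrite wcoefB => /eqP; rewrite subr_eq0 => /eqP ->.
Qed.

Lemma B_ext x y : (forall m, pure m -> bc x m = bc y m) -> bw x = bw y -> x = y.
Proof.
move=> E1 E2; rewrite -[x]reprK -[y]reprK; apply/eqP.
rewrite -subr_eq0 -rmorphB; apply/eqP/quot_eq0/B_idealP; split=> [m pm|].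
  by rewrite mcoeffB; apply/eqP; rewrite subr_eq0; apply/eqP; exact: E1.
by rewrite wcoefB; apply/eqP; rewrite subr_eq0; apply/eqP.
Qed.

Lemma B_scaleE f x : f *: x = \pi_B (f * repr x).
Proof. by rewrite rmorphM /= reprK. Qed.

Lemma bcB x y m : pure m -> bc (x - y) m = bc x m - bc y m.
Proof. by move=> pm; rewrite -{1}[x]reprK -{1}[y]reprK -rmorphB bc_pi // mcoeffB. Qed.

Lemma bwB x y : bw (x - y) = bw x - bw y.
Proof. by rewrite -{1}[x]reprK -{1}[y]reprK -rmorphB bw_pi wcoefB. Qed.

Lemma bc0 m : pure m -> bc 0 m = 0.
Proof. by move=> pm; rewrite -[X in bc X](subrr 0) bcB // subrr. Qed.

Lemma bw0 : bw 0 = 0.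
Proof. by rewrite -[X in bw X](subrr 0) bwB subrr. Qed.

Lemma bcD x y m : pure m -> bc (x + y) m = bc x m + bc y m.
Proof. by move=> pm; rewrite -{1}[y]opprK bcB // -[- y]sub0r bcB // bc0 // sub0r opprK. Qed.

Lemma bwD x y : bw (x + y) = bw x + bw y.
Proof. by rewrite -{1}[y]opprK bwB -[- y]sub0r bwB bw0 sub0r opprK. Qed.

Lemma bc_sum (I : Type) (r : seq I) (P : pred I) (F : I -> B) m : pure m ->
  bc (\sum_(i <- r | P i) F i) m = \sum_(i <- r | P i) bc (F i) m.
Proof.
by move=> pm; apply: (big_morph (bc^~ m)); [move=> x y; exact: bcD | exact: bc0].
Qed.

Lemma bw_sum (I : Type) (r : seq I) (P : pred I) (F : I -> B) :
  bw (\sum_(i <- r | P i) F i) = \sum_(i <- r | P i) bw (F i).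
Proof. by apply: (big_morph bw); [exact: bwD | exact: bw0]. Qed.

Lemma pureBU m j : pure m -> pure (m - U_(j)).
Proof.
by case/orP => /forallP H; apply/orP; [left|right]; apply/forallP => i;
  rewrite mnmBU (eqP (H i)) sub0n.
Qed.

Lemma bcX (c : k) j x m : pure m ->
  bc ((c *: 'X_j : S) *: x) m = if (0 < m j)%N then c * bc x (m - U_(j))%MM else 0.
Proof.
move=> pm; rewrite B_scaleE bc_pi // -scalerAl mcoeffZ mcoeff_Xmul.
by case: ifP; rewrite ?mulr0.
Qed.

(** The variable whose product with the variable [j] is the socle element. *)
Definition partner (j : 'I_(n + n)) := match split j with inl i => q i | inr i => p i end.

Lemma partner_p i : partner (p i) = q i.
Proof. by rewrite /partner (unsplitK (inl i)). Qed.

Lemma partner_q i : partner (q i) = p i.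
Proof. by rewrite /partner (unsplitK (inr i)). Qed.

Lemma bwX (c : k) j x : bw ((c *: 'X_j : S) *: x) = c * bc x U_(partner j).
Proof.
rewrite B_scaleE bw_pi -scalerAl /wcoef; under eq_bigr do rewrite mcoeffZ mcoeff_Xmul.
rewrite -mulr_sumr; congr (c * _).
rewrite -[j]splitK; case: (split j) => i /=.
- rewrite partner_p (bigD1 i) //= pqE_p eqxx big1 => [|t ti]; last first.
    by rewrite pqE_p (negbTE ti).
  rewrite addr0 /bc; congr (_ @_ _); apply/mnmP => s.
  by rewrite mnmBU mnmDE !mnm1E addKn.
- rewrite partner_q (bigD1 i) //= pqE_q eqxx big1 => [|t ti]; last first.
    by rewrite pqE_q (negbTE ti).
  rewrite addr0 /bc; congr (_ @_ _); apply/mnmP => s.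
  by rewrite mnmBU mnmDE !mnm1E addnK.
Qed.

Lemma pure_U j : pure U_(j).
Proof.
rewrite -[j]splitK; case: (split j) => i /=; apply/orP; [left|right];
  by apply/forallP => s; rewrite mnm1E ?eq_pq ?eq_qp.
Qed.

Lemma B_partD v x y : B_part v x -> B_part v y -> B_part v (x + y).
Proof.
move=> [f hf ->] [g hg ->]; exists (f + g); last by rewrite rmorphD.
by move=> m /msuppD_le; rewrite mem_cat => /orP[/hf|/hg].
Qed.

Lemma B_partZ v w f x : bihomog v f -> B_part w x -> B_part (add_bideg v w) (f *: x).
Proof.
move=> hf [g hg ->]; exists (f * g); last by rewrite rmorphM.
by move=> m /msuppM_le/allpairsP[[m1 m2] /= [/hf <- /hg <- ->]]; exact: bidegD.
Qed.

Lemma B_part_bc v x m : B_part v x -> pure m -> bideg m <> v -> bc x m = 0.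
Proof.
move=> [f hf ->] pm mv; rewrite bc_pi //; apply/eqP; rewrite mcoeff_eq0.
by apply/negP => /hf.
Qed.

Lemma B_part_bw v x : B_part v x -> v <> (1, 1)%N -> bw x = 0.
Proof.
move=> [f hf ->] v1; rewrite bw_pi /wcoef big1 // => i _; apply/eqP; rewrite mcoeff_eq0.
by apply/negP => /hf; rewrite bideg_pq => /esym.
Qed.

Lemma B_realize v (c : 'X_{1..n + n} -> k) (w : k) :
    (forall m, bideg m <> v -> c m = 0) -> (v <> (1, 1)%N -> w = 0) ->
  exists x : B, [/\ B_part v x, forall m, pure m -> bc x m = c m & bw x = w].
Proof.
move=> cv wv; have lt0 : (0 < n)%N by apply: leq_trans hn.
have [|f fE] := @mpoly_of_coef _ _ (fun m => if pure m then c m else 0) (v.1 + v.2).+1.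
  move=> m; rewrite -bideg_mdeg => lt; rewrite cv ?if_same // => E.
  by rewrite E ltnn in lt.
pose i0 := Ordinal lt0.
exists (\pi_B (f + w *: 'X_[pq i0])); split.
- exists (f + w *: 'X_[pq i0]) => // m; rewrite mcoeff_msupp mcoeffD mcoeffZ mcoeffX fE.
  move=> nz; apply/eqP; apply: contraNT nz => /eqP mv; rewrite cv // if_same add0r.
  have [E|] := eqVneq (pq i0) m; last by rewrite mulr0.
  by rewrite wv ?mul0r // => v1; case: mv; rewrite -E bideg_pq v1.
- move=> m pm; rewrite bc_pi // mcoeffD mcoeffZ mcoeffX fE pm.
  case: eqP => [E|]; last by rewrite mulr0 addr0.
  by have := pq_not_pure i0; rewrite E pm.
rewrite bw_pi /wcoef (bigD1 i0) //= mcoeffD mcoeffZ mcoeffX eqxx mulr1 fE.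
rewrite (negbTE (pq_not_pure _)) add0r big1 ?addr0 // => t ti.
rewrite mcoeffD mcoeffZ mcoeffX fE (negbTE (pq_not_pure _)) add0r.
by case: eqP => [/pq_inj E|_]; [rewrite E eqxx in ti | rewrite mulr0].
Qed.

End RingB.

(** * The Lefschetz operator on the exterior algebra *)

Section SubsetLattice.
Variables (I : finType) (k : fieldType).
Implicit Types D T Z : {set I}.

(** In the lattice of subsets of a set of size [2s+1], the incidence matrix
    between the levels [s] and [s+1] is invertible once [(s+1)!] is.  A column
    of the inverse depends only on the size of the intersection with the given
    [s]-subset [T], and solving the resulting two-term recursion gives the
    coefficients below. *)
Lemma subset_lattice_delta T Z : T \subset Z -> #|Z| = (2 * #|T|).+1 ->
    (#|T|.+1)`!%:R != 0 :> k ->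
  exists beta : {set I} -> k,
    (forall D, ~~ ((D \subset Z) && (#|D| == #|T|.+1)) -> beta D = 0) /\
    (forall D, \sum_(i | i \notin D) beta (i |: D) = (D == T)%:R).
Proof.
set s := #|T| => TZ cZ nz.
(* [alpha i] is the coefficient of the sets that meet [T] in [i] points. *)
pose alpha i : k := (-1) ^+ (s - i) * ((s - i)`! * i`!)%:R / (s.+1)`!%:R.
have alphaS i : (i < s)%N -> alpha i * i.+1%:R + alpha i.+1 * (s - i)%:R = 0.
  move=> lt; rewrite /alpha -(subnSK lt) exprS !factS mulN1r !mulNr !natrM.
  set x := (_ ^+ _); set u := _^-1; ring.
have alpha_s : alpha s * s.+1%:R = 1.
  rewrite /alpha subnn expr0 mul1r fact0 mul1n mulrAC -natrM mulnC -factS.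
  by rewrite divff.
exists (fun D => if (D \subset Z) && (#|D| == s.+1) then alpha #|D :&: T| else 0).
split=> [D /negbTE -> //|D].
have [/andP[DZ /eqP cD]|DZ] := boolP ((D \subset Z) && (#|D| == s)); last first.
  have -> : (D == T) = false.
    by apply: contraNF DZ => /eqP ->; rewrite TZ eqxx.
  rewrite big1 // => i iD; case: ifP => // /andP[]; rewrite subUset cardsU1 iD eqSS.
  by case/andP=> _ DZ' cD; rewrite DZ' cD in DZ.
set t := #|D :&: T|.
have ts : (t <= s)%N by rewrite subset_leq_card // subsetIr.
pose E := T :\: D; pose F := Z :\: (T :|: D).
have cE : #|E| = (s - t)%N by rewrite cardsD setIC.
have cF : #|F| = t.+1.
  rewrite cardsD cZ (setIidPr _) ?subUset ?TZ // cardsU -/s cD setIC -/t; lia.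
rewrite (bigID [in E]) (eq_bigl [in E]) /=; last first.
  by move=> i; rewrite !inE; case: (i \in D).
rewrite [X in _ + X](bigID [in F]) /= [X in _ + (X + _)](eq_bigl [in F]) /=; last first.
  by move=> i; rewrite !inE; case: (i \in D); case: (i \in T); rewrite ?andbF.
rewrite [X in _ + (_ + X)]big1 ?addr0; last first.
  move=> i; rewrite !inE => /andP[/andP[iD iT] iF].
  rewrite iD /= in iT; rewrite (negbTE iD) (negbTE iT) /= in iF.
  by rewrite subUset sub1set (negbTE iF).
rewrite (eq_bigr (fun=> alpha t.+1)); last first.
  move=> i; rewrite inE => /andP[iD iT].
  rewrite subUset sub1set (subsetP TZ _ iT) DZ cardsU1 iD cD eqxx /=; congr alpha.
  rewrite setIUl cardsU [X in (X + _ - _)%N](_ : _ = 1%N) ?add1n -/t.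
    rewrite (_ : _ :&: _ = set0) ?cards0 ?subn0 //.
    apply/setP => j; rewrite !inE; case: eqP => [->|] //=.
    by rewrite (negbTE iD) andbF.
  by rewrite (setIidPl _) ?cards1 // sub1set.
rewrite [X in _ + X](eq_bigr (fun=> alpha t)); last first.
  move=> i; rewrite !inE negb_or => /andP[/andP[iT iD] iZ].
  rewrite subUset sub1set iZ DZ cardsU1 iD cD eqxx /=; congr (alpha #|pred_of_set _|).
  by apply/setP => j; rewrite !inE; case: eqP => [->|] //=; rewrite (negbTE iT) !andbF.
rewrite !sumr_const cE cF -(mulr_natr (alpha t.+1)) -(mulr_natr (alpha t)).
have [tS|st] := ltnP t s.
  rewrite addrC alphaS //; case: eqP => // DT.
  by move: tS; rewrite /t DT setIid ltnn.
have tS : t = s by apply/eqP; rewrite eqn_leq ts.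
rewrite tS subnn mulr0 add0r alpha_s.
suff -> : D = T by rewrite eqxx.
apply/eqP; rewrite eqEcard cD leqnn andbT.
by apply/setIidPl/eqP; rewrite eqEcard subsetIl cD -/t tS leqnn.
Qed.

End SubsetLattice.

Section Lefschetz.
Variables (n : nat) (k : fieldType).
Hypothesis hchar : forall p : nat, p \in [pchar k] -> (n + 1 < 2 * p)%N.
Notation p := (@lshift n n).
Notation q := (@rshift n n).
Notation set2n := {set 'I_(n + n)}.
Implicit Types (A C : {set 'I_(n + n)}) (z y w : {ffun {set 'I_(n + n)} -> k}).

Definition dset (v : nat * nat) := [set A : set2n | sdeg A == v].
Definition addpq (i : 'I_n) A := p i |: (q i |: A).

(** Contraction with [p_1 q_1 + ... + p_n q_n], up to sign.  The signs are those
    that two successive Koszul boundaries produce. *)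
Definition lef z : {ffun set2n -> k} :=
  [ffun C : set2n => \sum_(i | (p i \notin C) && (q i \notin C))
               ksign k (q i) C * ksign k (p i) C * z (addpq i C)].

Lemma fact_neq0 j : (2 * j <= n + 1)%N -> (j`!)%:R != 0 :> k.
Proof.
elim: j => [|j IH] lt; first by rewrite fact0 oner_eq0.
rewrite factS natrM mulf_neq0 ?IH //; last by lia.
apply/negP => j0; have [//|r rk] := natf0_pchar _ j0; have := hchar rk.
have : (r %| j.+1)%N by rewrite (dvdn_pcharf rk).
by move/dvdn_leq => /(_ isT); lia.
Qed.

Lemma in_addpq_p i j A : (p j \in addpq i A) = (j == i) || (p j \in A).
Proof. by rewrite !inE eq_pp eq_pq. Qed.

Lemma in_addpq_q i j A : (q j \in addpq i A) = (j == i) || (q j \in A).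
Proof. by rewrite !inE eq_qp eq_qq. Qed.

Lemma set2n_ext A C : (forall i, (p i \in A) = (p i \in C)) ->
  (forall i, (q i \in A) = (q i \in C)) -> A = C.
Proof.
by move=> Ep Eq; apply/setP => j; rewrite -[j]splitK; case: (split j) => i /=.
Qed.

Lemma sdeg_addpq i A : p i \notin A -> q i \notin A ->
  sdeg (addpq i A) = ((sdeg A).1.+1, (sdeg A).2.+1).
Proof.
move=> pA qA; rewrite sdeg_setU1 ?sdeg_setU1 //; last by rewrite !inE eq_pq.
by rewrite bideg_p bideg_q.
Qed.

(** Reordering the basis vectors so that each [q_i] stands next to [p_i] turns
    the operator into a sum without signs; [inversions] counts the
    transpositions that this takes. *)
Definition inversions A : nat :=
  (\sum_i \sum_j ((q i \in A) && (p j \in A) && (i < j)))%N.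
Definition twist A : k := (-1) ^+ inversions A.

Lemma below_q i A : below (q i) A = (\sum_j (p j \in A) + \sum_j ((q j \in A) && (j < i)))%N.
Proof.
rewrite /below -sum1_card big_mkcond big_split_ord /=; congr addn; apply: eq_bigr => j _;
  rewrite !inE /=.
  by rewrite (leq_trans (ltn_ord j)) ?leq_addr // andbT; case: (_ \in _).
by rewrite ltn_add2l; case: (_ && _).
Qed.

Lemma below_p i A : below (p i) A = (\sum_j ((p j \in A) && (j < i)))%N.
Proof.
rewrite /below -sum1_card big_mkcond big_split_ord /= [X in (_ + X)%N]big1 ?addn0 => [|j _].
  by apply: eq_bigr => j _; rewrite !inE /=; case: (_ && _).
by rewrite !inE /= ltnNge (leq_trans (ltnW (ltn_ord i))) ?leq_addr // andbF.
Qed.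

Lemma inversions_addpq i A : p i \notin A -> q i \notin A ->
  inversions (addpq i A) = (inversions A + \sum_j ((q j \in A) && (j < i))
                            + \sum_j ((p j \in A) && (i < j)))%N.
Proof.
move=> pA qA; rewrite /inversions.
rewrite (eq_bigr (fun l => \sum_j ((q l \in A) && (p j \in A) && (l < j)) +
   ((q l \in A) && (l < i)) + (l == i) * \sum_j ((p j \in A) && (i < j)))%N).
  rewrite !big_split /=; congr addn; set X := (\sum_j ((p j \in A) && (i < j)))%N.
  by rewrite (bigD1 i) //= eqxx mul1n big1 ?addn0 // => l /negbTE ->.
move=> l _; under eq_bigr do rewrite in_addpq_p in_addpq_q.
have [->|li] := eqVneq l i.
  rewrite (negbTE qA) /= [X in (X + _ + _)%N]big1 // mul1n add0n.
  by apply: eq_bigr => j _; case: eqVneq => [->|//]; rewrite ltnn !andbF.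
rewrite mul0n addn0 /=.
rewrite (bigD1 i) //= eqxx /= [in RHS](bigD1 i) //= (negbTE pA) andbF /= add0n andbT addnC.
by congr addn; apply: eq_bigr => j /negbTE ->.
Qed.

Lemma twist_addpq i A : p i \notin A -> q i \notin A ->
  ksign k (q i) A * ksign k (p i) A * twist (addpq i A) = twist A.
Proof.
move=> pA qA; rewrite /ksign /twist -!exprD.
suff E : odd (below (q i) A + below (p i) A + inversions (addpq i A)) = odd (inversions A).
  by rewrite -[LHS]signr_odd E signr_odd.
rewrite inversions_addpq // below_q below_p.
have -> : (\sum_j (p j \in A) = \sum_j ((p j \in A) && (j < i)) + \sum_j ((p j \in A) && (i < j)))%N.
  rewrite -big_split; apply: eq_bigr => j _ /=.
  case: (ltngtP j i) => [||/val_inj ->]; rewrite ?andbT ?andbF ?addn0 //.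
  by rewrite (negbTE pA).
rewrite !oddD; set a := odd _; set b := odd _; set c := odd _; set d := odd _.
by case: a; case: b; case: c; case: d.
Qed.

Lemma twist_sqr A : twist A * twist A = 1.
Proof. by rewrite -expr2 sqrr_sign. Qed.

Definition lef0 z : {ffun set2n -> k} :=
  [ffun C : set2n => \sum_(i | (p i \notin C) && (q i \notin C)) z (addpq i C)].
Definition twistf z : {ffun set2n -> k} := [ffun A : set2n => twist A * z A].

Lemma twistfK z : twistf (twistf z) = z.
Proof. by apply/ffunP => A; rewrite !ffunE mulrA twist_sqr mul1r. Qed.

Lemma lef_twist z : lef (twistf z) = twistf (lef0 z).
Proof.
apply/ffunP => C; rewrite !ffunE mulr_sumr; apply: eq_bigr => i /andP[pC qC].
by rewrite ffunE mulrA twist_addpq.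
Qed.

Lemma supp_twist T z : supp_on T z -> supp_on T (twistf z).
Proof. by move=> Tz A TA; rewrite ffunE Tz ?mulr0. Qed.

Lemma lefB x y : lef (x - y) = lef x - lef y.
Proof. by apply/ffunP => C; rewrite !ffunE -sumrB; apply: eq_bigr => i _; rewrite !ffunE mulrBr. Qed.

Lemma lefZ c x : lef (fscale c x) = fscale c (lef x).
Proof. by apply/ffunP => C; rewrite !ffunE mulr_sumr; apply: eq_bigr => i _; rewrite !ffunE mulrCA. Qed.

Lemma lef_supp a b z : supp_on (dset (a.+1, b.+1)) z -> supp_on (dset (a, b)) (lef z).
Proof.
move=> Tz C; rewrite inE => TC; rewrite ffunE big1 // => i /andP[pC qC].
by rewrite Tz ?mulr0 // inE sdeg_addpq //; apply: contraNN TC.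
Qed.

Definition pairs A := [set i | (p i \in A) && (q i \in A)].
Definition singles_p A := [set i | (p i \in A) && (q i \notin A)].
Definition singles_q A := [set i | (q i \in A) && (p i \notin A)].

Lemma sum_card (P : pred 'I_n) : (\sum_i (P i : nat) = #|[set i | P i]|)%N.
Proof. by rewrite -sum1_card [RHS]big_mkcond; apply: eq_bigr => i _; rewrite inE; case: (P i). Qed.

Lemma sdegE A : sdeg A = (#|pairs A| + #|singles_p A|, #|pairs A| + #|singles_q A|)%N.
Proof.
rewrite /sdeg -!sum_card -!big_split; congr (_, _); apply: eq_bigr => i _ /=;
  by case: (p i \in A); case: (q i \in A).
Qed.

(** Fixing the unpaired indices of [A0] reduces the operator to the inclusion of
    [s]-subsets in [s+1]-subsets of the set [R] of the other indices, where [s]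
    is the number of pairs.  The bound on the degree makes [R] large enough to
    contain a set of size [2s+1] around the pairs of [A0]. *)
Lemma lef0_delta A0 : ((sdeg A0).1 + (sdeg A0).2 < n)%N ->
  exists2 z, supp_on (dset ((sdeg A0).1.+1, (sdeg A0).2.+1)) z &
    lef0 z = [ffun C : set2n => (C == A0)%:R].
Proof.
move=> lt; set T := pairs A0; pose R := ~: (singles_p A0 :|: singles_q A0).
have TR : T \subset R.
  by apply/subsetP => i; rewrite !inE; case: (p i \in A0); case: (q i \in A0).
have cR : (#|R| + (sdeg A0).1 + (sdeg A0).2 = n + 2 * #|T|)%N.
  have := cardsC (singles_p A0 :|: singles_q A0); rewrite -/R cardsU card_ord.
  rewrite (_ : _ :&: _ = set0) ?cards0 ?subn0 ?sdegE /=; last first.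
    by apply/setP => i; rewrite !inE; case: (p i \in A0); case: (q i \in A0).
  by rewrite -/T; lia.
pose Z := T :|: [set:: take #|T|.+1 (enum (R :\: T))].
have cRT : #|R :\: T| = (#|R| - #|T|)%N by rewrite cardsD (setIidPr TR).
have ctake : #|[set:: take #|T|.+1 (enum (R :\: T))]| = #|T|.+1.
  rewrite cardsE (card_uniqP (take_uniq _ (enum_uniq _))) size_takel // -cardE cRT.
  by have := subset_leq_card TR; lia.
have subRT i : i \in take #|T|.+1 (enum (R :\: T)) -> i \in R :\: T.
  by move/mem_take; rewrite mem_enum.
have ZR : Z \subset R.
  rewrite subUset TR; apply/subsetP => i; rewrite in_set => /subRT.
  by rewrite in_setD => /andP[].
have cZ : #|Z| = (2 * #|T|).+1.
  rewrite cardsU ctake (_ : _ :&: _ = set0) ?cards0; first by lia.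
  apply/setP => i; rewrite in_setI in_set0; apply/negbTE/negP => /andP[iT].
  by rewrite in_set => /subRT; rewrite in_setD iT.
have nz : (#|T|.+1)`!%:R != 0 :> k.
  have Rn : (#|R| <= n)%N by rewrite -[X in (_ <= X)%N]card_ord max_card.
  by apply: fact_neq0; have := subset_leq_card ZR; rewrite cZ; lia.
have [beta [beta0 betaS]] := subset_lattice_delta (subsetUl _ _ : T \subset Z) cZ nz.
pose same A := (singles_p A == singles_p A0) && (singles_q A == singles_q A0).
exists [ffun A : set2n => if same A then beta (pairs A) else 0].
  move=> A; rewrite inE ffunE => degA; case: ifP => // /andP[/eqP Ep /eqP Eq].
  apply: beta0; apply: contraNN degA => /andP[_ /eqP cA].
  by rewrite !sdegE Ep Eq cA !addSn.
apply/ffunP => C; rewrite !ffunE; under eq_bigr do rewrite ffunE.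
have same_add i : p i \notin C -> q i \notin C -> same (addpq i C) = same C.
  move=> pC qC; rewrite /same.
  have [-> -> //] : singles_p (addpq i C) = singles_p C /\ singles_q (addpq i C) = singles_q C.
  split; apply/setP => j; rewrite !inE !eq_pp !eq_qq !eq_pq !eq_qp; case: eqP => //= ->;
    by rewrite (negbTE pC) (negbTE qC).
have [sC|sC] := boolP (same C); last first.
  rewrite big1 => [|i /andP[pC qC]]; last by rewrite same_add // (negbTE sC).
  by case: eqP => // E; rewrite E /same !eqxx in sC.
have pairs_add i : p i \notin C -> q i \notin C -> pairs (addpq i C) = i |: pairs C.
  by move=> pC qC; apply/setP => j; rewrite !inE !eq_pp !eq_qq !eq_pq !eq_qp; case: eqP.
have -> : (C == A0) = (pairs C == T).
  apply/eqP/eqP => [-> //|E]; case/andP: sC => /eqP/setP Ep /eqP/setP Eq.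
  move/setP: E => E; apply: set2n_ext => i; move: (E i) (Ep i) (Eq i);
    by rewrite !inE; do 4!case: (_ \in _).
rewrite -betaS [in RHS](bigID (fun i => (p i \notin C) && (q i \notin C))) /=.
rewrite [X in _ = _ + X]big1 ?addr0; last first.
  move=> i; rewrite !inE => /andP[iD iC]; apply: beta0.
  apply: contraNN iC => /andP[/subsetP/(_ i)]; rewrite setU11 => /(_ isT) iZ _.
  have := subsetP ZR _ iZ; case/andP: sC => /eqP/setP/(_ i) Ep /eqP/setP/(_ i) Eq.
  rewrite in_setC in_setU -Ep -Eq !inE; move: iD.
  by case: (p i \in C); case: (q i \in C).
apply: eq_big => [i|i /andP[pC qC]]; last by rewrite same_add // sC pairs_add.
by rewrite !inE; case: (p i \in C); case: (q i \in C).
Qed.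

Lemma lef_surj a b w : (a + b < n)%N -> supp_on (dset (a, b)) w ->
  exists2 z, supp_on (dset (a.+1, b.+1)) z & lef z = w.
Proof.
move=> lt Tw; have /choice[d dP] : forall A, exists z, A \in dset (a, b) ->
    supp_on (dset (a.+1, b.+1)) z /\ lef0 z = [ffun C : set2n => (C == A)%:R].
  move=> A; have [|] := boolP (A \in dset (a, b)); last by exists 0.
  rewrite inE => /eqP E; have [|z] := @lef0_delta A; rewrite E //= => Tz Lz.
  by exists z.
have lef0_sum c : lef0 (\sum_(A in dset (a, b)) fscale (c A) (d A)) =
    [ffun C : set2n => if C \in dset (a, b) then c C else 0].
  apply/ffunP => C; rewrite !ffunE; under eq_bigr do rewrite sum_ffunE.
  rewrite exchange_big /= (eq_bigr (fun A => c A * (C == A)%:R)); last first.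
    move=> A TA; have /ffunP/(_ C) := (dP A TA).2; rewrite !ffunE => <-.
    by rewrite mulr_sumr; apply: eq_bigr => i _; rewrite ffunE.
  rewrite big_mkcond (bigD1 C) //= eqxx mulr1 big1 ?addr0 // => A /negbTE AC.
  by rewrite eq_sym AC mulr0 if_same.
exists (twistf (\sum_(A in dset (a, b)) fscale (twistf w A) (d A))).
  apply: supp_twist => A TA; rewrite sum_ffunE big1 // => C TC.
  by rewrite ffunE (dP C TC).1 ?mulr0.
rewrite lef_twist lef0_sum -[RHS]twistfK; congr twistf; apply/ffunP => C.
by rewrite ffunE; case: ifPn => // TC; rewrite !ffunE Tw ?mulr0.
Qed.

(** Complementation of subsets exchanges the operator with its transpose, so
    preimages of basis vectors below the middle are linear forms that recover
    the coefficients of [z] above it. *)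
Lemma lef_inj a b z : (n <= a + b + 1)%N -> supp_on (dset (a.+1, b.+1)) z ->
  lef z = 0 -> z = 0.
Proof.
move=> le Tz Lz; suff E : twistf z = 0.
  by rewrite -[z]twistfK E; apply/ffunP => A; rewrite !ffunE mulr0.
have {}Tz := supp_twist Tz; move: Lz.
rewrite -[z in lef z]twistfK lef_twist => /(congr1 twistf); rewrite twistfK.
move: (twistf z) Tz => x Tz; have -> : twistf 0 = 0 by apply/ffunP => A; rewrite !ffunE mulr0.
move=> Lx; apply/ffunP => A0; rewrite ffunE.
have [TA|/Tz //] := boolP (A0 \in dset (a.+1, b.+1)).
have degC A : ((sdeg A).1 + (sdeg (~: A)).1)%N = n /\ ((sdeg A).2 + (sdeg (~: A)).2)%N = n.
  rewrite -!big_split; split; rewrite (eq_bigr (fun=> 1%N)) ?sum1_card ?card_ord // => i _ /=;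
    by rewrite inE; case: (_ \in _).
have [|y _ Ly] := @lef0_delta (~: A0).
  by have := degC A0; move: TA; rewrite inE => /eqP -> /= [? ?]; lia.
have : \sum_C y (~: C) * lef0 x C = 0 by rewrite Lx big1 // => C _; rewrite ffunE mulr0.
have -> : \sum_C y (~: C) * lef0 x C = \sum_A lef0 y (~: A) * x A.
  under eq_bigr do rewrite ffunE mulr_sumr big_mkcond /=.
  under [RHS]eq_bigr do rewrite ffunE mulr_suml big_mkcond /=.
  rewrite exchange_big [RHS]exchange_big /=; apply: eq_bigr => i _.
  rewrite -!big_mkcond /=.
  rewrite [RHS](reindex_onto (addpq i) (fun A => A :\ p i :\ q i)) /=; last first.
    move=> A; rewrite !inE !negbK => /andP[pA qA]; apply: set2n_ext => j;
      rewrite !inE ?eq_pp ?eq_qq ?eq_pq ?eq_qp /=; by case: eqP => [->|] //=; rewrite ?pA ?qA.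
  apply: eq_big => [C|C /andP[pC qC]].
    rewrite !inE !eqxx ?eq_pq ?eq_qp /=.
    apply/idP/eqP => [/andP[pC qC]|<-]; last by rewrite !inE !eqxx !andbF.
    apply: set2n_ext => j; rewrite !inE ?eq_pp ?eq_qq ?eq_pq ?eq_qp /=; case: eqP => [->|] //=.
      by rewrite (negbTE pC).
    by rewrite (negbTE qC).
  congr (y _ * _); apply: set2n_ext => j; rewrite !inE ?eq_pp ?eq_qq ?eq_pq ?eq_qp;
    by case: eqP => [->|] //=; rewrite ?pC ?qC.
rewrite Ly (bigD1 A0) //= ffunE eqxx mul1r big1 ?addr0 // => A AA0.
by rewrite ffunE (inj_eq (@setC_inj _)) (negbTE AA0) mul0r.
Qed.

Lemma card_dset a b : #|dset (a, b)| = ('C(n, a) * 'C(n, b))%N.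
Proof.
pose f A : {set 'I_n} * {set 'I_n} := (p @^-1: A, q @^-1: A).
pose g (XY : {set 'I_n} * {set 'I_n}) : set2n := p @: XY.1 :|: q @: XY.2.
have mem_gp X Y i : (p i \in g (X, Y)) = (i \in X).
  rewrite in_setU mem_imset; last exact: lshift_inj.
  by rewrite [X in _ || X](_ : _ = false) ?orbF //; apply/negP => /imsetP[j _ /eqP]; rewrite eq_pq.
have mem_gq X Y i : (q i \in g (X, Y)) = (i \in Y).
  rewrite in_setU [X in _ || X]mem_imset; last exact: rshift_inj.
  by rewrite [X in X || _](_ : _ = false) //; apply/negP => /imsetP[j _ /eqP]; rewrite eq_qp.
have fK : cancel f g.
  by move=> A; apply: set2n_ext => i; rewrite ?mem_gp ?mem_gq inE.
have gK : cancel g f.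
  by move=> [X Y]; congr (_, _); apply/setP => i; rewrite inE ?mem_gp ?mem_gq.
have -> : dset (a, b) = f @^-1: setX [set X : {set 'I_n} | #|X| == a] [set Y : {set 'I_n} | #|Y| == b].
  apply/setP => A; rewrite !inE /sdeg !sum_card xpair_eqE.
  by congr ((#|pred_of_set _| == _) && (#|pred_of_set _| == _)); apply/setP => i; rewrite !inE.
rewrite on_card_preimset; last by exists g => ? _; [exact: fK | exact: gK].
by rewrite cardsX !card_draws card_ord.
Qed.

End Lefschetz.

(** * Koszul homology of [B] *)

Section KoszulHomology.
Variables (n : nat) (k : fieldType).
Hypothesis hn : (2 <= n)%N.
Notation S := {mpoly k[n + n]}.
Notation B := (B n k).
Notation p := (@lshift n n).
Notation q := (@rshift n n).
Notation set2n := {set 'I_(n + n)}.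
Notation K := (koszul n k).
Notation chain i := {ffun 'I_#|kset n i| -> B}.
Notation boundary := (@tensor_boundary n k B (@B_part n k) K _).
Implicit Types (A C T : {set 'I_(n + n)}) (m : 'X_{1..n + n}) (v : nat * nat).
Implicit Types (z y : {ffun {set 'I_(n + n)} -> k}).

Definition cx i (x : chain i) A m : k := bc (extend x A) m.
Definition cw i (x : chain i) A : k := bw (extend x A).

Lemma extend_diff i (x : chain i.+1) C :
  extend (tensor_diff (F := K) x) C =
  \sum_(j | j \notin C) (ksign k j C *: 'X_j : S) *: extend x (j |: C).
Proof. by rewrite -koszul_action; apply: eq_bigr => b _; rewrite ffunE. Qed.

Lemma cx_diff i (x : chain i.+1) C m : pure m ->
  cx (tensor_diff (F := K) x) C m = kdiff (cx x) C m.
Proof.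
move=> pm; rewrite /cx extend_diff bc_sum // /kdiff big_mkcondr.
by apply: eq_bigr => j _; rewrite bcX.
Qed.

Lemma cw_diff i (x : chain i.+1) C :
  cw (tensor_diff (F := K) x) C =
  \sum_(j | j \notin C) ksign k j C * cx x (j |: C) U_(partner j).
Proof. by rewrite /cw extend_diff bw_sum //; apply: eq_bigr => j _; rewrite bwX. Qed.

Lemma chain_ext i (x y : chain i) : (forall A m, pure m -> cx x A m = cx y A m) ->
  (forall A, cw x A = cw y A) -> x = y.
Proof.
move=> Ex Ew; apply/ffunP => a; rewrite -!(extend_val _ a).
by apply: (B_ext hn) => [m pm|]; [exact: Ex|exact: Ew].
Qed.

Lemma extend_ffunB i (x y : chain i) A : extend (x - y) A = extend x A - extend y A.
Proof. by rewrite -extendB; apply: eq_bigr => a _; rewrite !ffunE. Qed.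

Lemma cxB i (x y : chain i) A m : pure m -> cx (x - y) A m = cx x A m - cx y A m.
Proof. by move=> pm; rewrite /cx extend_ffunB bcB. Qed.

Lemma cwB i (x y : chain i) A : cw (x - y) A = cw x A - cw y A.
Proof. by rewrite /cw extend_ffunB bwB. Qed.

Lemma cx0 i A m : pure m -> cx (0 : chain i) A m = 0.
Proof. by move=> pm; rewrite -[0 in LHS](subrr 0) cxB // subrr. Qed.

Lemma cw0 i A : cw (0 : chain i) A = 0.
Proof. by rewrite -[0 in LHS](subrr 0) cwB subrr. Qed.

Section Support.
Variables (i : nat) (v : nat * nat) (x : chain i).
Hypothesis gx : tensor_part (F := K) (@B_part n k) v x.

Lemma extend_part A : extend x A = 0 \/
  #|A| = i /\ exists2 w, B_part w (extend x A) & v = add_bideg w (sdeg A).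
Proof.
have [Ai|Ai] := boolP (A \in kset n i); last by left; rewrite extend_out.
rewrite extend_in; case: (gx (enum_rank_in Ai A)) => [->|[w Bw vE]]; first by left.
right; split; first by have := Ai; rewrite inE => /eqP.
by exists w => //; rewrite vE /= enum_rankK_in.
Qed.

Lemma cx_supp A m : pure m -> cx x A m != 0 ->
  #|A| = i /\ v = add_bideg (bideg m) (sdeg A).
Proof.
move=> pm; rewrite /cx; case: (extend_part A) => [->|[cA [w Bw vE]]].
  by rewrite bc0 ?eqxx.
move=> nz; split=> //; rewrite vE; congr add_bideg; apply/eqP.
by apply: contraNT nz => /eqP wm; rewrite (B_part_bc hn Bw) // => /esym.
Qed.

Lemma cx_mdeg A m : pure m -> cx x A m != 0 -> (mdeg m + i = v.1 + v.2)%N.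
Proof.
move=> pm /(cx_supp pm)[<- ->]; rewrite -bideg_mdeg -sdeg_card.
by move: (bideg m) (sdeg A) => [a b] [c d] /=; rewrite addnACA.
Qed.

Lemma cw_supp A : cw x A != 0 -> #|A| = i /\ v = add_bideg (1, 1)%N (sdeg A).
Proof.
rewrite /cw; case: (extend_part A) => [->|[cA [w Bw vE]]].
  by rewrite bw0 ?eqxx.
move=> nz; split=> //; rewrite vE; congr add_bideg; apply/eqP.
by apply: contraNT nz => /eqP wm; rewrite (B_part_bw hn Bw).
Qed.

Lemma cw_mdeg A : cw x A != 0 -> (i.+2 = v.1 + v.2)%N.
Proof. by move=> /cw_supp[<- ->]; rewrite -sdeg_card; case: (sdeg A) => a b /=; lia. Qed.

(** The cycle condition, in a form that covers degree zero as well. *)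
Lemma cycle_cx : tensor_cycle (F := K) x -> forall C m, pure m -> kdiff (cx x) C m = 0.
Proof.
case: i x gx cx_supp => [|j] x' gx' supp /= cyc C m pm.
  rewrite /kdiff big1 // => l /andP[lC _]; have [->|nz] := eqVneq (cx x' (l |: C) (m - U_(l))%MM) 0.
    by rewrite mulr0.
  by have [] := supp _ _ (pureBU l pm) nz; rewrite cardsU1 lC.
by rewrite -cx_diff // cyc cx0.
Qed.

Lemma cycle_cw : tensor_cycle (F := K) x ->
  forall C, \sum_(j | j \notin C) ksign k j C * cx x (j |: C) U_(partner j) = 0.
Proof.
case: i x gx cx_supp => [|j] x' gx' supp /= cyc C.
  rewrite big1 // => l lC; have [->|nz] := eqVneq (cx x' (l |: C) U_(partner l)%MM) 0.
    by rewrite mulr0.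
  by have [] := supp _ _ (pure_U _) nz; rewrite cardsU1 lC.
by rewrite -cw_diff // cyc cw0.
Qed.

End Support.

Lemma chain_realize i v (c : set2n -> 'X_{1..n + n} -> k) (w : set2n -> k) :
    (forall A m, c A m != 0 -> #|A| = i /\ v = add_bideg (bideg m) (sdeg A)) ->
    (forall A, w A != 0 -> #|A| = i /\ v = add_bideg (1, 1)%N (sdeg A)) ->
  exists x : chain i, [/\ tensor_part (F := K) (@B_part n k) v x,
    forall A m, pure m -> cx x A m = c A m & forall A, cw x A = w A].
Proof.
move=> cP wP.
have ex A : exists x : B, [/\ x = 0 \/ exists2 u, B_part u x & v = add_bideg u (sdeg A),
    forall m, pure m -> bc x m = c A m & bw x = w A].
  pose u := (v.1 - (sdeg A).1, v.2 - (sdeg A).2)%N.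
  have uP d : v = add_bideg d (sdeg A) -> d = u.
    by move=> E; rewrite /u E /= !addnK; case: (d).
  have [E|ne] := eqVneq v (add_bideg u (sdeg A)).
    have [||x [Bx xc xw]] := @B_realize n k hn u (c A) (w A).
    - by move=> m mu; apply/eqP; apply: contra_notT mu => /cP[_ /uP].
    - by move=> u1; apply/eqP; apply: contra_notT u1 => /wP[_ /uP].
    by exists x; split=> //; right; exists u.
  exists 0; split=> [|m pm|]; first by left.
    rewrite bc0 //; apply/esym/eqP; apply: contraNT ne => /cP[_ E].
    by rewrite -(uP _ E) -E.
  by rewrite bw0 //; apply/esym/eqP; apply: contraNT ne => /wP[_ E]; rewrite -(uP _ E) -E.
have /choice[f fP] := ex.
pose x : chain i := [ffun a => f (enum_val a)].
have xE A : extend x A = if #|A| == i then f A else 0.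
  have [Ai|Ai] := boolP (A \in kset n i); last by rewrite extend_out //; rewrite inE in Ai; rewrite (negbTE Ai).
  by rewrite extend_in ffunE enum_rankK_in //; rewrite inE in Ai; rewrite Ai.
exists x; split=> [a|A m pm|A].
- by rewrite ffunE; case: (fP (enum_val a)).
- rewrite /cx xE; case: eqP => [_|Ai]; first by case: (fP A) => _ ->.
  by rewrite bc0 //; apply/esym/eqP; apply: contra_notT Ai => /cP[].
rewrite /cw xE; case: eqP => [_|Ai]; first by case: (fP A) => _ _ ->.
by rewrite bw0 //; apply/esym/eqP; apply: contra_notT Ai => /wP[].
Qed.

(** The [p]-pure and the [q]-pure parts of [K (x) B] use only the variables in
    [TP] and in [TQ] respectively; [khom_homotopy] contracts each of them at
    every nonconstant monomial. *)
Definition TP : set2n := [set j : 'I_(n + n) | (j < n)%N].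
Definition TQ : set2n := ~: TP.

Lemma TP_p i : p i \in TP. Proof. by rewrite inE /= ltn_ord. Qed.
Lemma TP_q i : q i \notin TP. Proof. by rewrite inE /= -leqNgt leq_addr. Qed.

Lemma ponly_TP m : ponly m <-> (forall l, (0 < m l)%N -> l \in TP).
Proof.
split=> [mp l|H]; last first.
  by apply/forallP => i; rewrite -leqn0 leqNgt; apply: contra (TP_q i); exact: H.
by rewrite -[l]splitK; case: (split l) => i /=; rewrite ?TP_p // (ponlyP mp).
Qed.

Lemma qonly_TQ m : qonly m <-> (forall l, (0 < m l)%N -> l \in TQ).
Proof.
split=> [mp l|H]; last first.
  apply/forallP => i; rewrite -leqn0 leqNgt; apply/negP => /H.
  by rewrite inE TP_p.
by rewrite -[l]splitK; case: (split l) => i /=; rewrite ?(qonlyP mp) // inE TP_q.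
Qed.

Lemma tsupp_neq0 T A m : (forall l, (0 < m l)%N -> l \in T) -> m != 0%MM ->
  tsupp T A m != set0.
Proof.
move=> mT m0; have [l ml] : exists l, (0 < m l)%N.
  apply/existsP; apply: contraNT m0; rewrite negb_exists => /forallP H.
  by apply/eqP/mnmP => l; rewrite mnm0E; apply/eqP; rewrite -leqn0 leqNgt.
by apply/set0Pn; exists l; rewrite !inE ml orbT mT.
Qed.

Lemma khom_cycle T (x : set2n -> 'X_{1..n + n} -> k) A m :
    (forall l, (0 < m l)%N -> l \in T) -> m != 0%MM ->
    (forall C m', (forall l, (0 < m' l)%N -> l \in T) -> kdiff x C m' = 0) ->
  kdiff (khom T x) A m = x A m.
Proof.
move=> mT m0 dx; rewrite -[RHS](khom_homotopy _ mT) ?tsupp_neq0 //.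
rewrite -[LHS]addr0; congr (_ + _); rewrite /khom; case: pickP => // j jS.
case: ifP => // jA; rewrite dx ?mulr0 // => l; rewrite mnmDU.
case: eqP => [<-|_]; last by rewrite addn0; exact: mT.
by move: jS; rewrite inE => /andP[].
Qed.

Lemma khom_supp T (x : set2n -> 'X_{1..n + n} -> k) A m : khom T x A m != 0 ->
  exists j, [/\ j \in T, j \in A & x (A :\ j) (m + U_(j))%MM != 0].
Proof.
rewrite /khom; case: pickP => [j jS|]; last by rewrite eqxx.
case: ifP => jA; last by rewrite eqxx.
move=> nz; exists j; split=> //; first by move: jS; rewrite inE => /andP[].
by apply: contraNN nz => /eqP ->; rewrite mulr0.
Qed.

Lemma sdeg_setD1 j A m v : j \in A -> v = add_bideg (bideg (m + U_(j))) (sdeg (A :\ j)) ->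
  v = add_bideg (bideg m) (sdeg A).
Proof.
move=> jA ->; rewrite -{2}(setD1K jA) sdeg_setU1; last by rewrite !inE eqxx.
by rewrite bidegD add_bidegA.
Qed.

Lemma ponly_qonly m : ponly m -> qonly m -> m = 0%MM.
Proof.
move=> mp mq; apply/mnmP => l; rewrite mnm0E -[l]splitK.
by case: (split l) => i /=; rewrite ?(ponlyP mp) ?(qonlyP mq).
Qed.

Lemma mdeg_subU m l : (0 < m l)%N -> mdeg m = (mdeg (m - U_(l))).+1.
Proof.
move=> ml; rewrite -addn1 -(mdeg1 l) -mdegD; congr mdeg; apply/mnmP => s.
by rewrite mnmDU mnmBU; case: eqP => [<-|]; rewrite ?subnK ?subn0 ?addn0.
Qed.

Lemma ponlyBU m l : ponly m -> ponly (m - U_(l)).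
Proof. by move=> /forallP H; apply/forallP => s; rewrite mnmBU (eqP (H s)) sub0n. Qed.

Lemma qonlyBU m l : qonly m -> qonly (m - U_(l)).
Proof. by move=> /forallP H; apply/forallP => s; rewrite mnmBU (eqP (H s)) sub0n. Qed.

Section CycleReduction.
Variables (i : nat) (v : nat * nat) (x : chain i).
Hypothesis gx : tensor_part (F := K) (@B_part n k) v x.
Hypothesis dx : forall C m, pure m -> kdiff (cx x) C m = 0.

Lemma khom_P A m : ponly m -> m != 0%MM -> kdiff (khom TP (cx x)) A m = cx x A m.
Proof.
move=> /ponly_TP mp m0; apply: khom_cycle => // C m' /ponly_TP mp'.
by apply: dx; apply/orP; left.
Qed.

Lemma khom_Q A m : qonly m -> m != 0%MM -> kdiff (khom TQ (cx x)) A m = cx x A m.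
Proof.
move=> /qonly_TQ mp m0; apply: khom_cycle => // C m' /qonly_TQ mp'.
by apply: dx; apply/orP; right.
Qed.

Lemma khom_deg T A m : (forall j, j \in T -> pure (m + U_(j))) ->
  khom T (cx x) A m != 0 -> #|A| = i.+1 /\ v = add_bideg (bideg m) (sdeg A).
Proof.
move=> mT /khom_supp[j [jT jA nz]]; have [cA vE] := cx_supp gx (mT j jT) nz.
split; first by rewrite (cardsD1 j) jA cA.
exact: sdeg_setD1 vE.
Qed.

Lemma pureD_P m j : ponly m -> j \in TP -> ponly (m + U_(j)).
Proof.
move=> mp jP; apply/ponly_TP => l; rewrite mnmDU; case: eqP => [<- //|_].
by rewrite addn0; move/ponly_TP: mp; exact.
Qed.

Lemma pureD_Q m j : qonly m -> j \in TQ -> qonly (m + U_(j)).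
Proof.
move=> mp jP; apply/qonly_TQ => l; rewrite mnmDU; case: eqP => [<- //|_].
by rewrite addn0; move/qonly_TQ: mp; exact.
Qed.

(** In this range the homotopies produce chains with nonconstant coefficients, where the
    [p]- and the [q]-part do not interfere.  They bound the cycle except for
    its component along the socle element. *)
Lemma reduce_to_socle : (i + 2 <= v.1 + v.2)%N ->
  exists2 y : chain i.+1, tensor_part (F := K) (@B_part n k) v y &
    forall A m, pure m -> cx (x - tensor_diff (F := K) y) A m = 0.
Proof.
move=> le2.
pose Y A m := if m == 0%MM then 0 else
  if ponly m then khom TP (cx x) A m else if qonly m then khom TQ (cx x) A m else 0.
have [||y [gy yY _]] := @chain_realize i.+1 v Y (fun=> 0); last first.
- exists y => // A m pm; rewrite cxB // cx_diff // (@eq_kdiff _ _ _ Y); last first.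
    by move=> l _ _; rewrite yY // pureBU.
  apply/eqP; rewrite subr_eq0; apply/eqP/esym.
  have [lt|ge] := ltnP (mdeg m) 2.
    have -> : cx x A m = 0.
      by apply/eqP; apply/negPn/negP => nz; have := cx_mdeg gx pm nz; lia.
    rewrite /kdiff big1 // => l /andP[_ ml]; rewrite /Y -mdeg_eq0.
    by have := mdeg_subU ml; case: eqP => ?; rewrite ?mulr0 //; lia.
  have sub0 l : (0 < m l)%N -> (m - U_(l))%MM != 0%MM.
    by move=> ml; rewrite -mdeg_eq0; have := mdeg_subU ml; lia.
  have m0 : m != 0%MM by rewrite -mdeg_eq0; lia.
  have [mp|mp] := boolP (ponly m).
    rewrite -(khom_P A mp m0); apply: eq_kdiff => l _ ml.
    by rewrite /Y (negbTE (sub0 l ml)) ponlyBU.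
  have mq : qonly m by case/orP: pm mp => [->|].
  rewrite -(khom_Q A mq m0); apply: eq_kdiff => l _ ml.
  rewrite /Y (negbTE (sub0 l ml)) (qonlyBU l mq); case: ifP => // mlp.
  by have := sub0 l ml; rewrite (ponly_qonly mlp (qonlyBU l mq)) eqxx.
- by move=> A; rewrite eqxx.
move=> A m; rewrite /Y; case: ifP => _; first by rewrite eqxx.
case: ifP => mp; first by apply: khom_deg => j jP; apply/orP; left; exact: pureD_P.
case: ifP => mq; last by rewrite eqxx.
by apply: khom_deg => j jP; apply/orP; right; exact: pureD_Q.
Qed.

End CycleReduction.
End KoszulHomology.

Section KoszulRanks.
Variables (n : nat) (k : fieldType).
Hypothesis hn : (2 <= n)%N.
Hypothesis hchar : forall p : nat, p \in [pchar k] -> (n + 1 < 2 * p)%N.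
Notation S := {mpoly k[n + n]}.
Notation B := (B n k).
Notation p := (@lshift n n).
Notation q := (@rshift n n).
Notation set2n := {set 'I_(n + n)}.
Notation K := (koszul n k).
Notation chain i := {ffun 'I_#|kset n i| -> B}.
Notation part v x := (tensor_part (F := K) (@B_part n k) v x).
Notation boundary v x := (tensor_boundary (F := K) (@B_part n k) v x).
Notation cycle x := (tensor_cycle (F := K) x).
Notation dif x := (tensor_diff (F := K) x).
Notation TP := (@TP n).
Notation TQ := (@TQ n).
Implicit Types (A C T : {set 'I_(n + n)}) (m : 'X_{1..n + n}) (v : nat * nat).
Implicit Types (z y : {ffun {set 'I_(n + n)} -> k}).

Definition delta y A m : k := if m == 0%MM then y A else 0.

Lemma UsubU (l' l : 'I_(n + n)) : (0 < (U_(l')%MM : 'X_{1..n + n}) l)%N -> l' = l /\ (U_(l') - U_(l))%MM = 0%MM :> 'X_{1..n + n}.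
Proof.
rewrite mnm1E lt0b => /eqP ->; split=> //.
by apply/mnmP => s; rewrite mnmBE subnn mnm0E.
Qed.

Lemma kdiff_delta y A m :
  kdiff (delta y) A m = \sum_(l | l \notin A) (if U_(l)%MM == m then ksign k l A * y (l |: A) else 0).
Proof.
rewrite /kdiff big_mkcondr; apply: eq_bigr => l _; rewrite /delta.
have [<-|ne] := eqVneq U_(l)%MM m.
  by rewrite mnm1E eqxx /=; have [|_ ->] := @UsubU l l; rewrite ?mnm1E ?eqxx.
case: ifP => // ml; case: ifP => E; rewrite ?mulr0 //.
case/eqP: ne; apply/mnmP => s; have /mnmP/(_ s) := eqP E.
rewrite mnmBU mnm0E mnm1E; case: eqP => [<-|_]; first by lia.
by rewrite subn0 => ->.
Qed.

Lemma kdiff_deltaU y A l :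
  kdiff (delta y) A U_(l) = if l \notin A then ksign k l A * y (l |: A) else 0.
Proof.
rewrite kdiff_delta big_mkcond (bigD1 l) //= eqxx big1 ?addr0 // => s sl.
case: ifP => // _; case: eqP => // /mnmP/(_ s).
by rewrite !mnm1E eqxx eq_sym (negbTE sl).
Qed.

Lemma kdiff_delta0 y A m : mdeg m != 1%N -> kdiff (delta y) A m = 0.
Proof.
by move=> m1; rewrite kdiff_delta big1 // => l _; case: eqP => // E; rewrite -E mdeg1 in m1.
Qed.

(** Each [p_i q_i] arises twice, from [p_i] times a [q]-coefficient and from
    [q_i] times a [p]-coefficient, with opposite signs: hence the difference. *)
Lemma socle_component (X : set2n -> 'X_{1..n + n} -> k) yP yQ C :
    (forall i A, X A U_(p i)%MM = kdiff (delta yP) A U_(p i)) ->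
    (forall i A, X A U_(q i)%MM = kdiff (delta yQ) A U_(q i)) ->
  \sum_(j | j \notin C) ksign k j C * X (j |: C) U_(partner j)%MM = lef yP C - lef yQ C.
Proof.
move=> XP XQ; rewrite big_mkcond big_split_ord /= addrC; congr (_ + _).
  rewrite ffunE [RHS]big_mkcond; apply: eq_bigr => i _.
  rewrite partner_q XP kdiff_deltaU !inE eq_pq /=.
  case: (p i \in C); case: ifP => //= qC; rewrite ?mulr0 //.
  rewrite mulrA; congr (_ * _ * _); rewrite /ksign below_setU1 //.
  by rewrite /= ltnNge (leq_trans (ltnW (ltn_ord i))) ?leq_addr.
rewrite ffunE -sumrN [RHS]big_mkcond; apply: eq_bigr => i _.
rewrite partner_p XQ kdiff_deltaU !inE eq_qp /=.
case: (q i \in C); case: ifP => //= pC; rewrite ?mulr0 ?andbF //= mulrA.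
rewrite /addpq setUCA -mulNr; congr (_ * _).
rewrite [LHS]mulrC /ksign below_setU1 // [(p i < q i)%N](_ : _ = true).
  by rewrite add1n exprS mulN1r mulNr.
by rewrite /= (leq_trans (ltn_ord i)) ?leq_addr.
Qed.

Lemma dset_deg a b A : (A \in dset n (a, b)) -> #|A| = (a + b)%N.
Proof. by rewrite inE => /eqP E; rewrite -sdeg_card E. Qed.

(** The [p]-part of the boundary of the constant chain [z].  Unlike the whole
    boundary it need not be a cycle: its boundary is [lef z] times the socle
    element ([cw_dif_pchain]). *)
Definition pchain i z : chain i := [ffun a : 'I_#|kset n i| => \pi_B (\sum_(l | p l \notin enum_val a)
  (ksign k (p l) (enum_val a) * z (p l |: enum_val a)) *: 'X_(p l) : S)].

Lemma cx_pchain i v z A m : (i.+1 = v.1 + v.2)%N -> supp_on (dset n v) z -> pure m ->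
  cx (pchain i z) A m = if ponly m then kdiff (delta z) A m else 0.
Proof.
move=> iv zv pm; have [Ai|Ai] := boolP (A \in kset n i).
  rewrite /cx extend_in ffunE enum_rankK_in // bc_pi // mcoeff_sumE.
  under eq_bigr do rewrite mcoeffZ mcoeffX.
  rewrite kdiff_delta [in RHS]big_mkcond big_split_ord /=.
  have [mp|mp] := boolP (ponly m).
    rewrite [X in _ = _ + X]big1 ?addr0 => [|l _].
      rewrite big_mkcond; apply: eq_bigr => l _.
      by case: ifP => // _; case: eqP => _; rewrite ?mulr1 ?mulr0.
    case: ifP => // _; case: eqP => // E; have := ponlyP mp l.
    by rewrite -E mnm1E eqxx.
  rewrite big1 // => l _; case: eqP => [E|]; rewrite ?mulr0 //.
  case/negP: mp; rewrite -E; apply/forallP => s; by rewrite mnm1E eq_pq.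
rewrite /cx extend_out // bc0 //; case: ifP => // _; rewrite kdiff_delta big1 // => l lA.
case: eqP => // _; rewrite zv ?mulr0 //; apply: contraNN Ai; rewrite !inE => /eqP E.
by have := sdeg_card (l |: A); rewrite E cardsU1 lA -iv; lia.
Qed.

Lemma pchain_part i v z : supp_on (dset n v) z -> part v (pchain i z).
Proof.
move=> zv a; rewrite ffunE; set A := enum_val a.
have [vE|vE] := eqVneq v (add_bideg (1, 0)%N (sdeg A)); last first.
  left; rewrite big1 ?rmorph0 // => l lA; rewrite zv ?mulr0 ?scale0r //.
  apply: contraNN vE; rewrite inE => /eqP <-.
  by rewrite sdeg_setU1 // bideg_p.
right; exists (1, 0)%N => //; eexists; last by [].
move=> m; rewrite mcoeff_msupp mcoeff_sumE => nz; apply/eqP; apply: contraNT nz => m1.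
rewrite big1 // => l _; rewrite mcoeffZ mcoeffX; case: eqP => [E|]; rewrite ?mulr0 //.
by rewrite -E bideg_p eqxx in m1.
Qed.

Lemma kdiff_pchain i v z C m : (i.+1 = v.1 + v.2)%N -> supp_on (dset n v) z -> pure m ->
  kdiff (cx (pchain i z)) C m = 0.
Proof.
move=> iv zv pm.
rewrite (@eq_kdiff _ _ _ (fun A m => if ponly m then kdiff (delta z) A m else 0)); last first.
  by move=> l _ _; rewrite (cx_pchain _ iv zv) // pureBU.
have [mp|mp] := boolP (ponly m).
  rewrite -[RHS](kdiff_kdiff (delta z) C m); apply: eq_kdiff => l _ _.
  by rewrite ponlyBU.
rewrite /kdiff big1 // => l _; case: ifP => [lp|]; rewrite ?mulr0 //.
have mq : qonly m by case/orP: pm mp => [->|].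
by rewrite (ponly_qonly lp (qonlyBU l mq)) -/(kdiff _ _ _) kdiff_delta0 ?mulr0 // mdeg0.
Qed.

Lemma cw_dif_pchain i v z C : (i.+2 = v.1 + v.2)%N -> supp_on (dset n v) z ->
  cw (dif (pchain i.+1 z)) C = lef z C.
Proof.
move=> iv zv; rewrite cw_diff // (@socle_component _ z 0).
- rewrite [lef 0](_ : _ = 0) ?ffunE ?subr0 //; apply/ffunP => D.
  by rewrite !ffunE big1 // => l _; rewrite ffunE mulr0.
- move=> l A; rewrite (cx_pchain _ iv zv) ?pure_U // [ponly _](_ : _ = true) //.
  by apply/forallP => s; rewrite mnm1E eq_pq.
move=> l A; rewrite (cx_pchain _ iv zv) ?pure_U // [ponly _](_ : _ = false).
  by rewrite kdiff_deltaU; case: ifP; rewrite // ffunE mulr0.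
by apply/negbTE/negP => /ponlyP/(_ l); rewrite mnm1E eqxx.
Qed.

Section Halves.
Variables (i : nat) (v : nat * nat) (x : chain i).
Hypothesis gx : part v x.
Hypothesis dx : forall C m, pure m -> kdiff (cx x) C m = 0.

(** Constant chains whose boundaries have the same [p]-part, respectively the
    same [q]-part, as [x]. *)
Definition phalf : {ffun set2n -> k} := [ffun A : set2n => khom TP (cx x) A 0%MM].
Definition qhalf : {ffun set2n -> k} := [ffun A : set2n => khom TQ (cx x) A 0%MM].

Lemma phalfE l A : cx x A U_(p l) = kdiff (delta phalf) A U_(p l).
Proof.
rewrite -(khom_P dx) => [||].
- by apply: eq_kdiff => s _ /UsubU[_ ->]; rewrite /delta eqxx ffunE.
- by apply/forallP => s; rewrite mnm1E eq_pq.
by rewrite -mdeg_eq0 mdeg1.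
Qed.

Lemma qhalfE l A : cx x A U_(q l) = kdiff (delta qhalf) A U_(q l).
Proof.
rewrite -(khom_Q dx) => [||].
- by apply: eq_kdiff => s _ /UsubU[_ ->]; rewrite /delta eqxx ffunE.
- by apply/forallP => s; rewrite mnm1E eq_qp.
by rewrite -mdeg_eq0 mdeg1.
Qed.

Lemma half_supp T : supp_on (dset n v) [ffun A : set2n => khom T (cx x) A 0%MM].
Proof.
move=> A; rewrite ffunE; apply: contraNeq => nz.
have [|cA vE] := khom_deg hn gx _ nz; first by move=> j _; rewrite add0m pure_U.
by rewrite inE vE bideg0; case: (sdeg A) => ? ?; rewrite /add_bideg.
Qed.

End Halves.

Notation rank_is i v d := (krank (fun (c : k) (x : chain i) => c%:MP *: x)
  (fun x : chain i => part v x /\ cycle x) (fun x : chain i => boundary v x) d).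

Lemma rank_zero i v : (forall x : chain i, part v x -> cycle x -> boundary v x) -> rank_is i v 0.
Proof. by move=> H; apply: krank0 => x [gx cx]; exact: H. Qed.

Lemma boundaryB i v (x y : chain i) : boundary v x -> boundary v y -> boundary v (x - y).
Proof. by apply: tensor_boundaryB; [exact: B_partD | exact: B_partZ]. Qed.

Lemma partB i v (x y : chain i) : part v x -> part v y -> part v (x - y).
Proof. by apply: gpartB; [exact: B_partD | exact: B_partZ]. Qed.

Lemma boundary0 i v : boundary v (0 : chain i).
Proof. by exists 0 => [a|]; [left; rewrite ffunE | rewrite tensor_diffE mxact0]. Qed.

Lemma cycleP i v (x : chain i) : part v x ->
  (forall C m, pure m -> kdiff (cx x) C m = 0) ->
  (forall C, \sum_(j | j \notin C) ksign k j C * cx x (j |: C) U_(partner j) = 0) -> cycle x.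
Proof.
case: i x => [//|i] x gx d0 w0; apply: (chain_ext hn) => [A m pm|A].
  by rewrite cx_diff // d0 // cx0.
by rewrite cw_diff // w0 cw0.
Qed.

Lemma dif_part i v (x : chain i.+1) : part v x -> part v (dif x).
Proof.
apply: mxact_gpart; first exact: B_partD.
  exact: B_partZ.
by case: (koszul_resolution n k) => -[gF _] _ _ _; exact: gF.
Qed.

(** ** Coefficients of degree at least three *)
Lemma rank_no_socle i v : (i + 2 <= v.1 + v.2)%N ->
  (forall (x : chain i) A, part v x -> cw x A = 0) -> rank_is i v 0.
Proof.
move=> le w0; apply: rank_zero => x gx cyc.
have [y gy yE] := reduce_to_socle hn gx (cycle_cx hn gx cyc) le.
exists y => //; apply: (chain_ext hn) => [A m pm|A].
  by apply/eqP; rewrite -subr_eq0 -cxB // yE.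
by rewrite !w0 //; exact: dif_part.
Qed.

Lemma rank_low i v : (i + 3 <= v.1 + v.2)%N -> rank_is i v 0.
Proof.
move=> le; apply: rank_no_socle => [|x A gx]; first by lia.
by apply/eqP/negPn/negP => /(cw_mdeg hn gx); lia.
Qed.

Lemma rank_socle_axis i v : (i + 2 = v.1 + v.2)%N -> (v.1 == 0) || (v.2 == 0)%N -> rank_is i v 0.
Proof.
move=> le v0; apply: rank_no_socle => [|x A gx]; first by lia.
by apply/eqP/negPn/negP => /(cw_supp hn gx)[_ vE]; move: v0; rewrite vE.
Qed.

(** ** Coefficients of degree two: the cokernel of the Lefschetz operator *)
(** Chains with coefficients in the socle, spanned by the common value in [B] of
    all [p_i q_i], here represented by the first of them. *)
Definition schain i z : chain i :=
  [ffun a : 'I_#|kset n i| => (z (enum_val a))%:MP *: \pi_B ('X_[pq (Ordinal (ltnW hn))] : S)].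

Lemma scale_pi (f g : S) : f *: (\pi_B g) = \pi_B (f * g).
Proof. by rewrite rmorphM. Qed.

Lemma cx_schain i z A m : pure m -> cx (schain i z) A m = 0.
Proof.
move=> pm; rewrite /cx; have [Ai|Ai] := boolP (A \in kset n i); last first.
  by rewrite extend_out // bc0.
rewrite extend_in ffunE scale_pi bc_pi // mcoeffCM mcoeffX.
case: eqP => [E|_]; last by rewrite mulr0.
by have := pq_not_pure (Ordinal (ltnW hn)); rewrite E pm.
Qed.

Lemma cw_schain i z A : cw (schain i z) A = if #|A| == i then z A else 0.
Proof.
rewrite /cw; have [Ai|Ai] := boolP (A \in kset n i); last first.
  by rewrite extend_out // bw0 //; rewrite inE in Ai; rewrite (negbTE Ai).
rewrite extend_in ffunE scale_pi bw_pi // enum_rankK_in //.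
have -> : #|A| == i by rewrite inE in Ai.
rewrite /wcoef (bigD1 (Ordinal (ltnW hn))) //= mcoeffCM mcoeffX eqxx mulr1 big1 ?addr0 // => l ln.
by rewrite mcoeffCM mcoeffX; case: eqP => [/pq_inj E|_]; rewrite ?mulr0 // E eqxx in ln *.
Qed.

Lemma schain_part i a b z : supp_on (dset n (a, b)) z -> part (a.+1, b.+1) (schain i z).
Proof.
move=> zs c; rewrite ffunE; set A := enum_val c.
have [TA|TA] := boolP (A \in dset n (a, b)); last by left; rewrite zs // rmorph0 scale0r.
right; exists (1, 1)%N; last first.
  by move: TA; rewrite inE /= => /eqP ->.
rewrite -[(1, 1)%N](_ : add_bideg (0, 0) (1, 1) = _) //; apply: B_partZ; first exact: bihomogC.
by eexists; [|by []] => m; rewrite msuppX inE => /eqP ->; rewrite bideg_pq.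
Qed.

Lemma schainB i x y : schain i (x - y) = schain i x - schain i y.
Proof. by apply/ffunP => a; rewrite !ffunE rmorphB scalerBl. Qed.

Lemma schainZ i c x : schain i (fscale c x) = c%:MP *: schain i x.
Proof. by apply/ffunP => a; rewrite !ffunE rmorphM scalerA. Qed.

Lemma pchainB i x y : pchain i (x - y) = pchain i x - pchain i y.
Proof.
apply/ffunP => a; rewrite !ffunE -rmorphB -sumrB; congr (\pi_B _).
by apply: eq_bigr => l _; rewrite !ffunE mulrBr scalerBl.
Qed.

Lemma pchainZ i c x : pchain i (fscale c x) = c%:MP *: pchain i x.
Proof.
apply/ffunP => a; rewrite !ffunE scale_pi mulr_sumr; congr (\pi_B _).
by apply: eq_bigr => l _; rewrite !ffunE mul_mpolyC scalerA mulrCA.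
Qed.

Lemma binprod_le a b : (a + b < n)%N -> ('C(n, a) * 'C(n, b) <= 'C(n, a.+1) * 'C(n, b.+1))%N.
Proof.
move=> lt; rewrite -(@leq_pmul2l (a.+1 * b.+1)) ?muln_gt0 // [X in (_ <= X)%N]mulnACA.
by rewrite !mul_bin_left [X in (_ <= X)%N]mulnACA leq_mul2r; apply/orP; right; rewrite mulnC; apply: leq_mul; lia.
Qed.

Lemma binprod_ge a b : (n <= a + b + 1)%N -> ('C(n, a.+1) * 'C(n, b.+1) <= 'C(n, a) * 'C(n, b))%N.
Proof.
move=> lt; rewrite -(@leq_pmul2l (a.+1 * b.+1)) ?muln_gt0 // [X in (X <= _)%N]mulnACA.
by rewrite !mul_bin_left [X in (X <= _)%N]mulnACA leq_mul2r; apply/orP; right; rewrite mulnC; apply: leq_mul; lia.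
Qed.

Lemma krank_lef_coker a b :
  krank (@fscale k _) (supp_on (dset n (a, b)))
    (fun w => exists2 z, supp_on (dset n (a.+1, b.+1)) z & w = lef z)
    (#|dset n (a, b)| - #|dset n (a.+1, b.+1)|).
Proof.
have [lt|ge] := ltnP (a + b) n.
  have -> : (#|dset n (a, b)| - #|dset n (a.+1, b.+1)| = 0)%N.
    by apply/eqP; rewrite subn_eq0 !card_dset binprod_le.
  by apply: krank0 => w Tw; have [z Tz <-] := lef_surj hchar lt Tw; exists z.
apply: krank_fun_coker; [exact: lefB | exact: lefZ | move=> z; exact: lef_supp | move=> z].
by apply: lef_inj => //; lia.
Qed.

Lemma krank_lef_ker a b :
  krank (@fscale k _) (fun z => supp_on (dset n (a.+1, b.+1)) z /\ lef z = 0) (fun z => z = 0)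
    (#|dset n (a.+1, b.+1)| - #|dset n (a, b)|).
Proof.
have [lt|ge] := ltnP (a + b) n.
  apply: krank_fun_ker; [exact: lefB | exact: lefZ | move=> z; exact: lef_supp | move=> w Tw].
  by have [z Tz Lz] := lef_surj hchar lt Tw; exists z.
have -> : (#|dset n (a.+1, b.+1)| - #|dset n (a, b)| = 0)%N.
  by apply/eqP; rewrite subn_eq0 !card_dset binprod_ge //; lia.
by apply: krank0 => z [Tz Lz]; apply: lef_inj Tz Lz => //; lia.
Qed.

(** Cycles reduce to the socle by [reduce_to_socle].  A chain with linear
    coefficients whose boundary lies in the socle has halves [yP] and [yQ], and
    its boundary is [lef (yP - yQ)]; conversely [lef y] is the boundary of
    [pchain y]. *)
Lemma rank_coker a b : rank_is (a + b)%N (a.+1, b.+1)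
  (#|dset n (a, b)| - #|dset n (a.+1, b.+1)|).
Proof.
set v := (a.+1, b.+1).
have iv : (a + b + 2 = v.1 + v.2)%N by rewrite /=; lia.
have iv2 : ((a + b).+2 = v.1 + v.2)%N by rewrite /=; lia.
have cwE z A : supp_on (dset n (a, b)) z -> cw (schain (a + b) z) A = z A.
  move=> zs; rewrite cw_schain; case: eqP => // cA; rewrite zs //.
  by apply: contra_notN cA => /dset_deg.
apply: krank_transfer (krank_lef_coker a b).
- exact: schainB.
- exact: schainZ.
- by move=> x y; exact: supp_onB.
- by move=> c x; exact: supp_onZ.
- exact: boundaryB.
- move=> z zs; have gz := schain_part (i := a + b) zs; split=> //.
  apply: cycleP gz _ _ => [C m pm|C]; first rewrite /kdiff; rewrite big1 // => l _;
    by rewrite cx_schain ?mulr0 ?pureBU ?pure_U.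
- move=> x [gx cyc]; have [|y gy yE] := reduce_to_socle hn gx (cycle_cx hn gx cyc).
    by rewrite iv.
  pose z : {ffun set2n -> k} := [ffun A : set2n => cw (x - dif y) A].
  have zs : supp_on (dset n (a, b)) z.
    move=> A; rewrite ffunE; apply: contraNeq => nz.
    have gu : part v (x - dif y) by apply: partB => //; exact: dif_part.
    have [_ [-> ->]] := cw_supp hn gu nz.
    by rewrite inE; exact: eqxx.
  exists z => //; exists y => //; apply: (chain_ext hn) => [A m pm|A].
    by rewrite cxB // cx_schain // subr0; apply/eqP; rewrite -subr_eq0 -cxB // yE.
  by rewrite cwB // cwE // ffunE cwB // subKr.
move=> z zs; split=> [[Y gY E]|[y ys ->]].
  have dY C m : pure m -> kdiff (cx Y) C m = 0.
    by move=> pm; rewrite -cx_diff // -E cx_schain.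
  exists (phalf Y - qhalf Y).
    by apply: supp_onB; apply: half_supp.
  apply/ffunP => C; rewrite -cwE // E cw_diff // lefB.
  by rewrite (socle_component _ (phalfE dY) (qhalfE dY)) !ffunE.
exists (pchain (a + b).+1 y); first exact: pchain_part.
apply: (chain_ext hn) => [A m pm|A].
  by rewrite cx_schain // cx_diff // (kdiff_pchain _ iv2 ys).
by rewrite cwE ?(cw_dif_pchain _ iv2 ys) //; exact: lef_supp.
Qed.

(** ** Coefficients of degree one: the kernel of the Lefschetz operator *)
(** Subtracting from [x] the boundary of the constant chain [qhalf x] removes its
    [q]-part and leaves the [p]-part of the boundary of the difference [z] of
    the halves; [lef z = 0] says that the boundary of [x] has no component
    along the socle element. *)
Lemma linear_cover i v (x : chain i) : (i.+1 = v.1 + v.2)%N -> part v x -> cycle x ->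
  exists z, [/\ supp_on (dset n v) z, lef z = 0 & boundary v (x - pchain i z)].
Proof.
move=> iv gx cyc; have dx := cycle_cx hn gx cyc.
set z := phalf x - qhalf x.
have qs : supp_on (dset n v) (qhalf x) by exact: half_supp.
have zs : supp_on (dset n v) z by apply: supp_onB => //; apply: half_supp.
exists z; split=> //.
  apply/ffunP => C; have := cycle_cw hn gx cyc C.
  by rewrite (socle_component _ (phalfE dx) (qhalfE dx)) lefB !ffunE.
have [||y [gy yE _]] := @chain_realize n k hn i.+1 v (delta (qhalf x)) (fun=> 0).
- move=> A m; rewrite /delta; case: (eqVneq m 0%MM) => [-> nz|]; last by rewrite eqxx.
  have : A \in dset n v by apply: contraNT nz => At; rewrite qs.
  rewrite inE => /eqP E; rewrite -sdeg_card E iv bideg0; split=> //.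
  by case: (v).
- by move=> A; rewrite eqxx.
have cw_zero (u : chain i) A : part v u -> cw u A = 0.
  by move=> gu; apply/eqP/negPn/negP => /(cw_mdeg hn gu); lia.
exists y => //; apply: (chain_ext hn) => [A m pm|A]; last first.
  by rewrite !cw_zero //; [exact: dif_part | apply: partB => //; exact: pchain_part].
rewrite cxB // cx_diff // (cx_pchain _ iv zs) //.
rewrite (@eq_kdiff _ _ (cx y) (delta (qhalf x))); last by move=> l _ _; rewrite yE // pureBU.
have [m1|m1] := eqVneq (mdeg m) 1%N; last first.
  rewrite !kdiff_delta0 // if_same subr0; apply/eqP/negPn/negP => /(cx_mdeg hn gx pm).
  by lia.
have /mdeg1P[l /eqP mE] : mdeg m == 1%N by apply/eqP.
rewrite {}mE {m pm m1}; rewrite -[l]splitK; case: (split l) => s /=.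
  rewrite [ponly _](_ : _ = true); last by apply/forallP => t; rewrite mnm1E eq_pq.
  rewrite (phalfE dx) !kdiff_deltaU; case: ifP => _; last by rewrite subrr.
  by rewrite !ffunE mulrBr subKr.
rewrite [ponly _](_ : _ = false); first by rewrite subr0 (qhalfE dx).
by apply/negbTE/negP => /ponlyP/(_ s); rewrite mnm1E eqxx.
Qed.

(** When one exterior power is trivial, [pchain z] is either zero or the whole
    boundary of the constant chain [z]. *)
Lemma rank_axis i v : (i.+1 = v.1 + v.2)%N -> (v.1 == 0) || (v.2 == 0)%N -> rank_is i v 0.
Proof.
move=> iv v0; apply: rank_zero => x gx cyc.
have [z [zs _ bz]] := linear_cover iv gx cyc.
suff bp : boundary v (pchain i z).
  have bN : boundary v (- pchain i z) by rewrite -sub0r; apply: boundaryB => //; exact: boundary0.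
  by rewrite -[x](subrK (pchain i z)) -[X in _ + X]opprK; apply: boundaryB.
case/orP: v0 => /eqP v0.
  rewrite (_ : pchain i z = 0); first exact: boundary0.
  apply/ffunP => c; rewrite !ffunE big1 ?rmorph0 // => l lA.
  rewrite zs ?mulr0 ?scale0r // inE; apply/negP => /eqP E; move: v0; rewrite -E.
  by rewrite sdeg_setU1 // bideg_p.
have [||y [gy yE _]] := @chain_realize n k hn i.+1 v (delta z) (fun=> 0).
- move=> A m; rewrite /delta; case: (eqVneq m 0%MM) => [-> nz|]; last by rewrite eqxx.
  have : A \in dset n v by apply: contraNT nz => At; rewrite zs.
  rewrite inE => /eqP E; rewrite -sdeg_card E iv bideg0; split=> //.
  by case: (v).
- by move=> A; rewrite eqxx.
have cw_zero (u : chain i) A : part v u -> cw u A = 0.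
  by move=> gu; apply/eqP/negPn/negP => /(cw_mdeg hn gu); lia.
exists y => //; apply: (chain_ext hn) => [A m pm|A]; last first.
  by rewrite !cw_zero //; [exact: dif_part | exact: pchain_part].
rewrite cx_diff // (cx_pchain _ iv zs) //.
rewrite (@eq_kdiff _ _ (cx y) (delta z)); last by move=> l _ _; rewrite yE // pureBU.
case: ifP => // /negP mp; rewrite kdiff_delta big1 // => l lA; case: eqP => // mE.
rewrite zs ?mulr0 // inE; apply/negP => /eqP E; move: v0; rewrite -E sdeg_setU1 //.
suff -> : bideg U_(l) = (0, 1)%N by [].
move: mp; rewrite -mE -[l]splitK; case: (split l) => s /= mp; last by rewrite bideg_q.
by case: mp; apply/forallP => t; rewrite mnm1E eq_pq.
Qed.

(** By [linear_cover] every class is that of some [pchain z].  The class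
    determines [z]: a constant chain whose boundary has no [q]-part vanishes
    in a bidegree with positive second entry. *)
Lemma rank_ker a b : rank_is (a + b).+1 (a.+1, b.+1)
  (#|dset n (a.+1, b.+1)| - #|dset n (a, b)|).
Proof.
set v := (a.+1, b.+1).
have iv : ((a + b).+2 = v.1 + v.2)%N by rewrite /=; lia.
apply: krank_transfer (krank_lef_ker a b).
- exact: pchainB.
- exact: pchainZ.
- by move=> x y [xs Lx] [ys Ly]; split; [exact: supp_onB | rewrite lefB Lx Ly subrr].
- move=> c x [xs Lx]; split; first exact: supp_onZ.
  by rewrite lefZ Lx; apply/ffunP => A; rewrite !ffunE mulr0.
- exact: boundaryB.
- move=> z [zs Lz]; split; first exact: pchain_part.
  apply: (chain_ext hn) => [A m pm|A].
    by rewrite cx_diff // cx0 // (kdiff_pchain _ iv zs).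
  by rewrite cw0 // (cw_dif_pchain _ iv zs) Lz ffunE.
- move=> x [gx cyc]; have [z [zs Lz bz]] := linear_cover iv gx cyc.
  by exists z.
move=> z [zs Lz]; split=> [[Y gY E]|->]; last first.
  rewrite (_ : pchain _ 0 = 0); first exact: boundary0.
  apply/ffunP => c; rewrite !ffunE big1 ?rmorph0 // => l lA.
  by rewrite ffunE mulr0 scale0r.
have YE l A : l \notin A -> cx (pchain (a + b).+1 z) A U_(l) = ksign k l A * cx Y (l |: A) 0%MM.
  move=> lA; rewrite E cx_diff ?pure_U // -[RHS](_ : kdiff (delta [ffun C : set2n => cx Y C 0%MM]) A U_(l) = _).
    by apply: eq_kdiff => s _ /UsubU[_ ->]; rewrite /delta eqxx ffunE.
  by rewrite kdiff_deltaU lA ffunE.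
(* A constant chain vanishes on the sets that contain some [q s], because its
   boundary has no [q]-part; in this bidegree every set contains one. *)
have Yq s A : q s \in A -> cx Y A 0%MM = 0.
  move=> sA; have sB : q s \notin A :\ q s by rewrite !inE eqxx.
  have := YE (q s) (A :\ q s) sB; rewrite (setD1K sA) (cx_pchain _ iv zs) ?pure_U //.
  rewrite [ponly _](_ : _ = false); last first.
    by apply/negbTE/negP => /ponlyP/(_ s); rewrite mnm1E eqxx.
  by move/esym/eqP; rewrite mulf_eq0 signr_eq0 => /eqP.
apply/ffunP => A; rewrite [RHS]ffunE.
have [AT|/zs //] := boolP (A \in dset n v).
have [s sA] : exists s, q s \in A.
  apply/existsP; apply: contraLR AT; rewrite negb_exists => /forallP H.
  rewrite inE; apply/negP => /eqP/(congr1 snd) /=.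
  by rewrite big1 // => s _; rewrite (negbTE (H s)).
have [r rA] : exists r, p r \in A.
  apply/existsP; apply: contraLR AT; rewrite negb_exists => /forallP H.
  rewrite inE; apply/negP => /eqP/(congr1 fst) /=.
  by rewrite big1 // => r _; rewrite (negbTE (H r)).
have rB : p r \notin A :\ p r by rewrite !inE eqxx.
have := YE (p r) (A :\ p r) rB; rewrite (cx_pchain _ iv zs) ?pure_U //.
rewrite [ponly _](_ : _ = true); last by apply/forallP => t; rewrite mnm1E eq_pq.
rewrite kdiff_deltaU rB (setD1K rA) (Yq s) // mulr0 => /eqP.
by rewrite mulf_eq0 signr_eq0 => /eqP.
Qed.

(** ** Constant coefficients *)
Lemma rank_top i v : (v.1 + v.2 <= i)%N -> (0 < i)%N -> rank_is i v 0.
Proof.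
move=> vi i0; apply: rank_zero => x gx cyc.
suff -> : x = 0 by exact: boundary0.
apply: (chain_ext hn) => [A m pm|A]; last first.
  by rewrite cw0 //; apply/eqP/negPn/negP => /(cw_mdeg hn gx); lia.
rewrite cx0 //; apply/eqP/negPn/negP => nz.
have [cA _] := cx_supp hn gx pm nz.
have /eqP := cx_mdeg hn gx pm nz; have [l lA] : exists l, l \in A.
  by apply/existsP; move: i0; rewrite -cA card_gt0 => /set0Pn[l lA]; apply/existsP; exists l.
have m0 : m = 0%MM by apply/eqP; rewrite -mdeg_eq0; have := cx_mdeg hn gx pm nz; lia.
move=> _; have := cycle_cx hn gx cyc (A :\ l) (pure_U l).
rewrite (@eq_kdiff _ _ (cx x) (delta [ffun C : set2n => cx x C 0%MM])); last first.
  by move=> s _ /UsubU[_ ->]; rewrite /delta eqxx ffunE.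
rewrite kdiff_deltaU !inE eqxx /= setD1K // ffunE => /eqP.
by rewrite mulf_eq0 signr_eq0 -m0 (negbTE nz).
Qed.

Lemma rank_unit : rank_is 0%N (0, 0)%N 1.
Proof.
pose one : chain 0 := [ffun=> 1].
have cx1 A m : pure m -> cx one A m = if (A == set0) && (m == 0%MM) then 1 else 0.
  move=> pm; rewrite /cx; have [A0|A0] := boolP (A \in kset n 0); last first.
    rewrite extend_out // bc0 //; case: eqP => // E.
    by rewrite E inE cards0 in A0.
  rewrite extend_in ffunE -(rmorph1 (\pi_B)) bc_pi // mcoeff1.
  by move: A0; rewrite inE cards_eq0 => ->; case: eqP.
have gone : part (0, 0)%N one.
  move=> a; right; exists (0, 0)%N; last by rewrite /= kset0 sdeg0.
  by exists 1; [rewrite -mpolyC1; exact: bihomogC | rewrite ffunE rmorph1].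
have bd0 (x : chain 0) : boundary (0, 0)%N x -> x = 0.
  move=> [y gy ->]; rewrite (_ : y = 0) ?tensor_diffE ?mxact0 //.
  apply: (chain_ext hn) => [A m pm|A].
    by rewrite cx0 //; apply/eqP/negPn/negP => /(cx_mdeg hn gy pm); rewrite /=; lia.
  by rewrite cw0 //; apply/eqP/negPn/negP => /(cw_mdeg hn gy).
have cxZ (c : k) A m : pure m -> cx (c%:MP *: one) A m = c * cx one A m.
  move=> pm; rewrite /cx; have [A0|A0] := boolP (A \in kset n 0); last first.
    by rewrite !extend_out // bc0 // mulr0.
  rewrite !extend_in !ffunE -(rmorph1 (\pi_B)) scale_pi mulr1 !bc_pi //.
  by rewrite mcoeffC mcoeff1.
have pure0 : pure (0%MM : 'X_{1..n + n}) by apply/orP; left; apply/forallP => l; rewrite mnm0E.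
exists (fun=> one) => [_|x [gx _]]; first by split.
exists [ffun=> cx x set0 0%MM]; split=> [|c]; rewrite big_ord1 ?ffunE.
  rewrite (_ : _ - _ = 0); first exact: boundary0.
  apply: (chain_ext hn) => [A m pm|A].
    rewrite cxB // cxZ // cx1 // cx0 //; case: ifP => [/andP[/eqP -> /eqP ->]|nz].
      by rewrite mulr1 subrr.
    rewrite mulr0 subr0; apply/eqP/negPn/negP => xz; case/negP: nz.
    have [/eqP + _] := cx_supp hn gx pm xz; rewrite cards_eq0 => ->.
    by have /eqP := cx_mdeg hn gx pm xz; rewrite addn0 mdeg_eq0.
  have w0 (u : chain 0) : part (0, 0)%N u -> cw u A = 0.
    by move=> gu; apply/eqP/negPn/negP => /(cw_mdeg hn gu).
  rewrite cwB // cw0 // (w0 _ gx) w0 ?subr0 //.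
  move=> a; right; exists (0, 0)%N; last by rewrite /= kset0 sdeg0.
  rewrite !ffunE -[(0, 0)%N](_ : add_bideg (0, 0) (0, 0) = _) //.
  by apply: B_partZ; [exact: bihomogC | exists 1; [rewrite -mpolyC1; exact: bihomogC | rewrite rmorph1]].
move=> /bd0/eqP; rewrite subr_eq0 => /eqP E.
by apply/ffunP => j; rewrite ffunE ord1 E cxZ // cx1 // !eqxx mulr1.
Qed.

(** ** The graded Betti numbers *)
(** The truncated differences are both the dimension of a kernel or cokernel of
    maximal rank and the positive part of an integer difference. *)
Definition betti (i : nat) v : nat :=
  let t a b := ('C(n, a) * 'C(n, b))%N in
  if i == (v.1 + v.2)%N then nat_of_bool (i == 0)%N
  else if (0 < v.1)%N && (0 < v.2)%N then
    if i.+1 == (v.1 + v.2)%N then (t v.1 v.2 - t v.1.-1 v.2.-1)%N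
    else if i.+2 == (v.1 + v.2)%N then (t v.1.-1 v.2.-1 - t v.1 v.2)%N else 0%N
  else 0%N.

Lemma rank_betti i v : rank_is i v (betti i v).
Proof.
have [vi|vi] := leqP (v.1 + v.2) i.
  rewrite /betti; case: eqP => [iv|iv].
    case: eqP => [i0|i0]; last by apply: rank_top => //; lia.
    have -> : v = (0, 0)%N by move: iv; rewrite i0; case: (v) => [[|a] [|b]].
    by rewrite i0; exact: rank_unit.
  have -> : (i.+1 == v.1 + v.2)%N = false by lia.
  have -> : (i.+2 == v.1 + v.2)%N = false by lia.
  by rewrite if_same; apply: rank_top; lia.
rewrite /betti [i == _](_ : _ = false); last by lia.
have [/andP[]|ax] := boolP ((0 < v.1)%N && (0 < v.2)%N); last first.
  have v0 : (v.1 == 0) || (v.2 == 0)%N by lia.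
  have [i1|i1] := eqVneq i.+1 (v.1 + v.2)%N; first exact: rank_axis.
  have [i2|i2] := eqVneq i.+2 (v.1 + v.2)%N; first by apply: rank_socle_axis; rewrite ?addn2.
  by apply: rank_low; lia.
case: v vi => [[|a] [|b]] //= vi _ _.
case: eqP => [i1|i1].
  have -> : i = (a + b).+1 by lia.
  by rewrite -!card_dset; exact: rank_ker.
case: eqP => [i2|i2]; last by apply: rank_low => /=; lia.
have -> : i = (a + b)%N by lia.
by rewrite -!card_dset; exact: rank_coker.
Qed.

Lemma graded_bettiP i v : graded_betti (@B_part n k) i v (betti i v).
Proof.
split; first by exists K, (@koszul_eps n k); exact: koszul_resolution.
move=> F eps rF; apply: (quot_rank_resolution _ _ rF (koszul_resolution n k)).
- exact: B_partD.
- exact: B_partZ.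
exact: rank_betti.
Qed.

End KoszulRanks.

(** * Krull dimension and depth *)

Section AlgebraicDependence.
Variables (N : nat) (k : fieldType).
Implicit Types (f g : {mpoly k[N]}) (m : 'X_{1..N}) (T : {set 'I_N}).

Definition in_vars T m := [forall l, (0 < m l)%N ==> (l \in T)].

Lemma in_varsP T m : reflect (forall l, (0 < m l)%N -> l \in T) (in_vars T m).
Proof. by apply: (iffP forallP) => H l; apply/implyP; exact: H. Qed.

Definition degle d f := forall m, m \in msupp f -> (mdeg m <= d)%N.

Lemma degleM d e f g : degle d f -> degle e g -> degle (d + e) (f * g).
Proof.
move=> fd ge m /msuppM_le/allpairsP[[m1 m2] /= [m1f m2g ->]].
by rewrite mdegD leq_add ?fd ?ge.
Qed.

Lemma degle1 : degle 0 1.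
Proof. by move=> m; rewrite msupp1 inE => /eqP ->; rewrite mdeg0. Qed.

Lemma degleX d f e : degle d f -> degle (e * d) (f ^+ e).
Proof.
move=> fd; elim: e => [|e IH]; first by rewrite expr0; exact: degle1.
by rewrite exprS mulSn; exact: degleM.
Qed.

Lemma degle_prod (I : finType) (F : I -> {mpoly k[N]}) d :
  (forall i, degle d (F i)) -> degle (#|I| * d) (\prod_i F i).
Proof.
move=> Fd; rewrite cardE /index_enum -enumT; elim: (enum I) => [|i s IH].
  by rewrite big_nil; exact: degle1.
by rewrite big_cons /= mulSn; exact: degleM.
Qed.

(** A dimension count: the products of powers below [M] of [d+1] polynomials of degree
    at most [D] number [(M+1)^(d+1)], while the monomials of degree at most
    [(d+1) M D] in [d] variables number at most [((d+1) M D + 1)^d]. *)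
Lemma algebraic_dependence T (f : 'I_#|T|.+1 -> {mpoly k[N]}) :
  exists M (c : {ffun 'I_#|T|.+1 -> 'I_M.+1} -> k),
    (exists e, c e != 0) /\
    forall m, in_vars T m -> (\sum_e c e *: \prod_j f j ^+ e j)@_m = 0.
Proof.
set d := #|T|; pose D := (\max_j msize (f j))%N.
have fD j : degle D (f j).
  by move=> m /msize_mdeg_lt/ltnW/leq_trans; apply; apply: leq_bigmax.
(* With these values [b <= K * M.+1], hence [b ^ d <= M * M.+1 ^ d], which is
   less than the number [M.+1 ^ d.+1] of products. *)
pose K := (d.+1 * D).+1; pose M := (K ^ d)%N.
pose b := (d.+1 * (M * D)).+1.
pose E : finType := {ffun 'I_d.+1 -> 'I_M.+1}.
pose U : finType := {ffun {l : 'I_N | l \in T} -> 'I_b}.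
pose mon (u : U) : 'X_{1..N} :=
  [multinom (if insub l is Some t then u t : nat else 0%N) | l < N].
pose A := \matrix_(a < #|E|, s < #|U|)
  (\prod_j f j ^+ (enum_val a : E) j)@_(mon (enum_val s)).
have cE : #|E| = (M.+1 ^ d.+1)%N by rewrite card_ffun !card_ord.
have cU : #|U| = (b ^ d)%N by rewrite card_ffun card_ord card_sig.
have lt : (#|U| < #|E|)%N.
  rewrite cU cE expnS; apply: (@leq_ltn_trans ((K * M.+1) ^ d)).
    have leb : (b <= K * M.+1)%N by rewrite /b /K; nia.
    by case: (d) => [|d0]; rewrite ?expn0 ?leq_exp2r.
  by rewrite expnMn -/M ltn_mul2r expn_gt0 ltnSn.
have [v vA v0] : exists2 v : 'rV_#|E|, v *m A = 0 & v != 0.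
  have : kermx A != 0.
    by rewrite -mxrank_eq0 mxrank_ker -lt0n subn_gt0 (leq_ltn_trans (rank_leq_col A)).
  by case/rowV0Pn => v /sub_kermxP vA v0; exists v.
exists M, (fun e : E => v 0 (enum_rank e)); split.
  apply/existsP; apply: contraNT v0; rewrite negb_exists => /forallP H.
  by apply/eqP/rowP => a; rewrite mxE; have := H (enum_val a); rewrite negbK enum_valK => /eqP.
move=> m /in_varsP mT; have [mb|mb] := ltnP (mdeg m) b; last first.
  rewrite mcoeff_sumE big1 // => e _; rewrite mcoeffZ; apply/eqP; rewrite mulf_eq0; apply/orP; right.
  rewrite mcoeff_eq0; apply/negP => mf; move: mb; rewrite leqNgt; case/negP; rewrite ltnS.
  have := @degle_prod _ (fun j => f j ^+ (e : E) j) (M * D) _ m mf; rewrite card_ord; apply.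
  move=> j p /(degleX (fD j)) /leq_trans; apply; rewrite leq_mul2r; apply/orP; right.
  by rewrite -ltnS.
have bP l : (m l < b)%N.
  by apply: leq_ltn_trans mb; rewrite mdegE (bigD1 l) //= leq_addr.
pose u : U := [ffun t => Ordinal (bP (val t))].
have -> : m = mon u.
  apply/mnmP => l; rewrite mnmE; case: insubP => [t _ tl|lT]; first by rewrite ffunE /= tl.
  by apply/eqP; rewrite -leqn0 leqNgt; apply: contra lT; exact: mT.
have /rowP/(_ (enum_rank u)) := vA; rewrite !mxE => vAu.
rewrite mcoeff_sumE -[RHS]vAu (reindex (fun a : 'I_#|E| => enum_val a : E)) /=; last first.
  by apply: onW_bij; exact: enum_val_bij.
by apply: eq_bigr => a _; rewrite mxE mcoeffZ enum_valK enum_rankK.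
Qed.

End AlgebraicDependence.

Section PrimeChains.
Variables (R : comNzRingType) (Q : nat -> prime_idealr R) (x : nat -> R) (r : nat).
Hypothesis Qsub : forall j, (j < r)%N -> {subset (Q j : pred R) <= (Q j.+1 : pred R)}.
Hypothesis xin : forall j, (j < r)%N -> x j \in (Q j.+1 : pred R).
Hypothesis xout : forall j, (j < r)%N -> x j \notin (Q j : pred R).
Variables (I : finType) (E : I -> 'I_r -> nat) (c : I -> R).
Hypothesis Einj : forall i i', (forall l, E i l = E i' l) -> i = i'.
Hypothesis cout : forall i, c i \notin (Q r : pred R).

(** A polynomial relation between the [x j], with coefficients outside the
    ideals, cannot hold modulo [Q 0]: dividing by the least power of [x 0] and
    reducing modulo [x 0], which lies in [Q 1], leaves a shorter relation
    modulo [Q 1] between the remaining elements. *)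
Lemma no_relation (J : {set I}) : J != set0 ->
  \sum_(i in J) c i * \prod_(l : 'I_r) x l ^+ E i l \notin (Q 0%N : pred R).
Proof.
move=> J0; apply/negP => H.
have memX (P : prime_idealr R) y e : y ^+ e \in (P : pred R) -> y \in (P : pred R).
  elim: e => [|e IH]; first by rewrite expr0 idealr1.
  by rewrite exprS prime_idealrM => /orP[//|/IH].
(* After [j] steps the remaining exponents agree in the first [j] places, and
   the relation holds modulo [Q j] with these places removed. *)
have step j : (j <= r)%N -> exists J' : {set I},
    [/\ J' != set0, forall i i', i \in J' -> i' \in J' -> forall l : 'I_r, (l < j)%N -> E i l = E i' l
     & \sum_(i in J') c i * \prod_(l : 'I_r | (j <= l)%N) x l ^+ E i l \in (Q j : pred R)].
  elim: j => [|j IH] jr; first by exists J; split=> //; under eq_bigr do under eq_bigl do rewrite leq0n.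
  have [J' [/set0Pn[i0 J'i0] agree mem]] := IH (ltnW jr).
  pose o := Ordinal jr; case: (@arg_minnP _ i0 (fun i => i \in J') (fun i => E i o) J'i0) => i1 J'i1 min.
  exists [set i in J' | E i o == E i1 o]; split.
  - by apply/set0Pn; exists i1; rewrite inE J'i1 eqxx.
  - move=> i i'; rewrite !inE => /andP[J'i /eqP Ei] /andP[J'i' /eqP Ei'] l.
    rewrite ltnS leq_eqVlt => /orP[/eqP lj|]; last exact: agree.
    by have -> : l = o by [exact: val_inj]; rewrite Ei Ei'.
  have prodE i : \prod_(l : 'I_r | (j <= l)%N) x l ^+ E i l =
      x j ^+ E i o * \prod_(l : 'I_r | (j.+1 <= l)%N) x l ^+ E i l.
    rewrite (bigD1 o) //=; congr (_ * _); apply: eq_bigl => l.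
    by rewrite -val_eqE /= [RHS]ltn_neqAle andbC eq_sym.
  have memf : \sum_(i in J') c i * (x j ^+ (E i o - E i1 o) *
      \prod_(l : 'I_r | (j.+1 <= l)%N) x l ^+ E i l) \in (Q j : pred R).
    have := mem; rewrite (eq_bigr (fun i => x j ^+ E i1 o * (c i * (x j ^+ (E i o - E i1 o) *
        \prod_(l : 'I_r | (j.+1 <= l)%N) x l ^+ E i l)))).
      rewrite -mulr_sumr prime_idealrM => /orP[/memX|//].
      by rewrite (negbTE (xout jr)).
    by move=> i J'i; rewrite prodE -[in LHS](subnKC (min i J'i)) exprD !mulrA; congr (_ * _ * _); rewrite mulrC.
  have {memf} := Qsub jr memf.
  rewrite (bigID (fun i => E i o == E i1 o)) /=.
  rewrite [X in X + _ \in _](_ : _ = \sum_(i in [set i in J' | E i o == E i1 o])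
      c i * \prod_(l : 'I_r | (j.+1 <= l)%N) x l ^+ E i l); last first.
    apply: eq_big => [i|i /andP[_ /eqP ->]]; first by rewrite inE.
    by rewrite subnn expr0 mul1r.
  rewrite rpredDr // rpred_sum // => i /andP[J'i ne].
  apply/idealMr; rewrite mulrC; apply/idealMr.
  have -> : (E i o - E i1 o)%N = (E i o - E i1 o).-1.+1.
    by rewrite prednK // subn_gt0 ltn_neqAle eq_sym ne min.
  by rewrite exprSr; apply/idealMr/xin.
have [J' [/set0Pn[i0 J'i0] agree mem]] := step r (leqnn r).
have J'1 : J' = [set i0].
  apply/setP => i; rewrite inE; apply/idP/eqP => [J'i|-> //].
  by apply: Einj => l; apply: agree.
move: mem; rewrite J'1 big_set1 big_pred0 ?mulr1; last by move=> l; rewrite leqNgt ltn_ord.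
by rewrite (negbTE (cout i0)).
Qed.

End PrimeChains.

Section Dimension.
Variables (n : nat) (k : fieldType).
Hypothesis hn : (2 <= n)%N.
Notation S := {mpoly k[n + n]}.
Notation B := (B n k).
Notation p := (@lshift n n).
Notation q := (@rshift n n).
Implicit Types (f g : S) (m : 'X_{1..n + n}) (T : {set 'I_(n + n)}) (x y : B).

Definition restr T f : S := f \mPo [tuple (if i \in T then 'X_i else 0) | i < n + n].

Lemma mcoeff_restr T f m : (restr T f)@_m = if in_vars T m then f@_m else 0.
Proof.
have monoE u : restr T 'X_[u] = if in_vars T u then 'X_[u] else 0.
  rewrite /restr comp_mpolyX.
  case: (in_varsP T u) => [uT|uT].
    rewrite mpolyXE_id; apply: eq_bigr => i _; rewrite tnth_mktuple.
    case: ifPn => // iT; suff -> : u i = 0%N by rewrite !expr0.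
    by apply/eqP; rewrite -leqn0 leqNgt; apply: contra iT; exact: uT.
  have /existsP[l /andP[ul lT]] : [exists l, (0 < u l)%N && (l \notin T)].
    apply: contra_notT uT; rewrite negb_exists => /forallP H l ul.
    by have := H l; rewrite ul negbK.
  by rewrite (bigD1 l) //= tnth_mktuple (negbTE lT) expr0n eqn0Ngt ul mul0r.
have -> : restr T f = \sum_(u <- msupp f) f@_u *: restr T 'X_[u].
  rewrite {1}[f]mpolyE /restr raddf_sum; apply: eq_bigr => u _.
  by rewrite /= comp_mpolyZ.
rewrite mcoeff_sumE; under eq_bigr do rewrite monoE.
have [mf|mf] := boolP (m \in msupp f).
  rewrite (bigD1_seq m) ?msupp_uniq //= big1 => [|u /negbTE um].
    by rewrite addr0 mcoeffZ; case: ifP; rewrite ?mcoeffX ?mcoeff0 ?eqxx ?mulr1 ?mulr0.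
  by rewrite mcoeffZ; case: ifP; rewrite ?mcoeffX ?mcoeff0 ?um mulr0.
have -> : f@_m = 0 by apply/eqP; rewrite mcoeff_eq0.
rewrite if_same big1_seq // => u /andP[_ uf].
rewrite mcoeffZ; case: ifP; rewrite ?mcoeffX ?mcoeff0 ?mulr0 //.
by case: eqP => [E|_]; [rewrite -E uf in mf | rewrite mulr0].
Qed.

Lemma restrM T f g : restr T (f * g) = restr T f * restr T g.
Proof. exact: rmorphM. Qed.

Lemma restrB T f g : restr T (f - g) = restr T f - restr T g.
Proof. exact: rmorphB. Qed.

Lemma in_vars_pure T m : T \subset TP n -> in_vars T m -> pure m.
Proof.
move=> /subsetP TT /in_varsP mT; apply/orP; left; apply/ponly_TP => l ml.
exact: TT (mT l ml).
Qed.

Lemma restr_ideal T f : T \subset TP n -> f \in @B_ideal n k -> restr T f = 0.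
Proof.
move=> TT /(B_idealP hn)[f0 _]; apply/mpolyP => m; rewrite mcoeff_restr mcoeff0.
by case: ifP => // /(in_vars_pure TT)/f0.
Qed.

Lemma restr_pi T f : T \subset TP n -> restr T (repr (\pi_B f)) = restr T f.
Proof.
move=> TT; have := restr_ideal TT (quot_repr_sub (erefl (\pi_B f))).
by rewrite restrB => /eqP; rewrite subr_eq0 => /eqP ->.
Qed.

(** The kernel of the projection of [B] to the polynomial ring in those [p_i]
    that lie in [T].  Intersecting with [TP] makes it a prime ideal for every
    [T]. *)
Definition var_ideal T : pred B := fun x => restr (T :&: TP n) (repr x) == 0.

Lemma var_ideal_pi T f : (\pi_B f \in var_ideal T) = (restr (T :&: TP n) f == 0).
Proof. by rewrite unfold_in restr_pi ?subsetIr. Qed.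

Lemma var_ideal_closed T : idealr_closed (var_ideal T).
Proof.
split.
- by rewrite -(rmorph0 (\pi_B)) var_ideal_pi /restr rmorph0.
- by rewrite -(rmorph1 (\pi_B)) var_ideal_pi /restr rmorph1 oner_eq0.
move=> a x y; rewrite -[a]reprK -[x]reprK -[y]reprK -rmorphM -rmorphD !var_ideal_pi /restr.
by move=> /eqP x0 /eqP y0; rewrite rmorphD rmorphM /= x0 y0 mulr0 addr0.
Qed.

Lemma var_ideal_prime T : prime_idealr_closed (var_ideal T).
Proof.
move=> x y; rewrite -[x]reprK -[y]reprK -rmorphM !var_ideal_pi restrM.
by rewrite mulf_eq0.
Qed.

HB.instance Definition _ T := isIdealr.Build B (var_ideal T) (var_ideal_closed T).
HB.instance Definition _ T := isPrimeIdealrClosed.Build B (var_ideal T) (@var_ideal_prime T).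

(** The chain starts with the ideal of all [q_j] and adds [p_0], [p_1], and so on
    one at a time. *)
Lemma prime_chain_exists : exists P : 'I_n.+1 -> prime_idealr B, prime_chain P.
Proof.
pose T (i : nat) : {set 'I_(n + n)} := [set j : 'I_(n + n) | (i <= j)%N].
exists (fun i => var_ideal (T i) : prime_idealr B) => i j ij; split.
  move=> x; change (x \in var_ideal (T i) -> x \in var_ideal (T j)).
  move=> /eqP xi; apply/eqP/mpolyP => m.
  rewrite mcoeff_restr mcoeff0; case: ifP => // /in_varsP mj.
  have := mcoeff_restr (T i :&: TP n) (repr x) m; rewrite xi mcoeff0.
  case: (in_varsP _ m) => // -[] l /mj; rewrite !inE => /andP[jl ->].
  by rewrite andbT (leq_trans (ltnW ij)).
have lt : (i < n)%N by apply: leq_trans ij _; rewrite -ltnS.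
exists (\pi_B 'X_(p (Ordinal lt))); rewrite var_ideal_pi.
  apply/eqP/mpolyP => m; rewrite mcoeff_restr mcoeff0; case: (in_varsP _ m) => // mj.
  rewrite mcoeffX; case: eqP => // E; have := mj (p (Ordinal lt)).
  by rewrite -E mnm1E eqxx !inE /= => /(_ isT)/andP[]; rewrite leqNgt ij.
apply/eqP => /mpolyP/(_ U_(p (Ordinal lt))%MM)/eqP; rewrite mcoeff_restr mcoeff0.
case: in_varsP => [_|[]]; first by rewrite mcoeffX eqxx oner_eq0.
by move=> l; rewrite mnm1E lt0b => /eqP <-; rewrite !inE /= leqnn lt.
Qed.

(** Every prime contains all [p_i] or all [q_i], since every [p_i q_j] is
    nilpotent in [B]. *)
Lemma prime_contains (P : prime_idealr B) :
  exists T, #|T| = n /\ forall l, l \notin T -> \pi_B 'X_l \in (P : pred B).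
Proof.
have pqP i j : (\pi_B 'X_(p i) \in (P : pred B)) || (\pi_B 'X_(q j) \in (P : pred B)).
  have mem0 a b : a != b -> \pi_B 'X_(p a) * \pi_B 'X_(q b) = 0 :> B.
    by move=> ab; rewrite -rmorphM; apply/quot_eq0; exact: mem_pq.
  have [<-|ij] := eqVneq i j; last by rewrite -prime_idealrM mem0 ?idealr0.
  have [l il] := other hn i.
  have E : \pi_B 'X_(p i) * \pi_B 'X_(q i) = \pi_B 'X_(p l) * \pi_B 'X_(q l) :> B.
    apply/eqP; rewrite -subr_eq0 -!rmorphM -rmorphB; apply/eqP/quot_eq0; exact: mem_pqB.
  rewrite -prime_idealrM -[_ \in _]orbb -prime_idealrM.
  by rewrite [X in _ * X]E [X in _ * X]mulrC mulrACA mem0 // mul0r idealr0.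
have cTP : #|TP n| = n.
  rewrite -sum1_card big_mkcond big_split_ord /= [X in (_ + X)%N]big1 ?addn0 => [|i _].
    rewrite (eq_bigr (fun=> 1%N)) ?sum1_card ?card_ord // => i _.
    by rewrite TP_p.
  by rewrite (negbTE (TP_q i)).
have [/forallP H|] := boolP [forall i, \pi_B 'X_(p i) \in (P : pred B)].
  exists (~: TP n); split=> [|l]; first by have := cardsC (TP n); rewrite cTP card_ord; lia.
  rewrite inE negbK -[l]splitK; case: (split l) => i /=; first by rewrite H.
  by rewrite (negbTE (TP_q i)).
rewrite negb_forall => /existsP[i pi]; exists (TP n); split=> // l.
rewrite -[l]splitK; case: (split l) => j /=; first by rewrite TP_p.
by move=> _; have := pqP i j; rewrite (negbTE pi).
Qed.

Lemma outside_vars (P : prime_idealr B) T f :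
  (forall l, l \notin T -> \pi_B 'X_l \in (P : pred B)) ->
  (forall m, in_vars T m -> f@_m = 0) -> \pi_B f \in (P : pred B).
Proof.
move=> PT f0; rewrite [f]mpolyE rmorph_sum big_seq rpred_sum // => m mf.
have /existsP[l /andP[ml lT]] : [exists l, (0 < m l)%N && (l \notin T)].
  apply: contraT; rewrite negb_exists => /forallP H; move: mf; rewrite mcoeff_msupp f0 ?eqxx //.
  by apply/in_varsP => l ml; have := H l; rewrite ml negbK.
have -> : 'X_[m] = 'X_[m - U_(l)] * 'X_l :> S.
  rewrite -mpolyXD; congr 'X_[_]; apply/mnmP => i.
  by rewrite mnmDU mnmBU; case: eqP => [<-|]; rewrite ?subnK ?subn0 ?addn0.
by rewrite -mul_mpolyC !rmorphM /=; do 2!apply: idealMr; exact: PT.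
Qed.

(** Elements [x j] separating the steps of a longer chain would be [n+1]
    elements of a ring that is generated by [n] elements modulo [P 0], hence
    algebraically dependent modulo [P 0]: this contradicts [no_relation]. *)
Lemma prime_chain_bound e (P : 'I_e.+1 -> prime_idealr B) : prime_chain P -> (e <= n)%N.
Proof.
move=> chainP; rewrite leqNgt; apply/negP => lt.
have [T [cT PT]] := prime_contains (P ord0).
pose Q j : prime_idealr B := P (inord j).
have ltj j : (j < #|T|.+1)%N -> ((inord j : 'I_e.+1) < (inord j.+1 : 'I_e.+1))%N.
  by rewrite cT => jn; rewrite !inordK //; lia.
have /choice[x xP] : forall j, exists x, (j < #|T|.+1)%N ->
    x \in (Q j.+1 : pred B) /\ x \notin (Q j : pred B).
  move=> j; have [jn|] := ltnP j #|T|.+1; last by exists 0.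
  by have [_ [x xi xo]] := chainP _ _ (ltj j jn); exists x.
have [M [c [[e0 ce0] dep]]] := @algebraic_dependence _ _ T (fun j => repr (x j)).
pose I : finType := {ffun 'I_#|T|.+1 -> 'I_M.+1}.
(* Coefficients outside the index set of the relation are set to 1, since all
   of them have to be units. *)
refine (negP (@no_relation B Q x #|T|.+1 _ _ _ I (fun (e : I) (j : 'I_#|T|.+1) => e j : nat)
  (fun e => \pi_B ((if c e == 0 then 1 else c e)%:MP)) _ _ [set e | c e != 0] _) _).
- by move=> j jn; have [] := chainP _ _ (ltj j jn).
- by move=> j /xP[].
- by move=> j /xP[].
- by move=> i i' H; apply/ffunP => l; apply: val_inj; exact: H.
- move=> i; set a := (if _ then _ else _); have a0 : a != 0.
    by rewrite /a; case: ifP => [_|/negbT //]; exact: oner_neq0.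
  apply/negP => mem; have := idealr1 (Q #|T|.+1).
  have := idealMr (\pi_B (a^-1)%:MP) mem.
  by rewrite -rmorphM -rmorphM /= mulVf // !rmorph1 => ->.
- by apply/set0Pn; exists e0; rewrite inE.
have -> : Q 0%N = P ord0 by congr P; apply: val_inj; rewrite /= inordK.
have -> : \sum_(i in [set e | c e != 0]) \pi_B ((if c i == 0 then 1 else c i)%:MP) *
      \prod_(l < #|T|.+1) x l ^+ (i : I) l =
    \pi_B (\sum_(i : I) c i *: \prod_(j : 'I_#|T|.+1) repr (x j) ^+ i j).
  rewrite rmorph_sum [RHS](bigID (fun i => c i != 0)) /= [X in _ + X]big1 ?addr0 => [|i].
    apply: eq_big => [i|i]; rewrite inE // => /negbTE ->.
    rewrite -mul_mpolyC rmorphM rmorph_prod; congr (_ * _); apply: eq_bigr => l _.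
    by rewrite rmorphXn /= reprK.
  by rewrite negbK => /eqP ->; rewrite scale0r rmorph0.
exact: outside_vars PT dep.
Qed.

Lemma krull_dim_B : krull_dim B n.
Proof. by split; [exact: prime_chain_exists | exact: prime_chain_bound]. Qed.

(** The nonzero element [p_i q_i] is killed by the maximal ideal, so no element
    of that ideal is regular on [B]. *)
Lemma depth_B : depth_is (@max_ideal n k) B 0.
Proof.
have nil0 x : in_seq_mul [::] x -> x = 0 by case=> y ->; rewrite big_ord0.
split.
  exists [::]; split=> //; split=> //; exists 1 => /nil0/eqP.
  by rewrite oner_eq0.
case=> [//|s0 s] sI [reg _]; have s0I : s0 \in @max_ideal n k by apply: sI; rewrite inE eqxx.
pose i0 := Ordinal (ltnW hn).
pose w : B := \pi_B ('X_(p i0) * 'X_(q i0)).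
have s0w : in_seq_mul (take 0 (s0 :: s)) (s0 *: w).
  exists (fun=> 0); rewrite big1 => [|i _]; last by rewrite scaler0.
  rewrite /= scale_pi; apply/quot_eq0/(B_idealP hn).
  rewrite mulrC -mulrA; split=> [m pm|]; first exact: mcoeff_pqmul_pure.
  by rewrite wcoef_pqmul // eqxx; apply/max_idealP.
have /(congr1 (@bw n k)) := nil0 _ (reg 0%N isT w s0w).
rewrite bw_pi // bw0 // -['X_(q i0)]mulr1 wcoef_pqmul // eqxx mcoeff1 eqxx => /eqP.
by rewrite oner_eq0.
Qed.

End Dimension.

(** * Generating functions *)

Section TrigradedSeries.
Variable n : nat.
Notation Z3 := {mpoly int[3]}.
Implicit Types (h : Z3) (m : 'X_{1..3}).

Notation i0 := (inord 0 : 'I_3).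
Notation i1 := (inord 1 : 'I_3).
Notation i2 := (inord 2 : 'I_3).

Definition mon (a b c : nat) : 'X_{1..3} := [multinom [tuple a; b; c]].

Lemma monE a b c : (mon a b c i0 = a) * (mon a b c i1 = b) * (mon a b c i2 = c).
Proof. by rewrite /mon /= !multinomE !(tnth_nth 0%N) /= !inordK. Qed.

Lemma ord3 (l : 'I_3) : [\/ l = i0, l = i1 | l = i2].
Proof.
by case: l => [[|[|[|//]]] lt]; [apply: Or31|apply: Or32|apply: Or33]; apply: val_inj; rewrite /= inordK.
Qed.

Lemma mon_eta m : mon (m i0) (m i1) (m i2) = m.
Proof. by apply/mnmP => l; case: (ord3 l) => ->; rewrite monE. Qed.

Lemma eq_mon a b c a' b' c' : (mon a b c == mon a' b' c') = [&& a == a', b == b' & c == c'].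
Proof.
apply/eqP/and3P => [E|[/eqP -> /eqP -> /eqP ->] //].
have H l : mon a b c l = mon a' b' c' l by rewrite E.
by split; [have := H i0 | have := H i1 | have := H i2]; rewrite !monE => ->.
Qed.

Lemma monD a b c a' b' c' : (mon a b c + mon a' b' c')%MM = mon (a + a') (b + b') (c + c').
Proof. by apply/mnmP => l; rewrite mnmDE; case: (ord3 l) => ->; rewrite !monE. Qed.

Lemma XU3 : (U_(i0)%MM = mon 1 0 0) * (U_(i1)%MM = mon 0 1 0) * (U_(i2)%MM = mon 0 0 1).
Proof.
by do !split; apply/mnmP => l; case: (ord3 l) => ->; rewrite monE mnm1E -val_eqE /= !inordK.
Qed.

Lemma mcoeff_monmul a b c h a' b' c' :
  ('X_[mon a b c] * h)@_(mon a' b' c') =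
  if [&& a <= a', b <= b' & c <= c']%N then h@_(mon (a' - a) (b' - b) (c' - c)) else 0.
Proof.
case: ifP => [/and3P[la lb lc]|H].
  have -> : mon a' b' c' = (mon a b c + mon (a' - a) (b' - b) (c' - c))%MM.
    by rewrite monD !subnKC.
  by rewrite mulrC mcoeffMX.
apply/eqP; rewrite mulrC mcoeff_eq0 (perm_mem (msuppMX h _)); apply/negP => /mapP[m _].
rewrite -[m]mon_eta monD => /eqP; rewrite eq_mon => /and3P[/eqP Ea /eqP Eb /eqP Ec].
by move: H; rewrite Ea Eb Ec !leq_addr.
Qed.

Definition diag (c : nat -> nat -> int) : Z3 :=
  \sum_(a < n.+1) \sum_(b < n.+1) c a b *: 'X_[mon a b (a + b)].

Lemma mcoeff_diag c a b e : (diag c)@_(mon a b e) =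
  if [&& e == a + b, a <= n & b <= n]%N then c a b else 0.
Proof.
rewrite /diag mcoeff_sumE; under eq_bigr do rewrite mcoeff_sumE.
under eq_bigr do under eq_bigr do rewrite mcoeffZ mcoeffX eq_mon.
case: ifP => [/and3P[/eqP -> la lb]|H].
  have lta : (a < n.+1)%N by []. have ltb : (b < n.+1)%N by [].
  rewrite (bigD1 (Ordinal lta)) //= (bigD1 (Ordinal ltb)) //= !eqxx mulr1.
  rewrite [X in _ + X]big1 ?addr0 => [|i]; last first.
    by rewrite -val_eqE /= => /negbTE ia; rewrite big1 // => j _; rewrite ia mulr0.
  by rewrite big1 ?addr0 // => j; rewrite -val_eqE /= => /negbTE ->; rewrite mulr0.
rewrite big1 // => i _; rewrite big1 // => j _.
case: and3P => [[/eqP ia /eqP jb /eqP e0]|_]; last by rewrite mulr0.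
by move: H; rewrite -ia -jb -e0 eqxx -ltnS ltn_ord -ltnS ltn_ord.
Qed.

Lemma binom_series (x : Z3) : (1 + x) ^+ n = \sum_(a < n.+1) 'C(n, a)%:Z *: x ^+ a.
Proof.
rewrite exprDn; apply: eq_bigr => a _.
by rewrite expr1n mul1r -[_ *+ _]scaler_nat; congr (_ *: _); rewrite natz.
Qed.

Notation s := svar.
Notation t := tvar.
Notation u := uvar.

Lemma suE a : (s * u) ^+ a = 'X_[mon a 0 a].
Proof.
rewrite /svar /uvar !XU3 -mpolyXD monD mpolyXn; congr 'X_[_].
by apply/mnmP => l; rewrite mulmnE; case: (ord3 l) => ->; rewrite !monE ?mul0n ?mul1n.
Qed.

Lemma tuE a : (t * u) ^+ a = 'X_[mon 0 a a].
Proof.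
rewrite /tvar /uvar !XU3 -mpolyXD monD mpolyXn; congr 'X_[_].
by apply/mnmP => l; rewrite mulmnE; case: (ord3 l) => ->; rewrite !monE ?mul0n ?mul1n.
Qed.

Lemma stuE : s * t * u ^+ 2 = 'X_[mon 1 1 2].
Proof. by rewrite /svar /tvar /uvar !XU3 expr2 -!mpolyXD !monD. Qed.

Lemma uE : u = 'X_[mon 0 0 1].
Proof. by rewrite /uvar XU3. Qed.

Lemma mcoeff_su a b c : ((1 + s * u) ^+ n)@_(mon a b c) =
  if (b == 0)%N && (c == a) then 'C(n, a)%:Z else 0.
Proof.
rewrite binom_series mcoeff_sumE; under eq_bigr do rewrite mcoeffZ suE mcoeffX eq_mon.
have [lt|ge] := ltnP a n.+1.
  rewrite (bigD1 (Ordinal lt)) //= eqxx big1 ?addr0 => [|i].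
    by rewrite [0%N == _]eq_sym [a == c]eq_sym /=; case: ifP; rewrite ?mulr1 ?mulr0.
  by rewrite -val_eqE /= => /negbTE ->; rewrite mulr0.
rewrite bin_small // if_same big1 // => i _; have := ltn_ord i; case: eqP => [->|_]; last by rewrite mulr0.
by rewrite ltnNge ge.
Qed.

Lemma mcoeff_tu a b c : ((1 + t * u) ^+ n)@_(mon a b c) =
  if (a == 0)%N && (c == b) then 'C(n, b)%:Z else 0.
Proof.
rewrite binom_series mcoeff_sumE; under eq_bigr do rewrite mcoeffZ tuE mcoeffX eq_mon.
have [lt|ge] := ltnP b n.+1.
  rewrite (bigD1 (Ordinal lt)) //= eqxx big1 ?addr0 => [|i].
    by rewrite [0%N == _]eq_sym [b == c]eq_sym; case: ifP; rewrite ?mulr1 ?mulr0.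
  by rewrite -val_eqE /= => /negbTE ->; rewrite andbF mulr0.
rewrite bin_small // if_same big1 // => i _; have := ltn_ord i; case: (eqVneq (i : nat) b) => [->|_].
  by rewrite ltnNge ge.
by rewrite andbF mulr0.
Qed.

Lemma mcoeff_stu a b c : ((1 + s * u) ^+ n * (1 + t * u) ^+ n)@_(mon a b c) =
  if (c == a + b)%N then ('C(n, a) * 'C(n, b))%:Z else 0.
Proof.
have -> : (1 + s * u) ^+ n * (1 + t * u) ^+ n = diag (fun a b => ('C(n, a) * 'C(n, b))%:Z).
  rewrite !binom_series big_distrlr /=; apply: eq_bigr => i _; apply: eq_bigr => j _.
  by rewrite suE tuE -scalerAl -scalerAr scalerA -mpolyXD monD addn0 add0n PoszM.
rewrite mcoeff_diag; case: eqP => //= _; case: ifP => // /negbT; rewrite negb_and -!ltnNge.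
by case/orP => lt; rewrite [X in X%:Z](_ : _ = 0)%N // (bin_small lt) ?muln0.
Qed.

Lemma mcoeff_pos (r : nat) (h : {mpoly int[r]}) (m : 'X_{1..r}) :
  (mpos_part h)@_m = if 0 < h@_m then h@_m else 0.
Proof.
rewrite /mpos_part mcoeff_sumE big_mkcond; have [mf|mf] := boolP (m \in msupp h).
  rewrite (bigD1_seq m) ?msupp_uniq //= big1 => [|p /negbTE pm].
    by rewrite addr0 mcoeffZ mcoeffX eqxx mulr1.
  by rewrite mcoeffZ mcoeffX pm mulr0 if_same.
have -> : h@_m = 0 by apply/eqP; rewrite mcoeff_eq0.
rewrite ltxx big1_seq // => p /andP[_ pf]; rewrite mcoeffZ mcoeffX.
by case: (eqVneq p m) => [E|_]; rewrite ?mulr0 ?if_same //; rewrite E (negbTE mf) in pf.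
Qed.

Lemma posZ (x y : nat) : (if 0 < x%:Z - y%:Z then x%:Z - y%:Z else 0) = (x - y)%N%:Z.
Proof. by case: ifP => H; lia. Qed.

Notation low a b := ((if (0 < a) && (0 < b) then 'C(n, a.-1) * 'C(n, b.-1) else 0)%N).

Lemma mcoeff_lef a b c :
  (s * t * u ^+ 2 * ((1 + s * u) ^+ n * (1 + t * u) ^+ n))@_(mon a b c) =
  if (c == a + b)%N then (low a b)%:Z else 0.
Proof.
rewrite stuE mcoeff_monmul mcoeff_stu !subn1.
have [/andP[a0 b0]|ab] := boolP ((0 < a)%N && (0 < b)%N); last first.
  by rewrite if_same; case: ifP => // /and3P[a0 b0]; rewrite a0 b0 in ab.
rewrite a0 b0 /=; case: (c =P (a + b)%N) => [->|ne]; last by case: ifP => // ?; case: eqP => // ?; lia.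
have -> : (1 < a + b)%N by lia.
by have -> : (a + b - 2 == a.-1 + b.-1)%N by lia.
Qed.

Lemma mcoeff_pos_ker a b c :
  (mpos_part ((1 - s * t * u ^+ 2) * (1 + s * u) ^+ n * (1 + t * u) ^+ n))@_(mon a b c) =
  if (c == a + b)%N then ('C(n, a) * 'C(n, b) - low a b)%N%:Z else 0.
Proof.
rewrite -mulrA mulrBl mul1r mcoeff_pos mcoeffB mcoeff_stu mcoeff_lef.
by case: (c == (a + b)%N); rewrite ?subrr ?ltxx ?posZ.
Qed.

Lemma mcoeff_pos_coker a b c :
  (mpos_part ((s * t * u ^+ 2 - 1) * (1 + s * u) ^+ n * (1 + t * u) ^+ n))@_(mon a b c) =
  if (c == a + b)%N then (low a b - 'C(n, a) * 'C(n, b))%N%:Z else 0.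
Proof.
rewrite -mulrA mulrBl mul1r mcoeff_pos mcoeffB mcoeff_stu mcoeff_lef.
by case: (c == (a + b)%N); rewrite ?subrr ?ltxx ?posZ.
Qed.

(** Multiplication by [u ^ 2] clears the denominators.  The
    brackets consist of monomials in which the exponent of [u] is the total
    degree in [s] and [t]; divided by [u] and [u ^ 2], they give the rows
    [i = a + b - 1] and [i = a + b - 2] of [betti], and the two subtracted
    binomial powers cancel the first bracket on the axes. *)
Lemma series_coeff (P : Z3) :
    (forall i v1 v2, P@_(mon v1 v2 i) = (betti n i (v1, v2))%:Z) ->
  P * u ^+ 2 = u ^+ 2 + u * (1 - (1 + s * u) ^+ n - (1 + t * u) ^+ n
      + mpos_part ((1 - s * t * u ^+ 2) * (1 + s * u) ^+ n * (1 + t * u) ^+ n))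
    + mpos_part ((s * t * u ^+ 2 - 1) * (1 + s * u) ^+ n * (1 + t * u) ^+ n).
Proof.
move=> PE; apply/mpolyP => m; rewrite -[m]mon_eta.
move: (m i0) (m i1) (m i2) => a b c.
have u2E : u ^+ 2 = 'X_[mon 0 0 2] by rewrite uE expr2 -mpolyXD monD.
have L : (P * u ^+ 2)@_(mon a b c) = if (1 < c)%N then (betti n (c - 2) (a, b))%:Z else 0.
  by rewrite mulrC u2E mcoeff_monmul PE !subn0.
have R1 : (u ^+ 2 : Z3)@_(mon a b c) = if [&& a == 0, b == 0 & c == 2]%N then 1 else 0.
  rewrite u2E mcoeffX eq_mon [0%N == a]eq_sym [0%N == b]eq_sym [2 == c]eq_sym.
  by case: ifP.
have R2 h : (u * h)@_(mon a b c) = if (0 < c)%N then h@_(mon a b (c - 1)) else 0.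
  by rewrite uE mcoeff_monmul !subn0.
have m1E c' : (1 : Z3)@_(mon a b c') = if [&& a == 0, b == 0 & c' == 0]%N then 1 else 0.
  rewrite mcoeff1 -[0%MM](_ : mon 0 0 0 = _) ?eq_mon; first by case: ifP.
  by apply/mnmP => l; rewrite mnm0E; case: (ord3 l) => ->; rewrite monE.
rewrite L !mcoeffD R1 R2 mcoeff_pos_coker !(mcoeffD, mcoeffN) mcoeff_pos_ker m1E mcoeff_su mcoeff_tu.
rewrite /betti /=.
case: a b {L R1 R2 m1E} => [|a] [|b] /=; rewrite ?bin0 ?mul1n ?muln1 ?subnn ?sub0n;
  try (move: ('C(n, a.+1) * 'C(n, b.+1))%N ('C(n, a) * 'C(n, b))%N => X Y);
  try move: 'C(n, b.+1) => X; try move: 'C(n, a.+1) => X;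
  case: c => [|[|c]] //=; rewrite ?subn1 ?subn2 /=;
  do ?[case: eqP => ?]; lia.
Qed.

End TrigradedSeries.

Section TrigradedPoincare.
Variables (n : nat) (k : fieldType).
Hypothesis hn : (2 <= n)%N.
Hypothesis hchar : forall p : nat, p \in [pchar k] -> (n + 1 < 2 * p)%N.

Lemma betti_bound i v : (n.+1 < v.1)%N || (n.+1 < v.2)%N || (v.1 + v.2 < i)%N -> betti n i v = 0%N.
Proof.
rewrite /betti; case: eqP => [->|_]; first by case: eqP => // v0; lia.
case: ifP => // /andP[v1 v2] big.
have [lt|ge] := ltnP (v.1 + v.2) i.
  by case: eqP => [|_]; [lia|case: eqP => //; lia].
have {ge} big : (n < v.1.-1)%N || (n < v.2.-1)%N by lia.
have z : ('C(n, v.1.-1) * 'C(n, v.2.-1) = 0)%N.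
  by case/orP: big => lt; rewrite (bin_small lt) ?muln0.
have z' : ('C(n, v.1) * 'C(n, v.2) = 0)%N.
  case/orP: big => lt; [rewrite (@bin_small n v.1)|rewrite (@bin_small n v.2)]; rewrite ?muln0 //; lia.
by rewrite z z' !if_same.
Qed.

Lemma trigraded_poincare_B : exists2 P : {mpoly int[3]}, trigraded_poincare (@B_part n k) P &
  P * uvar ^+ 2 = uvar ^+ 2 + uvar * (1 - (1 + svar * uvar) ^+ n - (1 + tvar * uvar) ^+ n
      + mpos_part ((1 - svar * tvar * uvar ^+ 2) * (1 + svar * uvar) ^+ n * (1 + tvar * uvar) ^+ n))
    + mpos_part ((svar * tvar * uvar ^+ 2 - 1) * (1 + svar * uvar) ^+ n * (1 + tvar * uvar) ^+ n).
Proof.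
have [|P PE] := @mpoly_of_coef 3 int
  (fun m => (betti n (m (inord 2)) (m (inord 0), m (inord 1)))%:Z) (4 * n.+2).
  move=> m; rewrite -[m]mon_eta mdegE => big; rewrite !monE betti_bound //=.
  move: big; rewrite !big_ord_recl big_ord0.
  have -> : lift ord0 (lift ord0 (ord0 : 'I_1)) = inord 2 by apply: val_inj; rewrite /= inordK.
  have -> : lift ord0 (ord0 : 'I_2) = inord 1 by apply: val_inj; rewrite /= inordK.
  have -> : (ord0 : 'I_3) = inord 0 by apply: val_inj; rewrite /= inordK.
  by rewrite !monE; lia.
have PE' i v1 v2 : P@_(mon v1 v2 i) = (betti n i (v1, v2))%:Z by rewrite PE !monE.
exists P; last exact: series_coeff.
by move=> i v1 v2; exists (betti n i (v1, v2)); [exact: graded_bettiP | exact: PE'].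
Qed.

End TrigradedPoincare.

(** * Total Betti numbers *)

Section TotalBetti.
Variable n : nat.
Notation t a b := ('C(n, a) * 'C(n, b))%N.

Lemma sum_antidiag (d m : nat) (F : nat -> nat -> nat) : (m < d)%N ->
  (\sum_(a < d) \sum_(b < d) (if a + b == m then F a b else 0) = \sum_(a < m.+1) F a (m - a))%N.
Proof.
move=> md; rewrite (big_ord_widen d (fun a => F a (m - a)%N)) // [RHS]big_mkcond.
apply: eq_bigr => a _; rewrite ltnS; case: leqP => am; last first.
  by rewrite big1 // => b _; case: eqP => // E; lia.
have lt : (m - a < d)%N by lia.
rewrite (bigD1 (Ordinal lt)) //= subnKC // eqxx big1 ?addn0 // => b.
by rewrite -val_eqE /= => ne; case: eqP => // E; lia.
Qed.

Lemma antidiag_bin d m : (m < d)%N ->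
  (\sum_(a < d) \sum_(b < d) (if a + b == m then t a b else 0) = 'C(2 * n, m))%N.
Proof.
by move=> md; rewrite (@sum_antidiag _ _ (fun a b => t a b)) // mul2n -addnn -binomial.Vandermonde.
Qed.

Lemma sum_shift d (F : nat -> nat -> nat) :
  (\sum_(a < d.+1) \sum_(b < d.+1) F a b =
   F 0 0 + \sum_(b < d) F 0 b.+1 + \sum_(a < d) F a.+1 0
   + \sum_(a < d) \sum_(b < d) F a.+1 b.+1)%N.
Proof.
rewrite big_ord_recl big_ord_recl /= -!addnA; congr (_ + (_ + _))%N.
by rewrite -big_split; apply: eq_bigr => a _; rewrite big_ord_recl.
Qed.

Lemma sum_delta d m (F : nat -> nat) : (m < d)%N ->
  (\sum_(a < d) (if a.+1 == m.+1 then F a.+1 else 0) = F m.+1)%N.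
Proof.
move=> md; rewrite (bigD1 (Ordinal md)) //= eqxx big1 ?addn0 // => a.
by rewrite -val_eqE eqSS /= => /negbTE ->.
Qed.

(** Vandermonde's identity with the terms on the axes removed. *)
Lemma antidiag_bin_inner d m : (m.+1 < d)%N ->
  (\sum_(a < d) \sum_(b < d) (if a + b == m then t a.+1 b.+1 else 0) + 2 * 'C(n, m.+2)
   = 'C(2 * n, m.+2))%N.
Proof.
move=> md; rewrite -(@antidiag_bin d.+1 m.+2) ?ltnS //.
rewrite (sum_shift d (fun a b => if a + b == m.+2 then t a b else 0)%N) /=.
under [X in (_ = 0 + X + _ + _)%N]eq_bigr do rewrite add0n bin0 mul1n.
rewrite (sum_delta (fun b => 'C(n, b)) md).
under [X in (_ = 0 + _ + X + _)%N]eq_bigr do rewrite addn0 bin0 muln1.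
rewrite (sum_delta (fun b => 'C(n, b)) md) add0n addnn -mul2n addnC; congr addn.
by apply: eq_bigr => a _; apply: eq_bigr => b _; rewrite addSn addnS !eqSS.
Qed.

(** The range exceeds every degree in which a Betti number is nonzero, also
    after the shift by one in [total_inner]. *)
Definition total (i : nat) : nat :=
  (\sum_(v1 < (n + i).+4) \sum_(v2 < (n + i).+4) betti n i (v1 : nat, v2 : nat))%N.

Lemma total_inner i : (2 <= n)%N ->
  total i = ((i == 0) + \sum_(a < (n + i).+3) \sum_(b < (n + i).+3) betti n i (a.+1, b.+1))%N.
Proof.
move=> hn; rewrite /total (sum_shift _ (fun a b => betti n i (a, b))).
have -> : betti n i (0, 0)%N = (i == 0) by rewrite /betti /=; case: eqP.
rewrite [X in (_ + X + _ + _)%N]big1 ?addn0 => [|b _]; last first.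
  by rewrite /betti /=; case: eqP => // ->.
by rewrite [X in (_ + X + _)%N]big1 ?addn0 // => b _; rewrite /betti /=; case: eqP => // ->.
Qed.

Lemma total_low i : (2 <= n)%N -> (i < n)%N ->
  (total i + (if (0 < i)%N then 'C(2 * n, i.-1) else 0) + 2 * 'C(n, i.+1) = (i == 0) + 'C(2 * n, i.+1))%N.
Proof.
move=> hn lt; rewrite total_inner //.
have bE a b : betti n i (a.+1, b.+1) =
    (if i == (a + b).+1 then t a.+1 b.+1 - t a b else 0)%N.
  rewrite /betti /= addSn addnS; case: eqP => [->|_].
    by rewrite (negbTE (_ : (a + b).+2 != (a + b).+1)) // neq_ltn ltnSn orbT.
  rewrite !eqSS; case: eqP => // _; case: eqP => // E.
  by apply/eqP; rewrite subn_eq0 binprod_le // -E.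
case: i lt bE => [|i] lt bE.
  rewrite /= big1 => [|a _]; last by rewrite big1.
  by rewrite !addn0 !bin1; lia.
rewrite [i.+1.-1]/= [(i.+1 == 0)%N]/= !add0n -(@antidiag_bin_inner (n + i.+1).+3 i); last by lia.
rewrite -(@antidiag_bin (n + i.+1).+3 i); last by lia.
congr addn; rewrite -big_split; apply: eq_bigr => a _ /=.
rewrite -big_split; apply: eq_bigr => b _ /=; rewrite bE eqSS eq_sym.
by case: eqP => // E; rewrite subnK // binprod_le //; lia.
Qed.

Lemma total_high i : (2 <= n)%N -> (n <= i)%N -> (total i + 'C(2 * n, i.+2) = 'C(2 * n, i))%N.
Proof.
move=> hn ge; rewrite total_inner // [(i == 0)%N](_ : _ = false); last by lia.
have bE a b : betti n i (a.+1, b.+1) =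
    (if a + b == i then t a b - t a.+1 b.+1 else 0)%N.
  rewrite /betti /= addSn addnS; case: eqP => [->|_].
    by rewrite [(a + b == _)%N](_ : _ = false) //; lia.
  rewrite !eqSS; case: (i =P (a + b).+1) => [E|_]; last by rewrite eq_sym.
  rewrite [(a + b == i)%N](_ : _ = false); last by lia.
  by apply/eqP; rewrite subn_eq0 binprod_ge //; lia.
have z : 'C(n, i.+2) = 0%N by rewrite bin_small //; lia.
rewrite add0n -(@antidiag_bin_inner (n + i).+3 i); last by lia.
rewrite z muln0 addn0 -(@antidiag_bin (n + i).+3 i); last by lia.
rewrite -big_split; apply: eq_bigr => a _ /=.
rewrite -big_split; apply: eq_bigr => b _ /=; rewrite bE.
by case: eqP => // E; rewrite subnK // binprod_ge //; lia.
Qed.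

Lemma bin2n_step i :
  (i.+1 * i.+2 * 'C(2 * n, i.+2) = ((2 * n - i.+1) * (2 * n - i)) * 'C(2 * n, i))%N.
Proof. by rewrite -mulnA mul_bin_left mulnCA mul_bin_left mulnA. Qed.

Lemma bin2n_le i : (i < n)%N -> ('C(2 * n, i) <= 'C(2 * n, i.+2))%N.
Proof.
move=> lt; rewrite -(@leq_pmul2l (i.+1 * i.+2)) ?muln_gt0 // bin2n_step.
by apply: leq_mul => //; apply: leq_mul; lia.
Qed.

Lemma bin2n_ge i : (n <= i.+1)%N -> ('C(2 * n, i.+2) <= 'C(2 * n, i))%N.
Proof.
move=> lt; rewrite -(@leq_pmul2l (i.+1 * i.+2)) ?muln_gt0 // bin2n_step.
by apply: leq_mul => //; apply: leq_mul; lia.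
Qed.

Lemma total_bound i : (2 <= n)%N -> (2 * n < i)%N -> total i = 0%N.
Proof.
move=> hn big; have := @total_high i hn; rewrite (@bin_small _ i) //.
by move=> H; have := H (ltac:(lia)); lia.
Qed.

Lemma coef_pos (h : {poly int}) i : (pos_part h)`_i = if 0 < h`_i then h`_i else 0.
Proof.
rewrite coef_poly; case: ltnP => // le; rewrite nth_default // ltxx.
Qed.

Lemma coef_binom N i : ((1 + 'X : {poly int}) ^+ N)`_i = 'C(N, i)%:Z.
Proof.
rewrite exprDn coef_sum; under eq_bigr do rewrite expr1n mul1r coefMn coefXn.
have [lt|ge] := ltnP i N.+1.
  rewrite (bigD1 (Ordinal lt)) //= eqxx big1 ?addr0 => [|j]; first by rewrite natz.
  by rewrite -val_eqE /= eq_sym => /negbTE ->; rewrite mul0rn.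
rewrite bin_small // big1 // => j _; case: eqP => [E|_]; last by rewrite mul0rn.
by have := ltn_ord j; rewrite -E ltnNge ge.
Qed.

Lemma total_series (P : {poly int}) : (2 <= n)%N -> (forall i, P`_i = (total i)%:Z) ->
  P * 'X ^+ 2 = 'X ^+ 2 - 2 * 'X * ((1 + 'X) ^+ n - 1)
    + 'X * pos_part ((1 - 'X ^+ 2) * (1 + 'X) ^+ (2 * n) - 1)
    + pos_part (('X ^+ 2 - 1) * (1 + 'X) ^+ (2 * n)).
Proof.
move=> hn PE; apply/polyP => j.
have pos (x : int) : (if 0 < x then x else 0) = Num.max x 0 by case: ltP; lia.
have D m : ((1 - 'X ^+ 2) * (1 + 'X : {poly int}) ^+ (2 * n))`_m =
    'C(2 * n, m)%:Z - (if (m < 2)%N then 0 else 'C(2 * n, m - 2)%:Z).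
  by rewrite mulrBl mul1r coefB ['X ^+ 2 * _]mulrC coefMXn !coef_binom.
have D' m : (('X ^+ 2 - 1) * (1 + 'X : {poly int}) ^+ (2 * n))`_m =
    (if (m < 2)%N then 0 else 'C(2 * n, m - 2)%:Z) - 'C(2 * n, m)%:Z.
  by rewrite mulrBl mul1r coefB ['X ^+ 2 * _]mulrC coefMXn !coef_binom.
rewrite coefMXn !coefD coefN coefXn coef_pos D' -mulrA.
rewrite (mulrDl 1 1) !mul1r coefD !coefXM coefB coef_binom coef1 coef_pos coefB D coef1 !pos.
case: j => [|[|i]] //=.
- by rewrite bin0.
- by rewrite !bin0 !bin1; lia.
rewrite PE !subSS !subn0 /=.
have [lt|ge] := ltnP i n.
  have := total_low hn lt; have := bin2n_le lt.
  case: i lt => [|i] lt /=; first by rewrite !bin0 !bin1; lia.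
  have := @bin2n_le i (ltnW lt).
  by rewrite ?subn1 /=; lia.
have := total_high hn ge; have := @bin2n_ge i (leqW ge).
case: i ge => [|i] ge; first by lia.
have z : 'C(n, i.+2) = 0%N by rewrite bin_small.
by have := @bin2n_ge i ge; rewrite /= z subn1 /=; lia.
Qed.

End TotalBetti.

Lemma total_bettiP n (k : fieldType) : (2 <= n)%N ->
  (forall p : nat, p \in [pchar k] -> (n + 1 < 2 * p)%N) ->
  forall i, total_betti (@B_part n k) i (total n i).
Proof.
move=> hn hchar i; exists (betti n i); split; first by move=> v; exact: graded_bettiP.
exists (n + i).+4 => // v dv; apply: betti_bound; move: dv; lia.
Qed.

Lemma tofrac_laurent (R : idomainType) (P U A C : R) : U != 0 ->
  P * U ^+ 2 = U ^+ 2 + U * A + C ->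
  tofrac P = 1 + (tofrac U)^-1 * tofrac A + (tofrac U) ^- 2 * tofrac C.
Proof.
move=> U0 E; have u0 : tofrac U != 0 by rewrite tofrac_eq0.
apply: (mulIf (expf_neq0 2 u0)); rewrite -tofracXn -tofracM E !tofracD tofracXn tofracM.
rewrite [RHS]mulrDl [X in _ = X + _]mulrDl mul1r [X in _ = _ + X]mulrAC.
rewrite mulVf ?expf_neq0 // mul1r [X in _ = _ + X + _]mulrAC.
by rewrite expr2 [_^-1 * _]mulrA mulVf // mul1r.
Qed.

Unset Implicit Arguments.
Set Strict Implicit.
Set Printing Implicit Defensive.

Theorem theorem5p1 (n : nat) (k : fieldType) (hn : (2 <= n)%N)
    (hchar : forall p : nat, p \in [pchar k] -> (n + 1 < 2 * p)%N) :
  (exists2 P : {mpoly int[3]}, trigraded_poincare (@B_part n k) P &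
     let s := svar in let t := tvar in let u := uvar in
     let F := @tofrac {mpoly int[3]} in
     F P = 1 + (F u)^-1 *
             F (1 - (1 + s * u) ^+ n - (1 + t * u) ^+ n
                + mpos_part ((1 - s * t * u ^+ 2)
                             * (1 + s * u) ^+ n * (1 + t * u) ^+ n))
           + (F u) ^- 2 *
             F (mpos_part ((s * t * u ^+ 2 - 1)
                           * (1 + s * u) ^+ n * (1 + t * u) ^+ n))) /\
  (exists2 P : {poly int}, poincare (@B_part n k) P &
     let u := 'X : {poly int} in
     let F := @tofrac {poly int} in
     F P = 1 - 2 * (F u)^-1 * F ((1 + u) ^+ n - 1)
           + (F u)^-1 * F (pos_part ((1 - u ^+ 2) * (1 + u) ^+ (2 * n) - 1))
           + (F u) ^- 2 * F (pos_part ((u ^+ 2 - 1) * (1 + u) ^+ (2 * n)))) /\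
  [/\ total_betti (@B_part n k) 0 1,
      forall i : nat, (1 <= i <= n - 1)%N ->
        exists2 b : nat, total_betti (@B_part n k) i b &
          b%:Z = 'C(2 * n, i + 1)%:Z - 'C(2 * n, i - 1)%:Z - 2 * 'C(n, i + 1)%:Z
    & forall i : nat, (n <= i <= 2 * n)%N ->
        exists2 b : nat, total_betti (@B_part n k) i b &
          b%:Z = 'C(2 * n, i)%:Z - 'C(2 * n, i + 2)%:Z] /\
  krull_dim (B n k) n /\
  depth_is (@max_ideal n k) (B n k) 0.
Proof.
have totalP := total_bettiP hn hchar.
split; [|split; [|split; [split|split]]].
- have [P PP PE] := trigraded_poincare_B hn hchar; exists P => //=.
  apply: tofrac_laurent PE; apply/eqP => /mpolyP/(_ U_(inord 2)%MM)/eqP.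
  by rewrite mcoeffX eqxx mcoeff0 oner_eq0.
- pose P : {poly int} := \poly_(i < (2 * n).+1) (total n i)%:Z.
  have PE i : P`_i = (total n i)%:Z.
    by rewrite coef_poly; case: ltnP => // lt; rewrite total_bound.
  exists P => [i|/=]; first by exists (total n i).
  have := total_series hn PE.
  set E := (1 + 'X) ^+ n - 1; set D := pos_part _; set C := pos_part _.
  have -> : 'X ^+ 2 - 2 * 'X * E + 'X * D + C = 'X ^+ 2 + 'X * (D - 2 * E) + C.
    by move: E D C ('X : {poly int}) => e d c x; ring.
  move/(tofrac_laurent (negbT (polyX_eq0 _))) => ->.
  rewrite tofracB tofracM tofracMn tofrac1.
  by move: ((tofrac 'X)^-1) (tofrac 'X ^- 2) (tofrac D) (tofrac E) (tofrac C) => x y d e c; ring.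
- by rewrite (_ : 1%N = total n 0) //; have := total_low hn (ltnW hn); rewrite /= !bin1; lia.
- move=> i iP; exists (total n i) => //; have lt : (i < n)%N by lia.
  have := total_low hn lt; have -> : (0 < i)%N by lia.
  have -> : (i == 0)%N = false by lia.
  by rewrite !addn1 subn1; lia.
- move=> i iP; exists (total n i) => //; have ge : (n <= i)%N by lia.
  by have := total_high hn ge; rewrite addn2; lia.
- exact: krull_dim_B.
exact: depth_B.
Qed.
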